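(* Let $V_n = V(\sigma_n, L_n, R_n)$, $n\in\mathbb{N}$, and $V = V(\sigma, L, R)$ be Lévy processes (with the notation $V(\sigma,L,R)$ of the context). Then $V_n \xrightarrow{d} V$ as $n\to\infty$ in $D[0,1]$ if and only if $V_n(1) \xrightarrow{d} V(1)$ as $n\to\infty$.
   Context: A Lévy process $V(t)$, $t\ge 0$, is a homogeneous, stochastically continuous random process with independent increments, $V(0)=0$, and trajectories in the Skorohod space (right-continuous with left limits). $D[0,1]$ is the Skorohod space with its usual (Skorohod) metric; a Lévy process is identified with the random element of $D[0,1]$ given by its restriction to $[0,1]$; $\xrightarrow{d}$ denotes convergence in distribution. $V(\sigma,L,R)$ denotes a Lévy process with characteristic function $$\mathbb{E}\, e^{ixV(t)}=\exp\Big[-\frac{\sigma^2x^2t}{2}+t\Big\{\int_{-\infty}^0\Big(e^{ixy}-1-\frac{ixy}{1+y^2}\Big)dL(y)+\int_0^{\infty}\Big(e^{ixy}-1-\frac{ixy}{1+y^2}\Big)dR(y)\Big\}\Big],\quad x\in\mathbb{R},$$ where $L$ is left-continuous and non-decreasing on $(-\infty,0)$ with $L(-\infty)=0$, $R$ is right-continuous and non-decreasing on $(0,\infty)$ with $R(\infty)=0$, and $\int_{-\varepsilon}^0y^2dL(y)+\int_0^{\varepsilon}y^2dR(y)<+\infty$ for all $\varepsilon>0$. (The linear drift parameter $\gamma$ in the Lévy representation is taken to be $0$ throughout.) *)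

(* Defs.v *)
From HB Require Import structures.
From mathcomp Require Import all_boot all_order all_algebra.
From mathcomp Require Import all_classical all_reals all_analysis.
From mathcomp Require Import measurable_realfun complex lra.

Set Implicit Arguments.
Unset Strict Implicit.
Unset Printing Implicit Defensive.

Import Order.TTheory GRing.Theory Num.Theory.
Import numFieldTopology.Exports numFieldNormedType.Exports.

Local Open Scope classical_set_scope.
Local Open Scope ring_scope.

(* Time changes of [0, 1]: the values outside [0, 1] are irrelevant. *)
Definition time_change (R : realType) (l : R -> R) : Prop :=
  [/\ {in `[0, 1] &, {homo l : s t / s < t}},
      {within `[0, 1], continuous l} &
      l @` `[0, 1] = `[0, 1]%classic].

Definition cadlag01 (R : realType) (x : R -> R) : Prop :=
  (forall t, 0 <= t < 1 -> x s @[s --> t^'+] --> x t) /\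
  (forall t, 0 < t <= 1 -> cvg (x s @[s --> t^'-])).

(* D[0, 1]. A path is represented by its extension by 0 to the whole line, so
   that Leibniz equality is equality of the paths on [0, 1]. *)
Record skorohod (R : realType) := Skorohod {
  sk_val :> R -> R ;
  sk_cadlag : cadlag01 sk_val ;
  sk_out : forall t, t \notin `[0, 1] -> sk_val t = 0
}.

HB.instance Definition _ (R : realType) := gen_eqMixin (skorohod R).
HB.instance Definition _ (R : realType) := gen_choiceMixin (skorohod R).

Definition skorohod_close (R : realType) (x y : skorohod R) (e : R) : Prop :=
  exists2 l : R -> R, time_change l &
    forall t, t \in `[0, 1] -> `|l t - t| <= e /\ `|x t - y (l t)| <= e.

(* The infimum over time changes l of the maximum of the sup norms of l - id
   and of x - y \o l on [0, 1]. *)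
Definition skorohod_dist (R : realType) (x y : skorohod R) : R :=
  inf [set e | skorohod_close x y e].

Section skorohod_metric.
Context {R : realType}.
Implicit Types (x y z : skorohod R) (l : R -> R) (t e : R).

Lemma time_change_endpoints l :
  {in `[0, 1] &, {homo l : s t / s < t}} ->
  l @` `[0, 1] = `[0, 1]%classic -> l 0 = 0 /\ l 1 = 1.
Proof.
move=> mo im.
have z01 : (0 : R) \in `[0, 1] by rewrite in_itv/= ler01 lexx.
have o01 : (1 : R) \in `[0, 1] by rewrite in_itv/= ler01 lexx.
have lin t : t \in `[0, 1] -> l t \in `[0, 1].
  move=> t01; have : (l @` `[0, 1]) (l t) by exists t.
  by rewrite im.
have lmo := le_mono_in mo.
split; apply/eqP; rewrite eq_le.
- have := lin _ z01; rewrite in_itv/= => /andP[-> _]; rewrite andbT.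
  have : `[0, 1]%classic (0 : R) by [].
  rewrite -[X in X _]im => -[t t01 lt].
  by rewrite -[leRHS]lt lmo// (itvP t01).
- have := lin _ o01; rewrite in_itv/= => /andP[_ ->] /=.
  have : `[0, 1]%classic (1 : R) by [].
  rewrite -[X in X _]im => -[t t01 lt].
  by rewrite -[leLHS]lt lmo// (itvP t01).
Qed.

Lemma mono_time_change l :
  {in `[0, 1] &, {homo l : s t / s < t}} ->
  l @` `[0, 1] = `[0, 1]%classic -> time_change l.
Proof.
move=> mo im; split => //; apply: segment_inc_surj_continuous.
  exact: le_mono_in.
by have [-> ->] := time_change_endpoints mo im; rewrite /set_surj im.
Qed.

Lemma time_change_id : time_change (@id R).
Proof. by apply: mono_time_change => //; rewrite image_id. Qed.

Lemma time_change_in l t : time_change l -> t \in `[0, 1] -> l t \in `[0, 1].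
Proof.
move=> [_ _ im] t01; have : (l @` `[0, 1]) (l t) by exists t.
by rewrite im.
Qed.

Lemma time_change_comp l l' :
  time_change l -> time_change l' -> time_change (l' \o l).
Proof.
move=> lc lc'; have [mo _ im] := lc; have [mo' _ im'] := lc'.
apply: mono_time_change; last by rewrite -image_comp im im'.
by move=> s t s01 t01 st; apply: mo'; [exact: time_change_in..|exact: mo].
Qed.

Lemma time_change_inv l : time_change l ->
  exists2 k : R -> R, time_change k & forall t, t \in `[0, 1] -> l (k t) = t.
Proof.
move=> lc; have [mo _ im] := lc.
have ex t : exists s, t \in `[0, 1] -> s \in `[0, 1] /\ l s = t.
  have [t01|t01] := boolP (t \in `[0, 1]); last by exists 0.
  have : `[0, 1]%classic t by [].
  by rewrite -[X in X _]im => -[s s01 <-]; exists s.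
have [k kP] := choice ex.
exists k; last by move=> t /kP[].
have inj := inc_inj_in (le_mono_in mo).
apply: mono_time_change.
  move=> s t s01 t01 st.
  have [ks ls] := kP _ s01; have [kt lt] := kP _ t01.
  by rewrite -(leW_mono_in (le_mono_in mo))// ls lt.
apply/seteqP; split => [_ [t t01 <-]|t t01]; first by have [] := kP _ t01.
have lt01 : l t \in `[0, 1] by exact: time_change_in.
exists (l t) => //; have [k01 klt] := kP _ lt01.
exact: inj.
Qed.

Lemma cadlag01_right (x : R -> R) t e : cadlag01 x -> 0 <= t < 1 -> 0 < e ->
  exists2 d, 0 < d & forall s, t <= s < t + d -> `|x t - x s| <= e.
Proof.
move=> [rc _] t01 e0; have /cvgrPdist_le/(_ _ e0)[d /= d0 dP] := rc t t01.
exists d => // s /andP[]; rewrite le_eqVlt => /predU1P[<- _|ts std].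
  by rewrite subrr normr0 ltW.
by apply: dP => //=; rewrite ltr0_norm ?subr_lt0// opprB ltrBlDl.
Qed.

Lemma cadlag01_left (x : R -> R) t : cadlag01 x -> 0 < t <= 1 ->
  exists a, forall e, 0 < e ->
  exists2 d, 0 < d & forall s, t - d < s < t -> `|a - x s| <= e.
Proof.
move=> [_ ll] t01; have /cvg_ex[a xa] := ll t t01; exists a => e e0.
have /cvgrPdist_le/(_ _ e0)[d /= d0 dP] := xa.
exists d => // s /andP[tds st].
by apply: dP => //=; rewrite gtr0_norm ?subr_gt0// ltrBlDr addrC -ltrBlDr.
Qed.

Lemma cadlag01_bounded (x : R -> R) : cadlag01 x ->
  exists M, forall t, t \in `[0, 1] -> `|x t| <= M.
Proof.
move=> cx.
have [] := @compact_near_coveringP R `[0, 1]%classic.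
move=> /(_ (@segment_compact R 0 1)) cov _.
have locb t : t \in `[0, 1] -> exists2 M, \forall s \near t, s \in `[0, 1] ->
    `|x s| <= M & True.
  move=> t01.
  have [M1 [d1 d10 P1]] : exists M1, exists2 d, 0 < d &
      forall s, t - d < s < t -> s \in `[0, 1] -> `|x s| <= M1.
    have [t0|t0] := leP t 0.
      exists 0, 1 => // s /andP[_ st]; rewrite in_itv/= => /andP[s0 _].
      by have := lt_le_trans st t0; rewrite ltNge s0.
    have [] := @cadlag01_left x t cx.
      by rewrite t0; move: t01; rewrite in_itv/= => /andP[].
    move=> a /(_ 1 ltr01)[d d0 dP]; exists (1 + `|a|), d => // s /dP aP _.
    by rewrite -lerBlDr; apply: le_trans aP; rewrite distrC lerB_dist.
  have [M2 [d2 d20 P2]] : exists M2, exists2 d, 0 < d &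
      forall s, t <= s < t + d -> s \in `[0, 1] -> `|x s| <= M2.
    have [t1|t1] := leP 1 t.
      exists `|x 1|, 1 => // s /andP[ts _]; rewrite in_itv/= => /andP[_ s1].
      suff -> : s = 1 by [].
      by apply/eqP; rewrite eq_le s1 (le_trans t1).
    have [] := @cadlag01_right x t 1 cx _ ltr01.
      by rewrite t1 andbT; move: t01; rewrite in_itv/= => /andP[].
    move=> d d0 dP; exists (1 + `|x t|), d => // s /dP aP _.
    by rewrite -lerBlDr; apply: le_trans aP; rewrite distrC lerB_dist.
  exists (Num.max M1 M2) => //.
  exists (Num.min d1 d2) => /=; first by rewrite lt_min d10.
  move=> s /=; rewrite lt_min => /andP[ts1 ts2] s01; rewrite le_max.
  have [st|ts] := ltP s t.
    rewrite P1// st andbT ltrBlDr -ltrBlDl.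
    by move: ts1; rewrite gtr0_norm// subr_gt0.
  apply/orP; right; apply: P2 => //; rewrite ts/= -ltrBlDl.
  by move: ts2; rewrite distrC ger0_norm// subr_ge0.
have /cov : Filter (pinfty_nbhs R) by exact: _.
move=> /(_ (fun M t => t \in `[0, 1] -> `|x t| <= M)) [].
  move=> t /= t01; have [M Mt _] := locb t t01.
  exists ([set s | s \in `[0, 1] -> `|x s| <= M], [set N | M < N]) => //=.
    by split => //; exists M; split => //; exact: num_real.
  by move=> [s N] /= [sM MN] s01; apply: le_trans (sM s01) (ltW MN).
move=> N [_ NP]; exists (N + 1) => t t01.
by apply: NP => //; rewrite ltrDl.
Qed.

Lemma skorohod_close_ge0 x y e : skorohod_close x y e -> 0 <= e.
Proof.
move=> [l _ /(_ 0)]; rewrite in_itv/= lexx ler01 => /(_ isT)[l0 _].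
exact: le_trans l0.
Qed.

Lemma skorohod_close_lbound x y : has_lbound [set e | skorohod_close x y e].
Proof. by exists 0 => e /skorohod_close_ge0. Qed.

Lemma skorohod_close_nonempty x y : [set e | skorohod_close x y e] !=set0.
Proof.
have [M MP] := cadlag01_bounded (sk_cadlag x).
have [N NP] := cadlag01_bounded (sk_cadlag y).
exists (M + N); exists id; first exact: time_change_id.
move=> t t01; rewrite subrr normr0; split.
  by rewrite addr_ge0// ?(le_trans _ (MP t t01)) ?(le_trans _ (NP t t01)).
by rewrite (le_trans (ler_normB _ _))// lerD ?MP ?NP.
Qed.

Lemma skorohod_dist_le x y e : skorohod_close x y e -> skorohod_dist x y <= e.
Proof. by move=> xye; apply: ge_inf => //; exact: skorohod_close_lbound. Qed.

Lemma skorohod_dist_ge0 x y : 0 <= skorohod_dist x y.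
Proof.
apply: lb_le_inf; first exact: skorohod_close_nonempty.
by move=> e /skorohod_close_ge0.
Qed.

Lemma skorohod_dist_adherent x y e : skorohod_dist x y < e ->
  exists2 e', e' < e & skorohod_close x y e'.
Proof.
move=> /inf_lt[|e' xye' e'e]; first exact: skorohod_close_nonempty.
by exists e'.
Qed.

Lemma skorohod_distxx x : skorohod_dist x x = 0.
Proof.
apply/eqP; rewrite eq_le skorohod_dist_ge0 andbT; apply: skorohod_dist_le.
by exists id; [exact: time_change_id|move=> t _; rewrite !subrr normr0].
Qed.

Lemma skorohod_close_sym x y e : skorohod_close x y e -> skorohod_close y x e.
Proof.
move=> [l lc lP]; have [k kc kP] := time_change_inv lc.
exists k => // t t01; have kt01 := time_change_in kc t01.
by have := lP _ kt01; rewrite kP// distrC [`|x _ - _|]distrC.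
Qed.

Lemma skorohod_dist_sym x y : skorohod_dist x y = skorohod_dist y x.
Proof.
by congr inf; apply/seteqP; split => e /=; exact: skorohod_close_sym.
Qed.

Lemma skorohod_dist_triangle y x z :
  skorohod_dist x z <= skorohod_dist x y + skorohod_dist y z.
Proof.
apply/ler_addgt0Pl => e e0; have e20 : 0 < e / 2 by rewrite divr_gt0.
have [a alt [l lc lP]] : exists2 a, a < skorohod_dist x y + e / 2 &
    skorohod_close x y a by apply: skorohod_dist_adherent; rewrite ltrDl.
have [b blt [k kc kP]] : exists2 b, b < skorohod_dist y z + e / 2 &
    skorohod_close y z b by apply: skorohod_dist_adherent; rewrite ltrDl.
apply: (@le_trans _ _ (a + b)); last first.
  rewrite (splitr e); apply: le_trans (ltW (ltrD alt blt)) _.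
  by rewrite addrACA addrC.
apply: skorohod_dist_le; exists (k \o l); first exact: time_change_comp.
move=> t t01; have [l1 l2] := lP _ t01.
have [k1 k2] := kP _ (time_change_in lc t01); split => /=.
  by rewrite [a + b]addrC (le_trans (ler_distD (l t) _ _))// lerD.
by rewrite (le_trans (ler_distD (y (l t)) _ _))// lerD.
Qed.

Lemma skorohod_eq x y : (forall t, t \in `[0, 1] -> x t = y t) -> x = y.
Proof.
case: x y => [f cf fo] [g cg go] /= fg.
have E : f = g.
  apply/funext => t; have [/fg//|t01] := boolP (t \in `[0, 1]).
  by rewrite fo// go.
by subst g; congr Skorohod; exact: Prop_irrelevance.
Qed.

Lemma skorohod_dist_positivity x y : skorohod_dist x y = 0 -> x = y.
Proof.
move=> xy0.
have ap e : 0 < e -> skorohod_close x y e.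
  rewrite -xy0 => /skorohod_dist_adherent[e' /ltW e'e [l lc lP]].
  exists l => // t /lP[l1 l2].
  by split; [exact: le_trans l1 e'e|exact: le_trans l2 e'e].
apply: skorohod_eq => t t01.
apply/eqP; rewrite -subr_eq0 -normr_le0; apply/ler_addgt0Pl => e e0.
rewrite addr0; have := t01; rewrite in_itv/= => /andP[t0 t1].
move: t1; rewrite le_eqVlt => /predU1P[t1|t1].
  have [l lc lP] := ap _ e0.
  have [_ l1] := time_change_endpoints (let: And3 m _ _ := lc in m)
    (let: And3 _ _ i := lc in i).
  by have [_] := lP _ t01; rewrite t1 l1.
have e30 : 0 < e / 3 by rewrite divr_gt0.
have tt : 0 <= t < 1 by rewrite t0.
have [d d0 dP] := cadlag01_right (sk_cadlag x) tt e30.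
have [c c0 cP] := cadlag01_right (sk_cadlag y) tt e30.
pose r := Num.min (Num.min d c) (1 - t).
have r0 : 0 < r by rewrite !lt_min d0 c0 subr_gt0.
have rd : r <= d by rewrite !ge_min lexx.
have rc : r <= c by rewrite !ge_min lexx orbT.
have rt : r <= 1 - t by rewrite !ge_min lexx !orbT.
pose s := t + r / 2.
have r20 : 0 < r / 2 by rewrite divr_gt0.
have r2r : r / 2 < r by rewrite ltr_pdivrMr// ltr_pMr// ltr1n.
have ts : t <= s by rewrite lerDl ltW.
have s01 : s \in `[0, 1].
  rewrite in_itv/= (le_trans t0 ts)/=.
  by rewrite -lerBrDl (le_trans (ltW r2r)).
have [|l lc lP] := ap (Num.min (e / 3) (r / 4)).
  by rewrite lt_min e30 divr_gt0.
have [ls xy] := lP _ s01.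
have lse : `|l s - s| <= r / 4 by rewrite (le_trans ls)// ge_min lexx orbT.
have xye : `|x s - y (l s)| <= e / 3 by rewrite (le_trans xy)// ge_min lexx.
have xs : `|x t - x s| <= e / 3.
  by apply: dP; rewrite ts ltrD2l (lt_le_trans r2r).
have yl : `|y t - y (l s)| <= e / 3.
  apply: cP; move: lse; rewrite ler_norml /s; move: r0 rc => /= ? ? ?; lra.
move: xs xye yl; rewrite !ler_norml.
lra.
Qed.

HB.instance Definition _ := isMetric.Build R (skorohod R)
  skorohod_distxx skorohod_dist_positivity skorohod_dist_sym
  skorohod_dist_triangle.

End skorohod_metric.

(* Only the values on ]0, +oo[ (resp. ]-oo, 0[ below) matter. *)
Record levy_right (R : realType) := LevyRight {
  lr_val :> R -> R ;
  lr_nondecreasing : forall a b, 0 < a -> a <= b -> lr_val a <= lr_val b ;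
  lr_right_continuous : forall a, 0 < a -> lr_val y @[y --> a^'+] --> lr_val a ;
  lr_cvg0 : lr_val y @[y --> +oo] --> (0 : R)
}.

Record levy_left (R : realType) := LevyLeft {
  ll_val :> R -> R ;
  ll_nondecreasing : forall a b, b < 0 -> a <= b -> ll_val a <= ll_val b ;
  ll_left_continuous : forall a, a < 0 -> ll_val y @[y --> a^'-] --> ll_val a ;
  ll_cvg0 : ll_val y @[y --> -oo] --> (0 : R)
}.

(* A levy_right function may tend to -oo at 0, so it need not extend to a
   cumulative function on the line. Its Stieltjes measure on ]0, +oo[ is obtained
   by the increasing change of variables y = exp u (resp. y = - exp u on the
   negative side, where the reversal of orientation also turns left-continuity
   into right-continuity). The lemmas levy_measure_right_itv/_out and
   levy_measure_left_itv/_out below characterize the resulting measures. *)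
Definition levy_right_exp (R : realType) (r : levy_right R) (u : R) : R :=
  r (expR u).

Definition levy_left_exp (R : realType) (l : levy_left R) (u : R) : R :=
  - l (- expR u).

Section cumulative_exp.
Context {R : realType}.

Lemma expR_cvg_right (a : R) : expR y @[y --> a^'+] --> (expR a)^'+.
Proof.
move=> A [e /= e0 eA].
have /cvgrPdist_lt/(_ _ e0) := @continuous_expR R a.
move=> [d /= d0 dP]; exists d => //= y ady ay.
by apply: eA; [exact: dP|rewrite ltr_expR].
Qed.

Let right_nd (r : levy_right R) : nondecreasing (levy_right_exp r).
Proof. by move=> a b ab; apply: lr_nondecreasing; rewrite ?expR_gt0 ?ler_expR. Qed.

Let right_rc (r : levy_right R) : right_continuous (levy_right_exp r).
Proof.
move=> a; apply: (cvg_comp _ _ (@expR_cvg_right a)).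
exact/lr_right_continuous/expR_gt0.
Qed.

HB.instance Definition _ (r : levy_right R) :=
  isCumulative.Build R _ R (levy_right_exp r) (@right_nd r) (@right_rc r).

Let left_nd (l : levy_left R) : nondecreasing (levy_left_exp l).
Proof.
move=> a b ab; rewrite lerN2.
by apply: ll_nondecreasing; rewrite ?oppr_lt0 ?expR_gt0// lerN2 ler_expR.
Qed.

Let left_rc (l : levy_left R) : right_continuous (levy_left_exp l).
Proof.
move=> a; apply: cvgN.
apply: (cvg_comp expR (fun y => l (- y)) (@expR_cvg_right a)).
apply/cvg_at_rightNP.
rewrite [X in X @ _ --> _](_ : _ = ll_val l); last first.
  by apply/funext => y /=; rewrite opprK.
by apply: ll_left_continuous; rewrite oppr_lt0 expR_gt0.
Qed.

HB.instance Definition _ (l : levy_left R) :=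
  isCumulative.Build R _ R (levy_left_exp l) (@left_nd l) (@left_rc l).

End cumulative_exp.

Definition levy_measure_right (R : realType) (r : levy_right R) :
    set (measurableTypeR R) -> \bar R :=
  pushforward (lebesgue_stieltjes_measure (levy_right_exp r)) expR.

Definition levy_measure_left (R : realType) (l : levy_left R) :
    set (measurableTypeR R) -> \bar R :=
  pushforward (lebesgue_stieltjes_measure (levy_left_exp l))
    (fun u => - expR u).

Section levy_measures.
Context {R : realType}.
Local Open Scope ereal_scope.

Let mexp : measurable_fun setT (expR : measurableTypeR R -> measurableTypeR R).
Proof. exact: measurable_expR. Qed.

Let mNexp : measurable_fun setT
  ((fun u => - expR u)%R : measurableTypeR R -> measurableTypeR R).
Proof. by apply: measurableT_comp => //; exact: measurable_expR. Qed.

Local Notation push_measure mf :=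
  (measure_function_pushforward__canonical__measure_function_Measure _ mf).

Let right0 (r : levy_right R) : levy_measure_right r set0 = 0.
Proof. exact: (measure0 (push_measure mexp)). Qed.

Let right_ge0 (r : levy_right R) A : 0 <= levy_measure_right r A.
Proof. exact: (measure_ge0 (push_measure mexp)). Qed.

Let right_sigma (r : levy_right R) : semi_sigma_additive (levy_measure_right r).
Proof. exact: (@measure_semi_sigma_additive _ _ _ (push_measure mexp)). Qed.

HB.instance Definition _ (r : levy_right R) := isMeasure.Build _ _ _
  (levy_measure_right r) (@right0 r) (@right_ge0 r) (@right_sigma r).

Let left0 (l : levy_left R) : levy_measure_left l set0 = 0.
Proof. exact: (measure0 (push_measure mNexp)). Qed.

Let left_ge0 (l : levy_left R) A : 0 <= levy_measure_left l A.
Proof. exact: (measure_ge0 (push_measure mNexp)). Qed.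

Let left_sigma (l : levy_left R) : semi_sigma_additive (levy_measure_left l).
Proof. exact: (@measure_semi_sigma_additive _ _ _ (push_measure mNexp)). Qed.

HB.instance Definition _ (l : levy_left R) := isMeasure.Build _ _ _
  (levy_measure_left l) (@left0 l) (@left_ge0 l) (@left_sigma l).

Let ls_itv (f : cumulative R R) a b : (a <= b)%R ->
  lebesgue_stieltjes_measure f `]a, b] = (f b - f a)%:E.
Proof.
move=> ab; rewrite /lebesgue_stieltjes_measure/= /measure_extension/=.
rewrite measurable_mu_extE/=; last exact: is_ocitv.
exact: wlength_itv_bnd.
Qed.

Lemma levy_measure_right_itv (r : levy_right R) a b : (0 < a)%R -> (a <= b)%R ->
  levy_measure_right r `]a, b] = (r b - r a)%:E.
Proof.
move=> a0 ab; have b0 := lt_le_trans a0 ab.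
rewrite /levy_measure_right /pushforward.
rewrite [X in lebesgue_stieltjes_measure _ X](_ : _ = `]ln a, ln b]%classic).
  by rewrite ls_itv ?ler_ln//= /levy_right_exp (lnK a0) (lnK b0).
apply/seteqP; split => u /=; rewrite !in_itv/=.
  by rewrite -{1}(lnK a0) -{1}(lnK b0) ltr_expR ler_expR.
by rewrite -{2}(lnK a0) -{2}(lnK b0) ltr_expR ler_expR.
Qed.

Lemma levy_measure_right_out (r : levy_right R) :
  levy_measure_right r `]-oo, 0%R] = 0.
Proof.
rewrite /levy_measure_right /pushforward.
rewrite [X in lebesgue_stieltjes_measure _ X](_ : _ = set0) ?measure0//.
by apply/seteqP; split => u //=; rewrite in_itv/= leNgt expR_gt0.
Qed.

Lemma levy_measure_left_itv (l : levy_left R) a b : (b < 0)%R -> (a <= b)%R ->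
  levy_measure_left l `[a, b[ = (l b - l a)%:E.
Proof.
move=> b0 ab; have a0 := le_lt_trans ab b0.
have Na0 : (0 < - a)%R by rewrite oppr_gt0.
have Nb0 : (0 < - b)%R by rewrite oppr_gt0.
rewrite /levy_measure_left /pushforward.
rewrite [X in lebesgue_stieltjes_measure _ X]
  (_ : _ = `]ln (- b), ln (- a)]%classic).
  rewrite ls_itv ?ler_ln ?lerN2//= /levy_left_exp (lnK Na0) (lnK Nb0) !opprK.
  by rewrite addrC.
apply/seteqP; split => u /=; rewrite !in_itv/=.
  rewrite lerNr ltrNl -{1}(lnK Na0) -{1}(lnK Nb0) ltr_expR ler_expR.
  by rewrite andbC.
rewrite lerNr ltrNl -{2}(lnK Na0) -{2}(lnK Nb0) ltr_expR ler_expR.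
by rewrite andbC.
Qed.

Lemma levy_measure_left_out (l : levy_left R) :
  levy_measure_left l `[0%R, +oo[ = 0.
Proof.
rewrite /levy_measure_left /pushforward.
rewrite [X in lebesgue_stieltjes_measure _ X](_ : _ = set0) ?measure0//.
by apply/seteqP; split => u //=; rewrite in_itv/= andbT oppr_ge0 leNgt expR_gt0.
Qed.

End levy_measures.

Record levy_triplet (R : realType) := LevyTriplet {
  triplet_sigma : R ;
  triplet_left : levy_left R ;
  triplet_right : levy_right R ;
  triplet_integrable : forall e : R, 0 < e ->
    (\int[levy_measure_left triplet_left]_(y in `[(- e)%R, 0%R[) (y ^+ 2)%:E +
     \int[levy_measure_right triplet_right]_(y in `]0%R, e]) (y ^+ 2)%:E < +oo)%E
}.

Definition cexp (R : realType) (z : R[i]) : R[i] :=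
  ((expR (complex.Re z) * cos (complex.Im z)) +i*
   (expR (complex.Re z) * sin (complex.Im z)))%C.

Definition cintegral d (T : measurableType d) (R : realType)
    (mu : {measure set T -> \bar R}) (D : set T) (f : T -> R[i]) : R[i] :=
  ((\int[mu]_(y in D) complex.Re (f y)) +i*
   (\int[mu]_(y in D) complex.Im (f y)))%C.

Local Open Scope complex_scope.

Definition levy_integrand (R : realType) (x y : R) : R[i] :=
  cexp ('i * (x * y)%:C) - 1 - 'i * (x * y / (1 + y ^+ 2))%:C.

(* Levy-Khintchine exponent with zero drift. *)
Definition levy_exponent (R : realType) (G : levy_triplet R) (t x : R) : R[i] :=
  - ((triplet_sigma G) ^+ 2 * x ^+ 2 * t / 2)%:C +
  t%:C * (cintegral (levy_measure_left (triplet_left G)) `]-oo, 0[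
            (levy_integrand x) +
          cintegral (levy_measure_right (triplet_right G)) `]0, +oo[
            (levy_integrand x)).

Section levy_process.
Context d (T : measurableType d) (R : realType) (P : probability T R).

Definition increment (V : R -> T -> R) (s t : R) : T -> R :=
  fun w => V t w - V s w.

Definition stationary_increments (V : R -> T -> R) : Prop :=
  forall s t (B : set R), 0 <= s -> 0 <= t -> measurable B ->
    P (increment V s (s + t) @^-1` B) = P (increment V 0 t @^-1` B).

Definition independent_increments (V : R -> T -> R) : Prop :=
  forall (n : nat) (t : nat -> R) (B : nat -> set R),
    0 <= t 0%N -> {homo t : i j / (i <= j)%N >-> i <= j} ->
    (forall i, measurable (B i)) ->
    P (\bigcap_(i < n) (increment V (t i) (t i.+1) @^-1` B i)) =
    (\prod_(i < n) P (increment V (t i) (t i.+1) @^-1` B i))%E.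

Definition stochastically_continuous (V : R -> T -> R) : Prop :=
  forall t e : R, 0 <= t -> 0 < e ->
    P [set w | e <= `|V s w - V t w|]
      @[s --> within [set s | 0 <= s] (nbhs t)] --> 0%E.

Definition cadlag (x : R -> R) : Prop :=
  (forall t, 0 <= t -> x s @[s --> t^'+] --> x t) /\
  (forall t, 0 < t -> cvg (x s @[s --> t^'-])).

(* Only the times t >= 0 matter. *)
Record levy_process := LevyProcess {
  lp_val :> R -> T -> R ;
  lp_measurable : forall t, 0 <= t -> measurable_fun setT (lp_val t) ;
  lp_start : forall w, lp_val 0 w = 0 ;
  lp_stationary : stationary_increments lp_val ;
  lp_independent : independent_increments lp_val ;
  lp_stoch_cont : stochastically_continuous lp_val ;
  lp_cadlag : forall w, cadlag (fun t => lp_val t w)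
}.

Definition has_triplet (V : levy_process) (G : levy_triplet R) : Prop :=
  forall t x : R, 0 <= t ->
    cintegral P setT (fun w => cexp ('i * (x * V t w)%:C)) =
    cexp (levy_exponent G t x).

Definition restrict01 (x : R -> R) : R -> R := x \_ `[0, 1].

Lemma restrict01_cadlag (x : R -> R) : cadlag x -> cadlag01 (restrict01 x).
Proof.
move=> [rc ll].
have E t : t \in `[0, 1] -> restrict01 x t = x t.
  by move=> t01; rewrite /restrict01 patchT// inE.
split => t /andP[t0 t1].
  rewrite E; last by rewrite in_itv/= t0 ltW.
  apply: cvg_trans (rc t t0); apply: near_eq_cvg.
  near=> s; rewrite E// in_itv/=; apply/andP; split.
    apply: (le_trans t0); near: s; exact: nbhs_right_ge.
  by near: s; exact: nbhs_right_le.
have /cvg_ex[a xa] := ll t t0; apply/cvg_ex; exists a.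
apply: cvg_trans xa; apply: near_eq_cvg.
near=> s; rewrite E// in_itv/=; apply/andP; split.
  by near: s; exact: nbhs_left_ge.
apply: le_trans t1; near: s; exact: nbhs_left_le.
Unshelve. all: by end_near. Qed.

Lemma restrict01_out (x : R -> R) t : t \notin `[0, 1] -> restrict01 x t = 0.
Proof. by move=> t01; rewrite /restrict01 patchC// inE /=; apply/negP. Qed.

Definition levy_path (V : levy_process) (w : T) : skorohod R :=
  Skorohod (restrict01_cadlag (lp_cadlag V w))
    (@restrict01_out (fun t => V t w)).

End levy_process.

(* The random elements may live on different probability spaces. Measurability of
   X is not imposed: paths of measurable cadlag processes are automatically Borel
   random elements of D[0, 1] with the Skorohod topology, so that the expectations
   below are genuine ones whenever X is levy_path of a Levy process. *)
Definition cvg_in_distribution (R : realType) (S : topologicalType)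
    (d : nat -> measure_display) (T : forall n, measurableType (d n))
    (P : forall n, probability (T n) R) (X : forall n, T n -> S)
    (d0 : measure_display) (T0 : measurableType d0) (P0 : probability T0 R)
    (X0 : T0 -> S) : Prop :=
  forall f : S -> R, continuous f -> (exists M, forall s, `|f s| <= M) ->
    ('E_(P n)[f \o X n] @[n --> \oo] --> 'E_P0[f \o X0])%E.

(* Main.v *)
Require Import Defs.
From HB Require Import structures.
From mathcomp Require Import all_boot all_order all_algebra.
From mathcomp Require Import all_classical all_reals all_analysis.
From mathcomp Require Import measurable_realfun complex lra ring.

Set Implicit Arguments.
Unset Strict Implicit.
Unset Printing Implicit Defensive.

Import Order.TTheory GRing.Theory Num.Theory.
Import numFieldTopology.Exports numFieldNormedType.Exports.

Local Open Scope classical_set_scope.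
Local Open Scope ring_scope.

(** Evaluation at 1 is continuous on D[0, 1], because time changes fix 1
    ([skorohod_eval1_continuous]); this gives one implication.

    For the other one, suppose that V_n(1) converges to V(1) in distribution.
    The characteristic functions then converge locally uniformly. By the
    Levy-Khintchine formula the characteristic function at time t / 2 is a
    continuous square root, equal to 1 at 0, of the one at time t, and that of
    the limit does not vanish. Such a root depends continuously on its square
    ([sqrt_close]), so that the characteristic functions of V_n(t) converge for
    every t = 1 / 2 ^ m ([dyadic_cf_cvg_tight]). Trigonometric polynomials that
    approximate the indicator of a half-line on a large interval
    ([trig_poly_step]) turn this into convergence of the distribution functions
    ([cdf_cvg]). The increments of V_n over the grid of mesh 1 / k are
    independent with the law of V_n(1 / k), hence for a fixed k = 2 ^ m the
    paths discretized at the points j / k converge in distribution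
    ([grid_path_mean_cvg]).

    It remains to compare a path with its discretization, uniformly in n. If the
    path has, up to e, a single jump in each cell of the grid and does not move
    in the last cell, then a time change that moves these jumps to the right
    ends of the cells shows that it is within max (1 / k, e) of its
    discretization ([one_switch_close]). Two disjoint large displacements in one
    cell have a probability of order p ^ 2, where p = P (|V_n(1 / k)| > e)
    ([double_exit_small]), and the comparison fails with a probability of order
    k p ^ 2 + p ([grid_refine_close]). For large n, p is controlled by the same
    quantity for V; and k p ^ 2 tends to 0 for V, since otherwise the cadlag
    paths of V would have large increments on two adjacent cells of arbitrarily
    fine grids, the pairs of adjacent cells being independent trials
    ([levy_pair_cvg0]).

    This proves the convergence of the expectations of bounded Lipschitz
    functionals ([lipschitz_mean_cvg]). A bounded continuous functional and its
    opposite are limits of increasing sequences of such functionals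
    ([lipschitz_minorant_cvg]), hence the theorem. *)

(** * Bounded random variables *)

Definition bounded_rv d (T : measurableType d) (R : realType) (X : T -> R) :=
  measurable_fun setT X /\ exists M, forall w, `|X w| <= M.

Section expectation.
Context d (T : measurableType d) (R : realType) (P : probability T R).
Implicit Types (X Y : T -> R) (A B : set T).

Definition mean X : R := \int[P]_w X w.

Definition prob A : R := fine (P A).

Lemma bounded_rv_integrable X : bounded_rv X -> P.-integrable setT (EFin \o X).
Proof.
move=> [mX [M XM]]; apply: measurable_bounded_integrable => //.
  by rewrite (le_lt_trans (probability_le1 _ _)) ?ltry.
exists M; split; first exact: num_real.
by move=> N MN w _; apply: le_trans (ltW MN).
Qed.

Lemma expectation_mean X : bounded_rv X -> ('E_P[X] = (mean X)%:E)%E.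
Proof.
move=> bX; rewrite /mean /Rintegral fineK; last first.
  by apply: integrable_fin_num => //; exact: bounded_rv_integrable.
by rewrite unlock.
Qed.

Lemma bounded_rv_cst (c : R) : bounded_rv (fun _ : T => c).
Proof. by split; [exact: measurable_cst|exists `|c|]. Qed.

Lemma bounded_rvD X Y : bounded_rv X -> bounded_rv Y ->
  bounded_rv (fun w => X w + Y w).
Proof.
move=> [mX [M XM]] [mY [N YN]]; split; first exact: measurable_funD.
by exists (M + N) => w; rewrite (le_trans (ler_normD _ _))// lerD.
Qed.

Lemma bounded_rvM X Y : bounded_rv X -> bounded_rv Y ->
  bounded_rv (fun w => X w * Y w).
Proof.
move=> [mX [M XM]] [mY [N YN]]; split; first exact: measurable_funM.
by exists (M * N) => w; rewrite normrM ler_pM.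
Qed.

Lemma bounded_rvZ c X : bounded_rv X -> bounded_rv (fun w => c * X w).
Proof. exact/bounded_rvM/bounded_rv_cst. Qed.

Lemma bounded_rvB X Y : bounded_rv X -> bounded_rv Y ->
  bounded_rv (fun w => X w - Y w).
Proof.
move=> bX [mY [M YM]]; apply: bounded_rvD => //; split.
  exact: measurableT_comp.
by exists M => w; rewrite normrN.
Qed.

Lemma bounded_rv_sum I (r : seq I) (X : I -> T -> R) :
  (forall i, bounded_rv (X i)) -> bounded_rv (fun w => \sum_(i <- r) X i w).
Proof.
move=> bX; elim: r => [|i r IH].
  rewrite (_ : (fun _ => _) = fun=> 0); first exact: bounded_rv_cst.
  by apply/funext => w; rewrite big_nil.
rewrite (_ : (fun _ => _) = fun w => X i w + \sum_(j <- r) X j w).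
  exact: bounded_rvD.
by apply/funext => w; rewrite big_cons.
Qed.

Lemma bounded_rv_indic A : measurable A -> bounded_rv (\1_A : T -> R).
Proof.
move=> mA; split; first exact: measurable_indic.
by exists 1 => w; rewrite indicE; case: (_ \in _); rewrite ?normr1 ?normr0.
Qed.

Lemma mean_cst (c : R) : mean (fun=> c) = c.
Proof. by rewrite /mean Rintegral_cst//= probability_setT mulr1. Qed.

Lemma meanD X Y : bounded_rv X -> bounded_rv Y ->
  mean (fun w => X w + Y w) = mean X + mean Y.
Proof. by move=> bX bY; rewrite /mean RintegralD//; exact: bounded_rv_integrable. Qed.

Lemma meanB X Y : bounded_rv X -> bounded_rv Y ->
  mean (fun w => X w - Y w) = mean X - mean Y.
Proof. by move=> bX bY; rewrite /mean RintegralB//; exact: bounded_rv_integrable. Qed.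

Lemma meanZ c X : bounded_rv X -> mean (fun w => c * X w) = c * mean X.
Proof. by move=> bX; rewrite /mean RintegralZl//; exact: bounded_rv_integrable. Qed.

Lemma mean_sum I (r : seq I) (X : I -> T -> R) : (forall i, bounded_rv (X i)) ->
  mean (fun w => \sum_(i <- r) X i w) = \sum_(i <- r) mean (X i).
Proof.
move=> bX; elim: r => [|i r IH].
  rewrite big_nil -[RHS](mean_cst 0); congr mean.
  by apply/funext => w; rewrite big_nil.
rewrite big_cons -IH -meanD//; last exact: bounded_rv_sum.
by congr mean; apply/funext => w; rewrite big_cons.
Qed.

Lemma le_mean X Y : bounded_rv X -> bounded_rv Y -> (forall w, X w <= Y w) ->
  mean X <= mean Y.
Proof.
by move=> bX bY XY; apply: le_Rintegral => //; exact: bounded_rv_integrable.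
Qed.

Lemma mean_indic A : measurable A -> mean (\1_A) = prob A.
Proof.
move=> mA; rewrite /mean /Rintegral; congr fine.
by rewrite integral_indic// setIT.
Qed.

Lemma prob_fin A : measurable A -> P A = (prob A)%:E.
Proof. by move=> mA; rewrite fineK// fin_num_measure. Qed.

Lemma prob_ge0 A : 0 <= prob A. Proof. exact: fine_ge0. Qed.

Lemma prob_le1 A : measurable A -> prob A <= 1.
Proof. by move=> mA; rewrite -lee_fin -prob_fin// probability_le1. Qed.

Lemma prob_setT : prob setT = 1. Proof. by rewrite /prob probability_setT. Qed.

Lemma prob_set0 : prob set0 = 0. Proof. by rewrite /prob measure0. Qed.

Lemma le_prob A B : measurable A -> measurable B -> A `<=` B -> prob A <= prob B.
Proof. by move=> mA mB AB; rewrite -lee_fin -!prob_fin// le_measure// inE. Qed.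

Lemma prob_setC A : measurable A -> prob (~` A) = 1 - prob A.
Proof.
move=> mA; apply: EFin_inj; rewrite EFinB -!prob_fin//; last exact: measurableC.
exact: probability_setC.
Qed.

Lemma prob_setU A B : measurable A -> measurable B ->
  prob (A `|` B) <= prob A + prob B.
Proof.
move=> mA mB; rewrite -lee_fin EFinD -!prob_fin//; last exact: measurableU.
exact: measureU2.
Qed.

Lemma prob_setD A B : measurable A -> measurable B ->
  prob A = prob (A `\` B) + prob (A `&` B).
Proof.
move=> mA mB; apply: EFin_inj; rewrite EFinD -!prob_fin//.
- exact: measureDI.
- exact: measurableI.
- exact: measurableD.
Qed.

Lemma prob_bigcup (n : nat) (A : nat -> set T) : (forall i, measurable (A i)) ->
  prob (\bigcup_(i < n) A i) <= \sum_(i < n) prob (A i).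
Proof.
move=> mA; elim: n => [|n IH].
  by rewrite big_ord0 bigcup_mkord big_ord0 prob_set0.
rewrite big_ord_recr/= (_ : \bigcup_(i < n.+1) A i =
    (\bigcup_(i < n) A i) `|` A n); last first.
  by rewrite !bigcup_mkord big_ord_recr.
rewrite (le_trans (prob_setU _ _))// ?lerD2r//.
exact: bigcup_measurable.
Qed.

Lemma prob_bigcup_disjoint (n : nat) (A : nat -> set T) :
  (forall i, measurable (A i)) -> trivIset setT A ->
  prob (\bigcup_(i < n) A i) = \sum_(i < n) prob (A i).
Proof.
move=> mA tA; apply: EFin_inj; rewrite -prob_fin; last exact: bigcup_measurable.
rewrite bigcup_mkord measure_bigsetU//.
by rewrite -sumEFin; apply: eq_bigr => i _; exact: prob_fin.
Qed.

Lemma mean_close X Y A (e M : R) : bounded_rv X -> bounded_rv Y -> measurable A ->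
  0 <= e -> (forall w, `|X w| <= M) -> (forall w, `|Y w| <= M) ->
  (forall w, ~ A w -> `|X w - Y w| <= e) ->
  `|mean X - mean Y| <= e + 2 * M * prob A.
Proof.
move=> bX bY mA e0 XM YM XYe.
have bA := bounded_rv_indic mA.
have bZ : bounded_rv (fun w => e + 2 * M * \1_A w).
  by apply: bounded_rvD; [exact: bounded_rv_cst|exact: bounded_rvZ].
have EZ : mean (fun w => e + 2 * M * \1_A w) = e + 2 * M * prob A.
  rewrite meanD ?mean_cst ?meanZ ?mean_indic//; first exact: bounded_rv_cst.
  exact: bounded_rvZ.
have D w : `|X w - Y w| <= e + 2 * M * \1_A w.
  rewrite indicE; have [wA|wA] := boolP (w \in A).
    rewrite mulr1 (le_trans (ler_normB _ _))//.
    by move: (XM w) (YM w); lra.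
  by rewrite mulr0 addr0 XYe//; move: wA; rewrite notin_setE.
rewrite -meanB// ler_norml -EZ; apply/andP; split; last first.
  by apply: le_mean => //; [exact: bounded_rvB|move=> w; have := D w; rewrite ler_norml => /andP[]].
rewrite -[- mean _]mulN1r -meanZ//; apply: le_mean.
- exact: bounded_rvZ.
- exact: bounded_rvB.
- by move=> w; rewrite mulN1r; have := D w; rewrite ler_norml => /andP[].
Qed.

Lemma mean_cvg (X_ : nat -> T -> R) X (M : R) : (forall n, measurable_fun setT (X_ n)) ->
  (forall n w, `|X_ n w| <= M) -> (forall w, X_ ^~ w @ \oo --> X w) ->
  mean (X_ n) @[n --> \oo] --> mean X.
Proof.
move=> mX XM cX.
have mX0 : measurable_fun setT X.
  by apply: (@measurable_fun_cvg _ _ _ _ X_) => // w _.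
have XM0 w : `|X w| <= M.
  by apply: (cvgr_to_le (cvg_norm (cX w))); exact: nearW.
have [] := @dominated_convergence _ T R P setT measurableT
    (fun n => EFin \o X_ n) (EFin \o X) (cst M%:E).
- by move=> n; exact/measurable_EFinP.
- exact/measurable_EFinP.
- apply: aeW => w _.  apply: cvg_EFin; first exact: nearW. exact: cX.
- by apply: (@finite_measure_integrable_cst _ _ _ P _ M).
- by apply: aeW => w n _ /=; rewrite lee_fin.

move=> _ _ cvgI; rewrite /mean /Rintegral; apply: fine_cvg; rewrite fineK//.
apply: integrable_fin_num => //; apply: bounded_rv_integrable; split => //.
by exists M.
Qed.

End expectation.

Section measurable_levels.
Context d (T : measurableType d) (R : realType).
Implicit Types (f : T -> R) (c : R).

Lemma measurable_gt f c : measurable_fun setT f -> measurable [set w | c < f w].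
Proof.
move=> mf; rewrite (_ : [set w | _] = setT `&` f @^-1` `]c, +oo[); first exact: mf.
by apply/seteqP; split=> w /=; rewrite in_itv/= andbT => // -[].
Qed.

Lemma measurable_ge f c : measurable_fun setT f -> measurable [set w | c <= f w].
Proof.
move=> mf; rewrite (_ : [set w | _] = setT `&` f @^-1` `[c, +oo[); first exact: mf.
by apply/seteqP; split=> w /=; rewrite in_itv/= andbT => // -[].
Qed.

Lemma measurable_lt f c : measurable_fun setT f -> measurable [set w | f w < c].
Proof.
move=> mf; rewrite (_ : [set w | _] = setT `&` f @^-1` `]-oo, c[); first exact: mf.
by apply/seteqP; split=> w /=; rewrite in_itv/= => // -[].
Qed.

Lemma measurable_le f c : measurable_fun setT f -> measurable [set w | f w <= c].
Proof.
move=> mf; rewrite (_ : [set w | _] = setT `&` f @^-1` `]-oo, c]); first exact: mf.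
by apply/seteqP; split=> w /=; rewrite in_itv/= => // -[].
Qed.

End measurable_levels.

Lemma in_setb (T : Type) (b : T -> bool) w : (w \in [set w | b w]) = b w.
Proof. by apply/idP/idP; rewrite inE. Qed.

(** * Step paths and the Skorohod distance *)

Section step_path.
Context {R : realType}.
Implicit Types (k : nat) (v : nat -> R) (x y : skorohod R) (e : R).

Lemma truncn_scale k (t : R) b : 0 <= t ->
  (b%:R <= k%:R * t < b.+1%:R) -> Num.truncn (k%:R * t) = b.
Proof. by move=> t0 bt; apply/eqP; rewrite truncn_eq// mulr_ge0. Qed.

Definition step_fun k v (t : R) : R :=
  if t \in `[0, 1] then v (Num.truncn (k%:R * t)) else 0.

Lemma step_fun_cadlag k v : cadlag01 (step_fun k v).
Proof.
have [-> |k0] := posnP k.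
  have E t : t \in `[0, 1] -> step_fun 0 v t = v 0%N.
    by move=> t01; rewrite /step_fun t01 mul0r truncn0.
  split=> t /andP[t0 t1].
    rewrite E ?in_itv/= ?t0 ?(ltW t1)//.
    apply: cvg_near_cst; near=> s; rewrite E// in_itv/=; apply/andP; split.
      by apply: (le_trans t0); near: s; exact: nbhs_right_ge.
    by near: s; exact: nbhs_right_le.
  apply/cvg_ex; exists (v 0%N).
  apply: cvg_near_cst; near=> s; rewrite E// in_itv/=; apply/andP; split.
    by near: s; exact: nbhs_left_ge.
  by apply: le_trans t1; near: s; exact: nbhs_left_le.
have kR0 : 0 < k%:R :> R by rewrite ltr0n.
split=> t /andP[t0 t1].
  set b := Num.truncn (k%:R * t).
  have /andP[bt tb] : b%:R <= k%:R * t < b.+1%:R.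
    by rewrite truncn_itv// mulr_ge0// ltW.
  have -> : step_fun k v t = v b by rewrite /step_fun in_itv/= t0 ltW.
  apply: cvg_near_cst; near=> s.
  have ts : t <= s by near: s; exact: nbhs_right_ge.
  have s1 : s <= 1 by near: s; exact: nbhs_right_le.
  have sb : s < b.+1%:R / k%:R.
    by near: s; apply: nbhs_right_lt; rewrite ltr_pdivlMr// mulrC.
  have s0 := le_trans t0 ts.
  rewrite /step_fun in_itv/= s0 s1/=; congr v; apply: truncn_scale => //.
  rewrite (le_trans bt) ?ler_pM2l//=.
  by rewrite mulrC -ltr_pdivlMr.
pose b0 := Num.truncn (k%:R * t).
have /andP[bt tb] : b0%:R <= k%:R * t < b0.+1%:R.
  by rewrite truncn_itv// mulr_ge0// ltW.
have [b [bt1 tb1]] : exists b : nat, b%:R < k%:R * t /\ k%:R * t <= b.+1%:R.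
  move: bt; rewrite le_eqVlt => /predU1P[bt|bt]; last by exists b0; split; last exact: ltW.
  have : (0 < b0)%N by rewrite -(ltr0n R) bt mulr_gt0.
  case: b0 bt {tb} => // b bt _; exists b; rewrite -bt; split => //.
  by rewrite ltr_nat.
apply/cvg_ex; exists (v b).
apply: cvg_near_cst; near=> s.
have st : s < t by near: s; exact: nbhs_left_lt.
have s0 : 0 <= s by near: s; exact: nbhs_left_ge.
have sb : b%:R / k%:R < s.
  by near: s; apply: nbhs_left_gt; rewrite ltr_pdivrMr// mulrC.
rewrite /step_fun in_itv/= s0 (le_trans (ltW st) t1)/=; congr v.
apply: truncn_scale => //; rewrite mulrC -ler_pdivrMr// ltW//=.
by rewrite mulrC (lt_le_trans _ tb1)// ltr_pM2l.
Unshelve. all: by end_near. Qed.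

Lemma step_fun_out k v t : t \notin `[0, 1] -> step_fun k v t = 0.
Proof. by rewrite /step_fun => /negPf ->. Qed.

Definition step_path k v : skorohod R :=
  Skorohod (step_fun_cadlag k v) (@step_fun_out k v).

Lemma step_close k v v' e : (forall j, (j <= k)%N -> `|v j - v' j| <= e) ->
  skorohod_close (step_path k v) (step_path k v') e.
Proof.
move=> vv; exists id; first exact: time_change_id.
move=> t t01; have e0 : 0 <= e by apply: le_trans (vv 0%N _).
rewrite subrr normr0; split => //=; rewrite /step_fun t01; apply: vv.
rewrite -(ler_nat R); apply: (@le_trans _ _ (k%:R * t)).
  by rewrite truncn_le// mulr_ge0// (itvP t01).
by rewrite ler_piMr// (itvP t01).
Qed.

Section time_change_nodes.
Variables (k : nat) (g : nat -> R).
Hypotheses (k0 : (0 < k)%N) (g0 : g 0%N = 0) (gk : g k = 1).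
Hypothesis gb : forall b, (b < k)%N -> g b <= b%:R / k%:R < g b.+1.

Let kR0 : 0 < k%:R :> R. Proof. by rewrite ltr0n. Qed.

Let glt b : (b < k)%N -> g b < g b.+1.
Proof. by move=> /gb/andP[]; exact: le_lt_trans. Qed.

Let gle a b : (a <= b <= k)%N -> g a <= g b.
Proof.
move=> /andP[]; elim: b => [|b IH].
  by rewrite leqn0 => /eqP ->.
rewrite leq_eqVlt => /predU1P[-> //|ab bk].
exact: le_trans (IH ab (ltnW bk)) (ltW (glt bk)).
Qed.

Let ind (t : R) := Num.truncn (k%:R * t).

(** The piecewise linear map sending b / k to g b. *)
Let l (t : R) := g (ind t) + (k%:R * t - (ind t)%:R) * (g (ind t).+1 - g (ind t)).

Let indP t : 0 <= t -> (ind t)%:R <= k%:R * t < (ind t).+1%:R.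
Proof. by move=> t0; rewrite truncn_itv// mulr_ge0. Qed.

Let ind_lt t : 0 <= t < 1 -> (ind t < k)%N.
Proof.
move=> /andP[t0 t1]; rewrite -(ltr_nat R); have /andP[it _] := indP t0.
by apply: (le_lt_trans it); rewrite gtr_pMr.
Qed.

Let ind1 : ind 1 = k. Proof. by rewrite /ind mulr1 natrK. Qed.

Let l1 : l 1 = 1. Proof. by rewrite /l ind1 mulr1 subrr mul0r addr0. Qed.

Let l_itv t : 0 <= t < 1 -> g (ind t) <= l t < g (ind t).+1.
Proof.
move=> t01; have /andP[t0 _] := t01.
have := glt (ind_lt t01); have /andP[] := indP t0; rewrite /l -natr1.
set i := _%:R; set a := g _; set b := g _ => h1 h2 h3.
have h : 0 <= k%:R * t - i < 1 by apply/andP; split; lra.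
move: h; set c := _ - i => /andP[c0 c1].
rewrite lerDl mulr_ge0//=; last by lra.
rewrite -[X in _ < X](subrK a) addrC ltrD2r gtr_pMl//; lra.
Qed.

Let l_homo : {in `[0, 1] &, {homo l : s t / s < t}}.
Proof.
move=> s t; rewrite !in_itv/= => /andP[s0 s1] /andP[t0 t1] st.
have s01 : 0 <= s < 1 by rewrite s0 (lt_le_trans st).
have /andP[_ lsb] := l_itv s01.
have ist : (ind s <= ind t)%N by apply: le_truncn; rewrite ler_pM2l// ltW.
move: ist; rewrite leq_eqVlt => /predU1P[ist|ist].
  have itk : (ind t < k)%N by rewrite -ist ind_lt.
  rewrite /l ist ltrD2l ltr_pM2r ?subr_gt0 ?glt// ltrD2r ltr_pM2l//.
apply: (lt_le_trans lsb).
move: t1; rewrite le_eqVlt => /predU1P[t1|t1].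
  by move: ist; rewrite t1 l1 ind1 -gk => ist; apply: gle; rewrite ist leqnn.
have t01 : 0 <= t < 1 by rewrite t0.
have /andP[ltb _] := l_itv t01.
by apply: le_trans ltb; apply: gle; rewrite ist ltnW// ind_lt.
Qed.

Let l_hit b u : (b < k)%N -> g b <= u < g b.+1 ->
  exists2 t, 0 <= t < 1 & l t = u.
Proof.
move=> bk /andP[gbu ugb]; have gg := glt bk.
pose c := (u - g b) / (g b.+1 - g b).
have c0 : 0 <= c by rewrite divr_ge0// ?subr_ge0// ltW.
have c1 : c < 1 by rewrite ltr_pdivrMr ?subr_gt0// mul1r ltrD2r.
pose t := (b%:R + c) / k%:R.
have kt : k%:R * t = b%:R + c by rewrite mulrC divfK// gt_eqF.
have t0 : 0 <= t by rewrite divr_ge0// addr_ge0.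
have it : ind t = b.
  by apply: truncn_scale => //; rewrite kt lerDl c0 -natr1 ltrD2l.
exists t.
  rewrite t0 ltr_pdivrMr// mul1r (lt_le_trans (_ : _ < b.+1%:R))//.
    by rewrite -natr1 ltrD2l.
  by rewrite ler_nat.
rewrite /l it kt [_ + c]addrC addrK /c divfK ?subr_eq0 ?gt_eqF//.
by rewrite addrC subrK.
Qed.

Let l_image : l @` `[0, 1] = `[0, 1]%classic.
Proof.
apply/seteqP; split=> [_ [t + <-]|u] /=; rewrite !in_itv/= => /andP[t0 t1].
  move: t1; rewrite bnd_simp le_eqVlt => /predU1P[-> |t1]; first by rewrite l1 ler01 lexx.
  have t01 : 0 <= t < 1 by rewrite t1 andbT.
  have /andP[h1 h2] := l_itv t01; apply/andP; split.
    by apply: le_trans h1; rewrite -g0; apply: gle; rewrite leq0n ltnW// ind_lt.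
  by apply: (le_trans (ltW h2)); rewrite -gk; apply: gle; rewrite ind_lt//= leqnn.
move: t1; rewrite le_eqVlt => /predU1P[-> |t1].
  by exists 1 => //; rewrite in_itv/= ler01 lexx.
have t01 : 0 <= u < 1 by rewrite t0.
have bk := ind_lt t01; have /andP[b1 b2] := indP t0.
have gu : g (ind u) <= u.
  have /andP[h _] := gb bk; apply: (le_trans h).
  by rewrite ler_pdivrMr// mulrC.
suff [t /andP[tt0 tt1] <-] : exists2 t, 0 <= t < 1 & l t = u.
  by exists t => //; rewrite /= in_itv/= tt0 ltW.
have [ug|gu'] := ltP u (g (ind u).+1).
  by apply: (l_hit bk); rewrite gu.
have [bk'|] := ltnP (ind u).+1 k.
  apply: (l_hit bk'); rewrite gu'/=; have /andP[_ h] := gb bk'.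
  by apply: lt_trans h; rewrite ltr_pdivlMr// mulrC.
move=> kb; have E : (ind u).+1 = k by apply/eqP; rewrite eqn_leq bk kb.
by move: gu' t1; rewrite E gk leNgt => /negP + h; case.
Qed.

Let l_close t : 0 <= t < 1 -> `|l t - t| <= k%:R^-1.
Proof.
move=> t01; have /andP[t0 _] := t01; have bk := ind_lt t01.
have /andP[] := indP t0; rewrite /l -natr1; set i := ind t; move=> h1 h2.
have /andP[h3 h4] := gb bk.
have h5 : i%:R / k%:R - k%:R^-1 <= g i.
  rewrite /i; case: (ind t) bk => [_|b bk].
    by rewrite g0 mul0r sub0r oppr_le0 invr_ge0.
  have /andP[_ h] := gb (ltnW bk); apply: le_trans (ltW h).
  by rewrite -natr1 mulrDl mul1r addrK.
have h6 : g i.+1 <= i%:R / k%:R + k%:R^-1.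
  move: (bk); rewrite -/i leq_eqVlt => /predU1P[E|bk'].
    by rewrite E gk; move: E => /(congr1 (fun n => n%:R / k%:R : R));
      rewrite divff ?gt_eqF// -natr1 mulrDl mul1r => ->.
  have /andP[h _] := gb bk'; apply: (le_trans h).
  by rewrite -natr1 mulrDl mul1r.
have tE : t = i%:R / k%:R + (k%:R * t - i%:R) * k%:R^-1.
  by rewrite mulrBl mulrC addrC subrK mulrAC divff ?mul1r// gt_eqF.
have ki0 : 0 < k%:R^-1 :> R by rewrite invr_gt0.
have c01 : 0 <= k%:R * t - i%:R <= 1 by apply/andP; split; lra.
rewrite {2}tE; move: c01 h3 h4 h5 h6 ki0; set c := _ - i%:R.
set p := i%:R / _; set q := k%:R^-1 => /andP[c0 c1] h3 h4 h5 h6 ki0.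
rewrite ler_norml; apply/andP; split; nra.
Qed.

(** The time change carries the cell from b / k to (b + 1) / k, on which the
    discretization is constant, to the interval from g b to g (b + 1), on which
    the path is almost constant with the same value. *)
Lemma step_path_close y e : 0 <= e ->
  (forall b u, (b < k)%N -> g b <= u < g b.+1 -> `|y (b%:R / k%:R) - y u| <= e) ->
  skorohod_close (step_path k (fun j => y (j%:R / k%:R))) y (Num.max k%:R^-1 e).
Proof.
move=> e0 ye; exists l; first exact: mono_time_change.
move=> t t01; have := t01; rewrite in_itv/= => /andP[t0].
rewrite le_eqVlt => /predU1P[-> |t1].
  rewrite l1 subrr normr0 le_max e0 orbT; split => //.
  rewrite /= /step_fun in_itv/= ler01 lexx/= -/(ind 1) ind1 divff ?gt_eqF//.
  by rewrite subrr normr0 le_max e0 orbT.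
have t01' : 0 <= t < 1 by rewrite t0.
rewrite !le_max l_close//; split => //.
apply/orP; right; rewrite /= /step_fun t01; apply: ye; first exact: ind_lt.
exact: l_itv.
Qed.

End time_change_nodes.

(** Up to e, the path has a single jump in ]p, q], at u: the Skorohod distance
    allows to move u to q. *)
Definition one_switch (y : R -> R) e (p q : R) :=
  exists2 u, p < u <= q & (forall s, p <= s < u -> `|y p - y s| <= e) /\
                          (forall s, u <= s <= q -> `|y q - y s| <= e).

(** The jump of each cell is moved to the right end of the cell, except in the
    last cell since time changes fix 1. *)
Lemma one_switch_close k y e : (0 < k)%N -> 0 <= e ->
  (forall b, (b.+1 < k)%N -> one_switch y e (b%:R / k%:R) (b.+1%:R / k%:R)) ->
  (forall s, k.-1%:R / k%:R <= s < 1 -> `|y (k.-1%:R / k%:R) - y s| <= e) ->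
  skorohod_close (step_path k (fun j => y (j%:R / k%:R))) y (Num.max k%:R^-1 e).
Proof.
move=> k0 e0 sw last.
have kR0 : 0 < k%:R :> R by rewrite ltr0n.
have /choice[h hP] : forall b, exists u, (b.+1 < k)%N ->
  b%:R / k%:R < u <= b.+1%:R / k%:R /\
  (forall s, b%:R / k%:R <= s < u -> `|y (b%:R / k%:R) - y s| <= e) /\
  (forall s, u <= s <= b.+1%:R / k%:R -> `|y (b.+1%:R / k%:R) - y s| <= e).
  move=> b; have [bk|bk] := ltnP b.+1 k; last by exists 0.
  by have [u ? ?] := sw b bk; exists u.
pose g b := if b is b'.+1 then (if b == k then 1 else h b') else 0.
have g1 b : (b < k)%N -> b%:R / k%:R < g b.+1.
  rewrite /g => bk; case: eqP => [E|/eqP E].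
    by rewrite ltr_pdivrMr// mul1r ltr_nat.
  have bk' : (b.+1 < k)%N by rewrite ltn_neqAle E.
  by have [/andP[]] := hP _ bk'.
have g2 b : (b < k)%N -> g b <= b%:R / k%:R.
  case: b => [|b] bk; first by rewrite /= mul0r.
  rewrite /g (ltn_eqF bk).
  by have [/andP[]] := hP _ bk.
apply: (@step_path_close k g) => //.
- by rewrite /g; case: (k) k0 => //= k' _; rewrite eqxx.
- by move=> b bk; rewrite g2//= g1.
move=> b s bk /andP[gs sg].
have [sb|bs] := ltP s (b%:R / k%:R).
  case: b bk gs sg sb => [_|b bk]; first by rewrite /= mul0r => + _ => /le_gtF ->.
  rewrite {1}/g (ltn_eqF bk) => hs _ sb.
  by have [_ [_]] := hP _ bk; apply; rewrite hs ltW.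
move: sg; rewrite /g; case: eqP => [E|/eqP E] sg.
  by move: last bs; rewrite -E/= => last bs; apply: last; rewrite bs.
have bk' : (b.+1 < k)%N by rewrite ltn_neqAle E.
by have [_ [+ _]] := hP _ bk'; apply; rewrite bs.
Qed.

(** Around each point a cadlag path is almost constant on each side, and
    compactness makes the scale uniform. *)
Lemma cadlag_one_switch y e : 0 < e -> \forall r \near 0^'+, forall p q,
  0 <= p -> p < q -> q <= 1 -> q - p < r ->
  one_switch y e p q /\ (q = 1 -> forall s, p <= s < 1 -> `|y p - y s| <= e).
Proof.
move=> e0; have e20 : 0 < e / 2 by rewrite divr_gt0.
have [] := @compact_near_coveringP R `[0, 1]%classic.
move=> /(_ (@segment_compact R 0 1)) cov _.
pose Q (r t : R) := forall p q, 0 <= p -> p < q -> q <= 1 -> q - p < r ->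
  p <= t <= q ->
  one_switch y e p q /\ (q = 1 -> forall s, p <= s < 1 -> `|y p - y s| <= e).
suff : \forall r \near 0^'+, `[0, 1]%classic `<=` Q r.
  apply: filterS => r QR p q p0 pq q1 qpr.
  by apply: (QR p) => //=; rewrite ?in_itv/= ?p0 ?lexx ?(ltW pq) ?(le_trans (ltW pq)).
apply: cov => t; rewrite /= in_itv/= => /andP[t0 t1].
have [d1 d10 left] : exists2 d1, 0 < d1 & 0 < t ->
    forall s s', t - d1 < s < t -> t - d1 < s' < t -> `|y s - y s'| <= e.
  have [tp|tn] := ltP 0 t; last by exists 1.
  have [|a aP] := @cadlag01_left _ y t (sk_cadlag y); first by rewrite tp.
  have [d d0 dP] := aP _ e20; exists d => // _ s s' /dP + /dP.
  by rewrite !ler_norml; lra.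
have [d2 d20 right] : exists2 d2, 0 < d2 & t < 1 -> t + d2 <= 1 /\
    forall s s', t <= s < t + d2 -> t <= s' < t + d2 -> `|y s - y s'| <= e.
  have [tp|tn] := ltP t 1; last by exists 1.
  have [||d d0 dP] := @cadlag01_right _ y t (e / 2) (sk_cadlag y) => //.
    by rewrite t0.
  exists (Num.min d (1 - t)); first by rewrite lt_min d0 subr_gt0.
  move=> _; split; first by rewrite -lerBrDl ge_min lexx orbT.
  move=> s s' /andP[ts sd] /andP[ts' sd'].
  have : `|y t - y s| <= e / 2.
    by apply: dP; rewrite ts (lt_le_trans sd)// lerD2l ge_min lexx.
  have : `|y t - y s'| <= e / 2.
    by apply: dP; rewrite ts' (lt_le_trans sd')// lerD2l ge_min lexx.
  by rewrite !ler_norml; lra.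
pose d := Num.min d1 d2.
have d0 : 0 < d by rewrite lt_min d10.
have dd1 : d <= d1 by rewrite ge_min lexx.
have dd2 : d <= d2 by rewrite ge_min lexx orbT.
exists ([set s | `|t - s| < d / 2], [set r | 0 < r < d / 2]).
  split; first by exists (d / 2) => //=; rewrite divr_gt0.
  near=> r; apply/andP; split; near: r; first exact: nbhs_right_gt.
  by apply: nbhs_right_lt; rewrite divr_gt0.
move=> [s r] /= [ts /andP[r0 rd]] p q p0 pq q1 qpr /andP[ps sq].
move: ts; rewrite ltr_norml => /andP[ts1 ts2].
have qd : q < t + d by lra.
have pd : t - d < p by lra.
have [tp|pt] := leP t p.
  have [] := right (le_lt_trans tp (lt_le_trans pq q1)) => td rP.
  split; last by move=> q1'; lra.
  exists q; first by rewrite pq lexx.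
  split=> u /andP[pu uq]; first by apply: rP; apply/andP; split; lra.
  have -> : u = q by apply/eqP; rewrite eq_le uq.
  by rewrite subrr normr0 ltW.
have tpos := le_lt_trans p0 pt.
have lP := left tpos.
have [qt|tq] := ltP q t.
  split; last by move=> q1'; lra.
  exists q; first by rewrite pq lexx.
  split=> u /andP[pu uq]; first by apply: lP; apply/andP; split; lra.
  have -> : u = q by apply/eqP; rewrite eq_le uq.
  by rewrite subrr normr0 ltW.
have lb u : p <= u < t -> `|y p - y u| <= e.
  by move=> /andP[pu ut]; apply: lP; apply/andP; split; lra.
move: t1; rewrite le_eqVlt => /predU1P[t1|t1].
  split; last by move=> _ u; rewrite -t1; exact: lb.
  exists t; first by rewrite pt.
  split=> // u /andP[tu uq].
  have -> : u = q by apply/eqP; rewrite eq_le uq; lra.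
  by rewrite subrr normr0 ltW.
have [td rP] := right t1.
split; last by move=> q1'; lra.
exists t; first by rewrite pt.
by split=> // u /andP[tu uq]; apply: rP; apply/andP; split; lra.
Unshelve. all: by end_near. Qed.

Lemma cadlag_one_switch_grid y e : 0 < e -> \forall k \near \oo,
  (forall b, (b < k)%N -> one_switch y e (b%:R / k%:R) (b.+1%:R / k%:R)) /\
  (forall s, k.-1%:R / k%:R <= s < 1 -> `|y (k.-1%:R / k%:R) - y s| <= e).
Proof.
move=> e0; have [r /= r0 rP] := cadlag_one_switch y e0.
near=> k.
have k0 : (0 < k)%N by near: k; exact: nbhs_infty_gt.
have kR0 : 0 < k%:R :> R by rewrite ltr0n.
have kr : k%:R^-1 < r / 2.
  rewrite invf_plt ?posrE ?divr_gt0//; near: k; exact: nbhs_infty_gtr.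
have r20 : 0 < r / 2 by rewrite divr_gt0.
have r2r : `|0 - r / 2| < r by rewrite sub0r normrN gtr0_norm// ltr_pdivrMr// ltr_pMr// ltr1n.
have key b : (b < k)%N -> one_switch y e (b%:R / k%:R) (b.+1%:R / k%:R) /\
   (b.+1%:R / k%:R = 1 :> R -> forall s, b%:R / k%:R <= s < 1 -> `|y (b%:R / k%:R) - y s| <= e).
  move=> bk; apply: (rP (r / 2) r2r r20).
  - by rewrite divr_ge0.
  - by rewrite ltr_pM2r ?invr_gt0// ltr_nat.
  - by rewrite ler_pdivrMr// mul1r ler_nat.
  - by rewrite -mulrBl -natrB ?leqnSn// subSnn mul1r.
split=> [b /key[]//|].
have [] := key k.-1; first by rewrite prednK.
by rewrite prednK// divff ?gt_eqF// => _; apply.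
Unshelve. all: by end_near. Qed.

Lemma step_path_cvg y e : 0 < e -> \forall k \near \oo,
  skorohod_close (step_path k (fun j => y (j%:R / k%:R))) y e.
Proof.
move=> e0; near=> k.
have k0 : (0 < k)%N by near: k; exact: nbhs_infty_gt.
have kR0 : 0 < k%:R :> R by rewrite ltr0n.
have ke : k%:R^-1 <= e.
  by rewrite invf_ple ?posrE//; near: k; exact: nbhs_infty_ger.
rewrite -(max_idPr ke).
have [sw last] : (forall b, (b < k)%N -> one_switch y e (b%:R / k%:R) (b.+1%:R / k%:R)) /\
  (forall s, k.-1%:R / k%:R <= s < 1 -> `|y (k.-1%:R / k%:R) - y s| <= e).
  near: k; exact: cadlag_one_switch_grid.
by apply: one_switch_close => //; [exact: ltW|move=> b /ltnW/sw].
Unshelve. all: by end_near. Qed.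

Lemma skorohod_close_ball x y e : skorohod_close x y e ->
  forall e', e < e' -> ball x e' y.
Proof.
move=> xy e' ee'; rewrite ballEmdist/=.
exact: le_lt_trans (skorohod_dist_le xy) ee'.
Qed.

Lemma continuous_skorohod_cvg (f : skorohod R -> R) (x_ : nat -> skorohod R) x :
  continuous f ->
  (forall e, 0 < e -> \forall n \near \oo, skorohod_close (x_ n) x e) ->
  f (x_ n) @[n --> \oo] --> f x.
Proof.
move=> cf cx; apply: continuous_cvg; first exact: cf.
apply/cvg_ballP => e e0; near=> n.
apply/ball_sym/(@skorohod_close_ball _ _ (e / 2)).
  by near: n; apply: cx; rewrite divr_gt0.
by rewrite ltr_pdivrMr// ltr_pMr// ltr1n.
Unshelve. all: by end_near. Qed.

End step_path.

(** * Independence of sigma-algebras *)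

Section independence.
Context d (T : measurableType d) (R : realType) (P : probability T R).
Implicit Types (G : set (set T)) (A B : set T).

Lemma prob_nondecreasing_cvg (F : nat -> set T) : (forall n, measurable (F n)) ->
  nondecreasing_seq F -> prob P (F n) @[n --> \oo] --> prob P (\bigcup_n F n).
Proof.
move=> mF ndF; apply: fine_cvg; rewrite -prob_fin; last exact: bigcup_measurable.
by apply: nondecreasing_cvg_mu => //; exact: bigcup_measurable.
Qed.

(** The sets A that satisfy the product rule with a fixed B form a lambda
    system. *)
Lemma independent_generated G B : setI_closed G -> (G `<=` measurable) ->
  measurable B ->
  (forall A, G A -> prob P (A `&` B) = prob P A * prob P B) ->
  forall A, <<s G >> A -> prob P (A `&` B) = prob P A * prob P B.
Proof.
move=> GI Gm mB GB.
pose H := [set A | measurable A /\ prob P (A `&` B) = prob P A * prob P B].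
suff HG : <<s G >> `<=` H by move=> A /HG[].
apply: lambda_system_subset => //; last by move=> A GA; split; [exact: Gm|exact: GB].
split => //.
- by split => //; rewrite setTI prob_setT mul1r.
- move=> A C CA [mA HA] [mC HC]; split; first exact: measurableD.
  have E1 := prob_setD P mA mC.
  have E2 := prob_setD P (measurableI _ _ mA mB) (measurableI _ _ mC mB).
  rewrite (setIidr CA) in E1.
  have S : A `&` B `&` (C `&` B) = C `&` B.
    by apply: setIidr => w [/CA].
  rewrite S in E2.
  have -> : (A `\` C) `&` B = (A `&` B) `\` (C `&` B).
    by apply/seteqP; split=> w /= => [[[? ?] ?]|[[? ?] ?]]; split; tauto.
  by move: E1 E2; rewrite HA HC; nra.
- move=> F ndF HF; have mF n : measurable (F n) by have [] := HF n.
  split; first exact: bigcup_measurable.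
  have c1 := prob_nondecreasing_cvg mF ndF.
  have c2 : prob P (F n `&` B) @[n --> \oo] --> prob P ((\bigcup_n F n) `&` B).
    rewrite setI_bigcupl; apply: prob_nondecreasing_cvg.
      by move=> n; exact: measurableI.
    by move=> m n mn; apply/subsetPset; apply: setSI; apply/subsetPset/ndF.
  have c3 : prob P (F n `&` B) @[n --> \oo] --> prob P (\bigcup_n F n) * prob P B.
    under eq_fun do rewrite (HF _).2.
    exact: cvgMl.
  exact: cvg_unique c2 c3.
Qed.

Lemma independent_generated2 G G' : setI_closed G -> setI_closed G' ->
  (G `<=` measurable) -> (G' `<=` measurable) ->
  (forall A B, G A -> G' B -> prob P (A `&` B) = prob P A * prob P B) ->
  forall A B, <<s G >> A -> <<s G' >> B ->
    prob P (A `&` B) = prob P A * prob P B.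
Proof.
move=> GI GI' Gm Gm' GG A B sA sB.
have mA : measurable A.
  by apply: (smallest_sub _ Gm sA); exact: sigma_algebra_measurable.
rewrite setIC mulrC; apply: (independent_generated GI') => // C GC.
rewrite setIC mulrC; apply: (independent_generated GI) => //; first exact: Gm'.
by move=> D GD; exact: GG.
Qed.

Lemma tail_small (X : T -> R) (e : R) : measurable_fun setT X -> 0 < e ->
  exists2 M : R, 0 < M & prob P [set w | M < `|X w|] < e.
Proof.
move=> mX e0.
have mE n : measurable [set w | `|X w| <= n%:R].
  by apply: measurable_le; exact: measurableT_comp.
have c : prob P [set w | `|X w| <= n%:R] @[n --> \oo] --> (1 : R).
  have E : prob P (\bigcup_n [set w | `|X w| <= n%:R]) = 1.
    rewrite (_ : \bigcup_n _ = setT) ?prob_setT//.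
    apply/seteqP; split=> // w _; exists (Num.truncn `|X w|).+1 => //=.
    by rewrite ltW// truncnS_gt.
  rewrite -[X in _ --> X]E; apply: prob_nondecreasing_cvg => // m n mn.
  apply/subsetPset => w /=; by move/le_trans; apply; rewrite ler_nat.
have /cvgrPdist_lt/(_ _ e0)[N _ NP] := c.
exists N.+1%:R => //.
rewrite (_ : [set w | _] = ~` [set w | `|X w| <= N.+1%:R]); last first.
  by apply/seteqP; split=> w /=; [move=> h; apply/negP; rewrite -ltNge|move/negP; rewrite -ltNge].
rewrite prob_setC//; apply: le_lt_trans (NP N.+1 _) => //=.
exact: ler_norm.
Qed.

End independence.

(** * Random walks with stationary independent increments *)

Section walk.
Context d (T : measurableType d) (R : realType) (P : probability T R).
Variable S : nat -> T -> R.
Hypothesis mS : forall n, measurable_fun setT (S n).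
Hypothesis S0 : forall w, S 0%N w = 0.

Let X n w := S n.+1 w - S n w.

Hypothesis stat : forall i j (B : set R), measurable B ->
  prob P [set w | B (S (i + j)%N w - S i w)] = prob P [set w | B (S j w)].
Hypothesis ind : forall n (B : nat -> set R), (forall i, measurable (B i)) ->
  prob P (\bigcap_(i < n) X i @^-1` B i) = \prod_(i < n) prob P (X i @^-1` B i).

Let mX n : measurable_fun setT (X n).
Proof. exact: measurable_funB. Qed.

Definition cylinders a b : set (set T) := [set A | exists2 B : nat -> set R,
  (forall i, measurable (B i)) &
  A = \bigcap_(i in [set i | (a <= i < b)%N]) X i @^-1` B i].

Local Notation fld a b := (g_sigma_algebraType (cylinders a b)).

Lemma cylinders_setI a b : setI_closed (cylinders a b).
Proof.
move=> A A' [B mB ->] [B' mB' ->]; exists (fun i => B i `&` B' i).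
  by move=> i; exact: measurableI.
by rewrite -bigcapI.
Qed.

Lemma cylinders_measurable a b : cylinders a b `<=` measurable.
Proof.
move=> _ [B mB ->]; apply: bigcap_measurableType => i _.
rewrite -[X in measurable X]setTI; exact: mX.
Qed.

Lemma cylinders_independent a b c A B : cylinders a b A -> cylinders b c B ->
  prob P (A `&` B) = prob P A * prob P B.
Proof.
move=> [FA mFA ->] [FB mFB ->].
(* both sets are cylinders with sides indexed by all i < max b c *)
pose EA i := if (a <= i < b)%N then FA i else setT.
pose EB i := if (b <= i < c)%N then FB i else setT.
have mEA i : measurable (EA i) by rewrite /EA; case: ifP.
have mEB i : measurable (EB i) by rewrite /EB; case: ifP.
pose n := maxn b c.
have -> : \bigcap_(i in [set i | (a <= i < b)%N]) X i @^-1` FA i =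
    \bigcap_(i < n) X i @^-1` EA i.
  apply/seteqP; split=> w h i /= hi.
    by rewrite /EA; case: ifP => // /h.
  have /andP[_ ib] := hi.
  have := h i; rewrite /EA hi; apply => /=; rewrite /n leq_max ib//.
have -> : \bigcap_(i in [set i | (b <= i < c)%N]) X i @^-1` FB i =
    \bigcap_(i < n) X i @^-1` EB i.
  apply/seteqP; split=> w h i /= hi.
    by rewrite /EB; case: ifP => // /h.
  have /andP[_ ic] := hi.
  have := h i; rewrite /EB hi; apply => /=; rewrite /n leq_max ic orbT//.
rewrite (ind _ mEA) (ind _ mEB) -big_split/=.
have mEAB i : measurable (EA i `&` EB i) by exact: measurableI.
transitivity (prob P (\bigcap_(i < n) X i @^-1` (EA i `&` EB i))).
  by congr prob; rewrite -bigcapI; apply: eq_bigcapr.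
rewrite (ind n mEAB); apply: eq_bigr => i _; rewrite preimage_setI /EA /EB.
case: ifP => [/andP[_ ib]|_]; last by rewrite setTI preimage_setT prob_setT mul1r.
by rewrite leqNgt ib/= setIT preimage_setT prob_setT mulr1.
Qed.

Lemma walk_independent a b c (A B : set T) : measurable (A : set (fld a b)) ->
  measurable (B : set (fld b c)) -> prob P (A `&` B) = prob P A * prob P B.
Proof.
apply: independent_generated2.
- exact: cylinders_setI.
- exact: cylinders_setI.
- exact: cylinders_measurable.
- exact: cylinders_measurable.
- exact: cylinders_independent.
Qed.

Lemma fld_measurable a b (A : set T) : measurable (A : set (fld a b)) -> measurable A.
Proof.
move=> mA; apply: (smallest_sub _ (@cylinders_measurable a b) mA).
exact: sigma_algebra_measurable.
Qed.

Lemma increment_fld a b i j : (a <= i <= j)%N -> (j <= b)%N ->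
  measurable_fun setT (fun w : fld a b => S j w - S i w).
Proof.
move=> /andP[ai ij] jb.
rewrite (_ : (fun w => _) = fun w => \sum_(i <= m < j) X m w); last first.
  by apply/funext => w; rewrite telescope_sumr.
rewrite (_ : (fun w => _) = fun w => \sum_(m < j - i) X (m + i)%N w); last first.
  apply/funext => w; rewrite -{1}(add0n i) big_addn big_mkord.
  by apply: eq_bigr.
apply: measurable_sum => m _ Y mY.
apply: sub_gen_smallest; exists (fun k => if k == (m + i)%N then Y else setT).
  by move=> k; case: ifP.
rewrite setTI; apply/seteqP; split=> w /=.
  by move=> Yw k _ /=; case: eqP => // ->.
have h : (a <= m + i < b)%N.
  rewrite (leq_trans ai) ?leq_addl//= (leq_trans _ jb)//.
  by rewrite addnC -ltn_subRL.
by move/(_ _ h); rewrite /= eqxx.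
Qed.

Lemma increment_gt_fld a b i j (c : R) : (a <= i <= j)%N -> (j <= b)%N ->
  measurable ([set w | c < `|S j w - S i w|] : set (fld a b)).
Proof.
move=> aij jb; apply: measurable_gt; apply: measurableT_comp => //.
exact: increment_fld.
Qed.

Definition first_exit i (c : R) m : set T :=
  [set w | (i <= m)%N /\ c < `|S m w - S i w| /\
           forall m', (i <= m' < m)%N -> `|S m' w - S i w| <= c].

Definition exits i l (c : R) : set T :=
  [set w | exists2 m, (i <= m <= l)%N & c < `|S m w - S i w|].

Lemma first_exit_trivIset i (c : R) : trivIset setT (first_exit i c).
Proof.
move=> m m' _ _ [w [[im [mc mP]] [im' [mc' mP']]]].
have [lt|lt|//] := ltngtP m m'.
- have /mP' : (i <= m < m')%N by rewrite im lt.
  by rewrite leNgt mc.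
- have /mP : (i <= m' < m)%N by rewrite im' lt.
  by rewrite leNgt mc'.
Qed.

Lemma exitsE i l (c : R) : exits i l c = \bigcup_(m < l.+1) first_exit i c m.
Proof.
apply/seteqP; split=> [w [m /andP[im ml] mc]|w [m /= ml [im [mc _]]]]; last first.
  by exists m => //; rewrite im.
have ex : exists m, (i <= m)%N && (c < `|S m w - S i w|) by exists m; rewrite im.
case: (ex_minnP ex) => n /andP[inn nc] nmin; exists n => /=.
  by rewrite ltnS (leq_trans _ ml)// nmin// im.
split=> //; split=> // m' /andP[im' m'n]; rewrite leNgt; apply/negP => m'c.
by have := nmin m'; rewrite im' m'c leqNgt m'n => /(_ isT).
Qed.

Lemma first_exit_fld a b i (c : R) m : (a <= i)%N -> (m <= b)%N ->
  measurable (first_exit i c m : set (fld a b)).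
Proof.
move=> ai mb; have [im|mi] := leqP i m; last first.
  rewrite (_ : first_exit _ _ _ = set0)//.
  by apply/seteqP; split=> // w [im]; move: mi; rewrite ltnNge im.
rewrite (_ : first_exit _ _ _ = [set w | c < `|S m w - S i w|] `&`
  \bigcap_(m' in [set m' | (i <= m' < m)%N]) ~` [set w | c < `|S m' w - S i w|]).
  apply: measurableI; first by apply: increment_gt_fld => //; rewrite ai.
  apply: bigcap_measurableType => m' /= /andP[im' m'm].
  apply: measurableC; apply: increment_gt_fld; first by rewrite ai.
  exact: leq_trans (ltnW m'm) mb.
apply/seteqP; split=> w /=.
  move=> [_ [mc mP]]; split=> // m' /mP h /=.
  by apply/negP; rewrite -leNgt.
move=> [mc mP]; split=> //; split=> // m' /mP /= /negP.
by rewrite -leNgt.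
Qed.

Lemma exits_fld a b i l (c : R) : (a <= i)%N -> (l <= b)%N ->
  measurable (exits i l c : set (fld a b)).
Proof.
move=> ai lb; rewrite exitsE; apply: bigcup_measurable => m /= ml.
by apply: first_exit_fld => //; exact: leq_trans lb.
Qed.

Let law i j (B : set R) : (i <= j)%N -> measurable B ->
  prob P [set w | B (S j w - S i w)] = prob P [set w | B (S (j - i)%N w)].
Proof. by move=> ij mB; rewrite -(stat i (j - i) mB) subnKC. Qed.

Let m_gt (f : T -> R) (c : R) : measurable_fun setT f -> measurable [set w | c < `|f w|].
Proof. by move=> mf; apply: measurable_gt; exact: measurableT_comp. Qed.

(** Medians up to e are found among the multiples of e, of which only finitely
    many lie in the range where Y mostly is. *)
Lemma approx_median (Y : T -> R) (e : R) : measurable_fun setT Y -> 0 < e ->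
  exists c, 1 / 2 <= prob P [set w | c <= Y w] /\
            1 / 2 <= prob P [set w | Y w <= c + e].
Proof.
move=> mY e0; have [|M M0 PM] := tail_small P mY (_ : 0 < 1 / 2) => //.
pose N := (Num.truncn (M / e)).+1.
have MN : M < N%:R * e by rewrite -ltr_pdivrMr// truncnS_gt.
pose f n := prob P [set w | - (N%:R * e) + n%:R * e <= Y w].
have mf c : measurable [set w | c <= Y w] by exact: measurable_ge.
have f0 : 1 / 2 <= f 0%N.
  have mM := m_gt M mY.
  rewrite -(opprK (f _)) -subr_le0; have := prob_setC P mM.
  suff : prob P (~` [set w | M < `|Y w|]) <= f 0%N by lra.
  apply: le_prob => //; first exact: measurableC.
  move=> w /= /negP; rewrite -leNgt mul0r addr0 ler_norml => /andP[h _].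
  by apply: le_trans h; rewrite lerN2 ltW.
have ex : exists n, f n < 1 / 2.
  exists (N + N)%N; apply: le_lt_trans PM; apply: le_prob => //; first exact: m_gt.
  move=> w /=; rewrite natrD mulrDl addKr => h; apply: lt_le_trans (ler_norm _).
  exact: lt_le_trans MN h.
case: (ex_minnP ex) => -[|n] fn nmin; first by move: fn; rewrite ltNge f0.
exists (- (N%:R * e) + n%:R * e); split.
  by rewrite leNgt; apply/negP => /nmin; rewrite ltnn.
have -> : - (N%:R * e) + n%:R * e + e = - (N%:R * e) + n.+1%:R * e.
  by rewrite -natr1 mulrDl mul1r addrA.
have := prob_setC P (mf (- (N%:R * e) + n.+1%:R * e)).
suff : prob P (~` [set w | - (N%:R * e) + n.+1%:R * e <= Y w]) <=
       prob P [set w | Y w <= - (N%:R * e) + n.+1%:R * e].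
  by move: fn; rewrite /f; lra.
apply: le_prob; [exact: measurableC|exact: measurable_le|].
by move=> w /= /negP; rewrite -ltNge => /ltW.
Qed.

Section small_increments.
Variables (r : nat) (e p : R).
Hypotheses (e0 : 0 < e) (p12 : 12 * p < 1).
Hypothesis Sr : prob P [set w | e < `|S r w|] <= p.

Let p0 : 0 <= p. Proof. exact: le_trans (prob_ge0 _ _) Sr. Qed.

Let walk_fld b j : (j <= b)%N -> measurable_fun setT (fun w : fld 0 b => S j w).
Proof.
move=> jb; rewrite (_ : (fun w => _) = fun w => S j w - S 0%N w).
  exact: increment_fld.
by apply/funext => w; rewrite S0 subr0.
Qed.

(** If a sum of two independent variables is rarely large, each of them is
    rarely far from minus a median of the other. *)
Lemma walk_center j : (j <= r)%N ->
  exists z, prob P [set w | 2 * e < `|S j w - z|] <= 4 * p.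
Proof.
move=> jr; have [c [c1 c2]] := approx_median (mS (r - j)) e0.
exists (- c).
pose B := [set x : R | 2 * e < `|x - - c|].
have mB : measurable B.
  by apply: measurable_gt; apply: measurableT_comp => //; exact: measurable_funB.
have rj : (r - j <= r)%N by exact: leq_subr.
rewrite -[X in prob P X]/[set w | B (S j w)] -[X in S X](subKn jr) -law//.
pose Z w := S r w - S (r - j)%N w.
have mZ : measurable_fun setT Z by exact: measurable_funB.
have mZf : measurable_fun setT (Z : fld (r - j) r -> R).
  by apply: increment_fld => //; rewrite leqnn.
have mYf := walk_fld (leqnn (r - j)).
have H1 : prob P [set w | 2 * e - c < Z w] * (1 / 2) <= p.
  apply: le_trans Sr; apply: (@le_trans _ _ (prob P
      ([set w | c <= S (r - j)%N w] `&` [set w | 2 * e - c < Z w]))).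
    rewrite (@walk_independent 0 (r - j) r); last 2 first.
      exact: measurable_ge.
      exact: measurable_gt.
    by rewrite mulrC ler_wpM2r// prob_ge0.
  apply: le_prob.
  - by apply: measurableI; [exact: measurable_ge|exact: measurable_gt].
  - exact: m_gt.
  - move=> w /= [h1]; rewrite /Z => h2; apply: lt_le_trans (ler_norm _).
    by move: h1 h2 e0; lra.
have H2 : prob P [set w | Z w < - (2 * e) - c] * (1 / 2) <= p.
  apply: le_trans Sr; apply: (@le_trans _ _ (prob P
      ([set w | S (r - j)%N w <= c + e] `&` [set w | Z w < - (2 * e) - c]))).
    rewrite (@walk_independent 0 (r - j) r); last 2 first.
      exact: measurable_le.
      exact: measurable_lt.
    by rewrite mulrC ler_wpM2r// prob_ge0.
  apply: le_prob.
  - by apply: measurableI; [exact: measurable_le|exact: measurable_lt].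
  - exact: m_gt.
  - move=> w /= [h1]; rewrite /Z -normrN => h2; apply: lt_le_trans (ler_norm _).
    by move: h1 h2 e0; lra.
have := prob_setU P (measurable_gt (2 * e - c) mZ) (measurable_lt (- (2 * e) - c) mZ).
suff : prob P [set w | B (Z w)] <=
    prob P ([set w | 2 * e - c < Z w] `|` [set w | Z w < - (2 * e) - c]) by lra.
apply: le_prob.
- rewrite -[X in measurable X]setTI; exact: mZ.
- by apply: measurableU; [exact: measurable_gt|exact: measurable_lt].
- move=> w; rewrite /B /= opprK; have [h _|h] := ltP (2 * e - c) (Z w); first by left.
  by rewrite lter_normr => /orP[]; [lra|right; lra].
Qed.

(** The centers z j of [walk_center] are additive up to 6 e and z r = 0. If
    |z i| is maximal then either 2 i <= r and z (2 i) is close to 2 z i, or the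
    same holds for r - i and z (r - i) is close to - z i; both bound |z i| by
    18 e. *)
Lemma walk_small j : (j <= r)%N -> prob P [set w | 20 * e < `|S j w|] <= 4 * p.
Proof.
have /choice[z0 z0P] : forall i, exists z, (i <= r)%N ->
    prob P [set w | 2 * e < `|S i w - z|] <= 4 * p.
  move=> i; have [/walk_center[z zP]|] := leqP i r; first by exists z.
  by exists 0.
pose z i := if i == r then 0 else z0 i.
have zP i : (i <= r)%N -> prob P [set w | 2 * e < `|S i w - z i|] <= 4 * p.
  move=> ir; rewrite /z; case: eqP => [->|_]; last exact: z0P.
  apply: (@le_trans _ _ p); last by move: p0; lra.
  apply: le_trans Sr; apply: le_prob.
  - by apply: m_gt; exact: measurable_funB.
  - exact: m_gt.
  - by move=> w /=; rewrite subr0; move: e0; lra.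
have add i k : (i + k <= r)%N -> `|z (i + k)%N - z i - z k| <= 6 * e.
  move=> ikr; have ir : (i <= r)%N := leq_trans (leq_addr _ _) ikr.
  have kr : (k <= r)%N := leq_trans (leq_addl _ _) ikr.
  pose B := [set x : R | 2 * e < `|x - z k|].
  have mB : measurable B.
    by apply: measurable_gt; apply: measurableT_comp => //; exact: measurable_funB.
  have h1 := zP _ ir; have h2 := zP _ kr; have h3 := zP _ ikr.
  rewrite -[X in prob P X]/[set w | B (S k w)] -(stat i k mB) in h2.
  have m1 : measurable [set w | 2 * e < `|S i w - z i|].
    by apply: m_gt; exact: measurable_funB.
  have m2 : measurable [set w | B (S (i + k)%N w - S i w)].
    by apply: m_gt; apply: measurable_funB => //; exact: measurable_funB.
  have m3 : measurable [set w | 2 * e < `|S (i + k)%N w - z (i + k)%N|].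
    by apply: m_gt; exact: measurable_funB.
  have h12 := prob_setU P m1 m2.
  have h123 := prob_setU P (measurableU _ _ m1 m2) m3.
  have [w] : exists w, ~ (([set w | 2 * e < `|S i w - z i|] `|`
      [set w | B (S (i + k)%N w - S i w)]) `|`
      [set w | 2 * e < `|S (i + k)%N w - z (i + k)%N|]) w.
    apply: contrapT => /forallNP H.
    move: h123; rewrite [X in prob P X <= _](_ : _ = setT); last first.
      by apply/seteqP; split=> // w _; exact: contrapT (H w).
    by rewrite prob_setT; move: p12; lra.
  rewrite /B /= => /not_orP[/not_orP[/negP + /negP +] /negP].
  by rewrite -!leNgt !ler_norml; lra.
have zr : z r = 0 by rewrite /z eqxx.
have [i _ imax] := @arg_maxP _ _ 'I_r.+1 ord0 xpredT (fun i => `|z i|) isT.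
have {}imax k : (k <= r)%N -> `|z k| <= `|z i|.
  by move=> kr; have := imax (Ordinal (kr : (k < r.+1)%N)) isT.
have dbl k : (k + k <= r)%N -> 2 * `|z k| <= `|z i| + 6 * e.
  move=> kk; have := add _ _ kk; have := imax _ kk.
  move: `|z i| (z (k + k)%N) (z k) => M a b.
  by rewrite !ler_norml; case: (ger0P b); lra.
have zi : `|z i| <= 18 * e.
  have [ii|ii] := leqP (i + i) r; first by have := dbl _ ii; move: e0; lra.
  have ir : (i <= r)%N by rewrite -ltnS.
  have := add i (r - i)%N; rewrite subnKC// zr sub0r leqnn => /(_ isT) h1.
  have h2 : ((r - i) + (r - i) <= r)%N.
    by rewrite -[X in (_ <= X)%N](subnKC ir) leq_add2r leq_subLR ltnW.
  have := dbl _ h2.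
  move: h1; move: (z i) (z (r - i)%N) => a b.
  by rewrite ler_norml; case: (ger0P a); case: (ger0P b); lra.
move=> jr; apply: le_trans (zP _ jr); apply: le_prob.
- exact: m_gt.
- by apply: m_gt; exact: measurable_funB.
- move=> w /= h; have := imax _ jr => h'.
  have := ler_normB (S j w) (z j); have := lerB_dist (S j w) (z j).
  by move: h h' zi; lra.
Qed.

(** Ottaviani's inequality: after leaving the ball of radius 40 e, the walk moves
    by at most 20 e until l with probability at least 1 / 2, independently of
    the past; it is then still at distance more than 20 e from its start. *)
Lemma exits_small i l : (i <= l)%N -> (l - i <= r)%N ->
  prob P (exits i l (40 * e)) <= 8 * p.
Proof.
move=> il lir.
have inc m : (i <= m <= l)%N -> prob P [set w | 20 * e < `|S l w - S m w|] <= 4 * p.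
  move=> /andP[im ml]; pose B := [set x : R | 20 * e < `|x|].
  have mB : measurable B by apply: measurable_gt; exact: normr_measurable.
  rewrite -[X in prob P X]/[set w | B (S l w - S m w)] law//.
  by apply: walk_small; exact: leq_trans (leq_sub2l _ im) lir.
pose A m := first_exit i (40 * e) m.
pose B m := ~` [set w | 20 * e < `|S l w - S m w|].
have mA m : measurable (A m).
  by apply: (@fld_measurable i m); apply: first_exit_fld.
have mB m : measurable (B m).
  by apply: measurableC; apply: m_gt; exact: measurable_funB.
have tAB : trivIset setT (fun m => A m `&` B m).
  move=> m m' _ _ [w [[a _] [a' _]]].
  by apply: (@first_exit_trivIset i (40 * e)) => //; exists w.
have H : prob P (\bigcup_(m < l.+1) (A m `&` B m)) <= 4 * p.
  apply: le_trans (inc i _); last by rewrite leqnn.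
  apply: le_prob.
  - by apply: bigcup_measurable => m _; exact: measurableI.
  - by apply: m_gt; exact: measurable_funB.
  - move=> w [m _ [[_ [h1 _]]]]; rewrite /B /= => /negP; rewrite -leNgt => h2.
    have := ler_distD (S l w) (S m w) (S i w); rewrite [`|S m w - S l w|]distrC.
    by move: h1 h2; lra.
rewrite prob_bigcup_disjoint// in H; last by move=> m; exact: measurableI.
rewrite exitsE prob_bigcup_disjoint//; last exact: first_exit_trivIset.
suff : \sum_(m < l.+1) prob P (A m) <= 2 * \sum_(m < l.+1) prob P (A m `&` B m).
  by rewrite -/A; lra.
rewrite mulr_sumr; apply: ler_sum => -[m /= ml] _.
have [im|mi] := leqP i m; last first.
  rewrite (_ : A m = set0) ?prob_set0 ?mulr_ge0 ?prob_ge0//.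
  by apply/seteqP; split=> // w [im]; move: mi; rewrite ltnNge im.
rewrite (@walk_independent i m l); last 2 first.
- exact: first_exit_fld.
- by apply: measurableC; apply: increment_gt_fld => //; rewrite leqnn.
have h : 1 / 2 <= prob P (B m).
  rewrite prob_setC; last by apply: m_gt; exact: measurable_funB.
  by have := inc m; rewrite im -ltnS ml => /(_ isT); move: p12; lra.
by have := prob_ge0 P (A m); nra.
Qed.

(** What follows the first exit is independent of it, which squares the bound of
    [exits_small]. *)
Lemma double_exit_small i l : (i <= l)%N -> (l - i <= r)%N ->
  prob P (\bigcup_(m < l.+1)
    (first_exit i (40 * e) m `&` exits m l (40 * e))) <= (8 * p) ^+ 2.
Proof.
move=> il lir; pose A m := first_exit i (40 * e) m.
pose B m := exits m l (40 * e).
have mA m : measurable (A m).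
  by apply: (@fld_measurable i m); apply: first_exit_fld.
have mB m : measurable (B m) by apply: (@fld_measurable m l); apply: exits_fld.
have tAB : trivIset setT (fun m => A m `&` B m).
  move=> m m' _ _ [w [[a _] [a' _]]].
  by apply: (@first_exit_trivIset i (40 * e)) => //; exists w.
rewrite (@prob_bigcup_disjoint _ _ _ P _ _ _ tAB); last by move=> m; exact: measurableI.
have := exits_small il lir.
rewrite exitsE prob_bigcup_disjoint//; last exact: first_exit_trivIset.
rewrite -/A => H.
apply: (@le_trans _ _ (\sum_(m < l.+1) prob P (A m) * (8 * p))); last first.
  by rewrite -mulr_suml expr2 ler_wpM2r// mulr_ge0.
apply: ler_sum => -[m /= ml] _.
have [im|mi] := leqP i m; last first.
  rewrite (_ : A m = set0) ?set0I ?prob_set0 ?mul0r//.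
  by apply/seteqP; split=> // w [im]; move: mi; rewrite ltnNge im.
rewrite (@walk_independent i m l); last 2 first.
- exact: first_exit_fld.
- exact: exits_fld.
apply: ler_wpM2l; first exact: prob_ge0.
by apply: exits_small => //; exact: leq_trans (leq_sub2l _ im) lir.
Qed.

End small_increments.

Lemma no_pair_prob N (c : R) :
  prob P (\bigcap_(b < N) ~` [set w | c < `|X b.*2 w| /\ c < `|X b.*2.+1 w|]) =
  (1 - prob P [set w | c < `|S 1%N w|] ^+ 2) ^+ N.
Proof.
pose B b := [set w | c < `|X b.*2 w|] `&` [set w | c < `|X b.*2.+1 w|].
have mBf b b' : (b' <= b.*2)%N -> measurable (B b : set (fld b' b.+1.*2)).
  move=> bb'; rewrite doubleS.
  by apply: measurableI; apply: increment_gt_fld; rewrite ?bb' ?(leqW bb') ?leqnSn.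
have mB b : measurable (B b) by apply: fld_measurable (mBf b _ (leqnn _)).
have pX n : prob P [set w | c < `|X n w|] = prob P [set w | c < `|S 1%N w|].
  pose C := [set x : R | c < `|x|].
  have mC : measurable C by apply: measurable_gt; exact: normr_measurable.
  by rewrite -[LHS]/(prob P [set w | C (S n.+1 w - S n w)]) law// subSnn.
have pB b : prob P (B b) = prob P [set w | c < `|S 1%N w|] ^+ 2.
  rewrite (@walk_independent b.*2 b.*2.+1 b.*2.+2) ?pX ?expr2//.
    by apply: increment_gt_fld; rewrite ?leqnn ?leqnSn.
  by apply: increment_gt_fld; rewrite ?leqnn ?leqnSn.
elim: N => [|N IH].
  by rewrite expr0 bigcap_mkord big_ord0 prob_setT.
rewrite (_ : \bigcap_(b < N.+1) _ = (\bigcap_(b < N) ~` B b) `&` ~` B N); last first.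
  by rewrite !bigcap_mkord big_ord_recr.
rewrite (@walk_independent 0 N.*2 N.+1.*2); last 2 first.
- apply: bigcap_measurableType => b /= bN; apply: measurableC.
  have h : (b.*2.+2 <= N.*2)%N by rewrite -doubleS leq_double.
  apply: (@measurableI _ (fld 0 N.*2)); apply: increment_gt_fld => //.
  + by rewrite leqnSn.
  + exact: ltnW.
  + by rewrite leqnSn.
- by apply: measurableC; exact: mBf.
by rewrite prob_setC// pB [RHS]exprSr -IH.
Qed.

End walk.

(** * Discretized Levy processes *)

Lemma bernoulli_le (R : realType) n (a : R) : 0 <= a ->
  1 + n%:R * a <= (1 + a) ^+ n.
Proof.
move=> a0; elim: n => [|n IH]; first by rewrite mul0r addr0 expr0.
rewrite exprS -natr1; have h : 0 <= n%:R * a by rewrite mulr_ge0.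
by nra.
Qed.

Section levy_grid.
Context d (T : measurableType d) (R : realType) (P : probability T R).
Variable V : levy_process P.
Implicit Types (k : nat) (e p : R).

Lemma levy_grid_measurable k n : measurable_fun setT (V (n%:R / k%:R)).
Proof. by apply: lp_measurable; rewrite divr_ge0. Qed.

Lemma levy_grid0 k w : V (0%:R / k%:R) w = 0.
Proof. by rewrite mul0r lp_start. Qed.

Lemma levy_stationary (s t : R) (B : set R) : 0 <= s -> 0 <= t -> measurable B ->
  prob P [set w | B (V (s + t) w - V s w)] = prob P [set w | B (V t w)].
Proof.
move=> s0 t0 mB; have := lp_stationary V s0 t0 mB.
rewrite /increment /preimage /prob /= => ->; congr (fine (P _)).
by apply/seteqP; split=> w /=; rewrite lp_start subr0.
Qed.

Lemma levy_grid_stationary k i j (B : set R) : measurable B ->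
  prob P [set w | B (V ((i + j)%N%:R / k%:R) w - V (i%:R / k%:R) w)] =
  prob P [set w | B (V (j%:R / k%:R) w)].
Proof. by move=> mB; rewrite natrD mulrDl levy_stationary// divr_ge0. Qed.

Lemma levy_grid_independent k n (B : nat -> set R) : (forall i, measurable (B i)) ->
  prob P (\bigcap_(i < n)
    (fun w => V (i.+1%:R / k%:R) w - V (i%:R / k%:R) w) @^-1` B i) =
  \prod_(i < n) prob P ((fun w => V (i.+1%:R / k%:R) w - V (i%:R / k%:R) w) @^-1` B i).
Proof.
move=> mB; have := @lp_independent _ _ _ _ V n (fun i => i%:R / k%:R) B.
rewrite mul0r => /(_ (lexx _)) H.
have mX i : measurable ((fun w => V (i.+1%:R / k%:R) w - V (i%:R / k%:R) w) @^-1` B i).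
  rewrite -[X in measurable X]setTI; apply: measurable_funB => //;
  exact: levy_grid_measurable.
apply: EFin_inj; rewrite -prob_fin; last exact: bigcap_measurableType.
rewrite -prodEFin; under [RHS]eq_bigr do rewrite -prob_fin//.
by apply: H => // i j ij; rewrite ler_wpM2r// ler_nat.
Qed.

(** A cadlag path does not have large increments on two neighbouring cells of
    a fine grid, whereas a fine grid contains many independent such pairs. *)
Lemma levy_pair_cvg0 e : 0 < e ->
  n%:R * prob P [set w | e < `|V (1 / n.*2%:R) w|] ^+ 2 @[n --> \oo] --> (0 : R).
Proof.
move=> e0; pose S n j w := V (j%:R / n.*2%:R) w.
pose E n := \bigcap_(b < n) ~` [set w | e < `|S n b.*2.+1 w - S n b.*2 w| /\
   e < `|S n b.*2.+2 w - S n b.*2.+1 w|].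
pose p n := prob P [set w | e < `|V (1 / n.*2%:R) w|].
have mgt (f : T -> R) : measurable_fun setT f -> measurable [set w | e < `|f w|].
  by move=> mf; apply: measurable_gt; exact: measurableT_comp.
have mS n j : measurable_fun setT (S n j) by exact: levy_grid_measurable.
have mE n : measurable (E n).
  apply: bigcap_measurableType => b _; apply: measurableC.
  by apply: measurableI; apply: mgt; exact: measurable_funB.
have PE n : prob P (E n) = (1 - p n ^+ 2) ^+ n.
  apply: (@no_pair_prob _ _ _ P (S n)).
  - exact: mS.
  - by move=> i j B; exact: levy_grid_stationary.
  - by move=> m B; exact: levy_grid_independent.
have cE : prob P (E n) @[n --> \oo] --> (1 : R).
  have := @mean_cvg _ _ _ P (fun n => \1_(E n)) (fun=> 1) 1.
  rewrite mean_cst; under eq_fun do rewrite mean_indic//.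
  apply.
  - by move=> n; exact: measurable_indic.
  - by move=> n w; rewrite indicE; case: (_ \in _); rewrite ?normr1 ?normr0.
  move=> w; apply: cvg_near_cst.
  have := @cadlag_one_switch_grid _ (levy_path V w) _ e0.
  move=> H; near=> n.
  rewrite indicE mem_set// => b /= bn [h1 h2].
  have [/(_ b bn)[u /andP[u1 u2] [uP1 uP2]] _] : (forall b, (b < n)%N ->
     one_switch (levy_path V w) e (b%:R / n%:R) (b.+1%:R / n%:R)) /\
     (forall s, n.-1%:R / n%:R <= s < 1 ->
      `|levy_path V w (n.-1%:R / n%:R) - levy_path V w s| <= e) by near: n.
  have n0 : (0 < n)%N by exact: leq_ltn_trans bn.
  have nR : 0 < n%:R :> R by rewrite ltr0n.
  have pE j : (j <= n.*2)%N -> levy_path V w (j%:R / n.*2%:R) = S n j w.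
    move=> jn; rewrite /= /restrict01 patchT// inE /= in_itv/= divr_ge0//=.
    by rewrite ler_pdivrMr ?mul1r ?ler_nat// ltr0n double_gt0.
  have dE j : j%:R / n%:R = j.*2%:R / n.*2%:R :> R.
    by rewrite -!muln2 !natrM -mulf_div divff ?mulr1.
  have b2 : (b.*2.+2 <= n.*2)%N by rewrite -doubleS leq_double.
  have [lt|ge] := ltP (b.*2.+1%:R / n.*2%:R) u.
    have := uP1 (b.*2.+1%:R / n.*2%:R); rewrite lt dE !pE//; last 2 first.
    - exact: ltnW.
    - by rewrite ltnW// ltnW.
    rewrite ler_wpM2r ?ler_nat//= => /(_ isT); rewrite distrC leNgt.
    by rewrite h1.
  have := uP2 (b.*2.+1%:R / n.*2%:R); rewrite ge dE doubleS !pE//; last first.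
    exact: ltnW.
  rewrite ler_wpM2r ?ler_nat//= => /(_ isT); rewrite leNgt.
  by rewrite h2.
have cI : (prob P (E n))^-1 - 1 @[n --> \oo] --> (0 : R).
  rewrite -(subrr 1); apply: cvgB; last exact: cvg_cst.
  by rewrite -[X in _ --> X]invr1; apply: cvgV => //; exact: oner_neq0.
apply: (squeeze_cvgr _ (cvg_cst 0) cI).
have E0 : \forall n \near \oo, 0 < prob P (E n).
  exact: (cvgr_gt 1 cE _ ltr01).
near=> n; rewrite mulr_ge0 ?sqr_ge0//=.
have En : 0 < prob P (E n) by near: n.
rewrite -/(p n) lerBrDl -[(prob _ _)^-1]mul1r ler_pdivlMr// PE.
set a := p n ^+ 2.
have a0 : 0 <= a by exact: sqr_ge0.
have a1 : a <= 1.
  rewrite expr_le1//; last exact: prob_ge0.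
  by apply: prob_le1; apply: mgt; exact: lp_measurable.
have := bernoulli_le n a0.
have : ((1 - a) * (1 + a)) ^+ n <= 1 by rewrite exprn_ile1//; nra.
rewrite exprMn; have : 0 <= (1 - a) ^+ n by rewrite exprn_ge0// subr_ge0.
nra.
Unshelve. all: by end_near. Qed.

Definition grid_path k w : skorohod R :=
  step_path k (fun j => V (j%:R / k%:R) w).

Lemma levy_path_grid k j w : (j <= k)%N ->
  levy_path V w (j%:R / k%:R) = V (j%:R / k%:R) w.
Proof.
move=> jk; rewrite /= /restrict01 patchT// inE /= in_itv/= divr_ge0//=.
have [->|k0] := posnP k; first by rewrite invr0 mulr0.
by rewrite ler_pdivrMr ?mul1r ?ler_nat// ltr0n.
Qed.

Lemma step_path_eq k (v v' : nat -> R) : (forall j, (j <= k)%N -> v j = v' j) ->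
  step_path k v = step_path k v'.
Proof.
move=> vv; apply: skorohod_dist_positivity; apply/eqP.
rewrite eq_le skorohod_dist_ge0 andbT; apply: skorohod_dist_le.
by apply: step_close => j /vv ->; rewrite subrr normr0.
Qed.

Lemma grid_path_cvg w e : 0 < e -> \forall k \near \oo,
  skorohod_close (grid_path k w) (levy_path V w) e.
Proof.
move=> e0; have := @step_path_cvg _ (levy_path V w) _ e0.
apply: filterS => k; rewrite (@step_path_eq k _ (fun j => V (j%:R / k%:R) w))//.
by move=> j; exact: levy_path_grid.
Qed.

Lemma step_one_switch K m (S : nat -> R) e b r k : (0 < k)%N -> (0 < r)%N ->
  K = (k * r)%N -> (b < k)%N -> 0 <= e ->
  let i := (b * r)%N in let l := (b.+1 * r)%N in
  (i < m <= l)%N ->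
  (forall j, (i <= j < m)%N -> `|S j - S i| <= e) ->
  (forall j, (m <= j <= l)%N -> `|S l - S j| <= e) ->
  one_switch (step_path K S) e (b%:R / k%:R) (b.+1%:R / k%:R).
Proof.
move=> k0 r0 KE bk e0 i l /andP[im ml] H1 H2.
have kR : 0 < k%:R :> R by rewrite ltr0n.
have rR : 0 < r%:R :> R by rewrite ltr0n.
have KR : 0 < K%:R :> R by rewrite KE natrM mulr_gt0.
have nodeE c : c%:R / k%:R = (c * r)%N%:R / K%:R :> R.
  by rewrite KE !natrM -mulf_div divff ?mulr1// gt_eqF.
have yE s : 0 <= s <= 1 -> step_path K S s = S (Num.truncn (K%:R * s)).
  by move=> s01; rewrite /= /step_fun in_itv/= s01.
have lK : (l <= K)%N by rewrite KE leq_mul2r bk orbT.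
have node c : (c <= K)%N -> step_path K S (c%:R / K%:R) = S c.
  move=> cK; rewrite yE; last by rewrite divr_ge0//= ler_pdivrMr// mul1r ler_nat.
  by rewrite [K%:R * _]mulrC divfK ?gt_eqF// natrK.
rewrite !nodeE -/i -/l.
have idx (s : R) j : j%:R / K%:R <= s -> (j <= Num.truncn (K%:R * s))%N.
  rewrite ler_pdivrMr// mulrC => h.
  have := le_truncn h; by rewrite natrK.
have idx2 (s : R) j : 0 <= s -> s < j%:R / K%:R -> (Num.truncn (K%:R * s) < j)%N.
  move=> s0; rewrite ltr_pdivlMr// mulrC => h; rewrite -(ltr_nat R).
  apply: le_lt_trans h; rewrite truncn_le// mulr_ge0//.
exists (m%:R / K%:R); first by rewrite ltr_pM2r ?invr_gt0// ltr_nat im ler_pM2r ?invr_gt0// ler_nat.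
have lm1 : l%:R / K%:R <= 1 :> R by rewrite ler_pdivrMr// mul1r ler_nat.
have i0 : 0 <= i%:R / K%:R :> R by rewrite divr_ge0.
split=> s /andP[s1 s2].
  have s0 := le_trans i0 s1.
  rewrite node; last by rewrite (leq_trans (ltnW im))// (leq_trans ml).
  rewrite yE.
    by rewrite distrC; apply: H1; rewrite idx//= idx2.
  rewrite s0/= (le_trans _ lm1)// (le_trans (ltW s2))//.
  by rewrite ler_pM2r ?invr_gt0// ler_nat.
have s0 : 0 <= s by apply: le_trans s1; rewrite divr_ge0.
rewrite node// yE; last by rewrite s0 (le_trans s2).
apply: H2; rewrite idx//= -ltnS; apply: idx2 => //.
apply: (le_lt_trans s2); by rewrite ltr_pM2r ?invr_gt0// ltr_nat.
Qed.

(** A cell without two successive exits contains at most one jump up to 80 e: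
    the walk stays within 40 e of its start before the first exit, and within
    40 e of the exit point after it. The bound does not
    depend on the refinement r, which can therefore tend to infinity. *)
Lemma grid_refine_close k r e p : (0 < k)%N -> (0 < r)%N -> 0 < e ->
  prob P [set w | e < `|V (1 / k%:R) w|] <= p -> 12 * p < 1 ->
  exists2 A : set T, measurable A /\ prob P A <= k%:R * (8 * p) ^+ 2 + 8 * p &
    forall w, ~ A w -> skorohod_close (grid_path k w) (grid_path (k * r) w)
      (Num.max k%:R^-1 (80 * e)).
Proof.
move=> k0 r0 e0 Hp p12; pose K := (k * r)%N; pose S j w := V (j%:R / K%:R) w.
have kR : 0 < k%:R :> R by rewrite ltr0n.
have rR : 0 < r%:R :> R by rewrite ltr0n.
have KR : 0 < K%:R :> R by rewrite natrM mulr_gt0.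
have nodeE c : c%:R / k%:R = (c * r)%N%:R / K%:R :> R.
  by rewrite /K !natrM -mulf_div divff ?mulr1// gt_eqF.
have mS j : measurable_fun setT (S j) by exact: levy_grid_measurable.
have S0 w : S 0%N w = 0 by exact: levy_grid0.
have stat i j (B : set R) : measurable B ->
    prob P [set w | B (S (i + j)%N w - S i w)] = prob P [set w | B (S j w)].
  exact: levy_grid_stationary.
have ind n (B : nat -> set R) : (forall i, measurable (B i)) ->
    prob P (\bigcap_(i < n) (fun w => S i.+1 w - S i w) @^-1` B i) =
    \prod_(i < n) prob P ((fun w => S i.+1 w - S i w) @^-1` B i).
  exact: levy_grid_independent.
have Sr : prob P [set w | e < `|S r w|] <= p.
  have E : r%:R / K%:R = 1 / k%:R :> R by have := nodeE 1%N; rewrite mul1n.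
  by rewrite /S E.
pose D b := \bigcup_(m < (b.+1 * r).+1)
   (first_exit S (b * r) (40 * e) m `&` exits S m (b.+1 * r) (40 * e)).
pose F := exits S (k.-1 * r) (k * r) (40 * e).
have mD b : measurable (D b).
  apply: bigcup_measurable => m _; apply: measurableI.
    by apply: (@fld_measurable _ _ _ S mS (b * r) m); exact: first_exit_fld.
  by apply: (@fld_measurable _ _ _ S mS m (b.+1 * r)); exact: exits_fld.
have mF : measurable F.
  by apply: (@fld_measurable _ _ _ S mS (k.-1 * r) (k * r)); exact: exits_fld.
have pD b : prob P (D b) <= (8 * p) ^+ 2.
  apply: (@double_exit_small _ _ _ P S mS S0 stat ind r) => //.
    by rewrite leq_mul2r leqnSn orbT.
  by rewrite -mulnBl subSnn mul1n.
have pF : prob P F <= 8 * p.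
  apply: (@exits_small _ _ _ P S mS S0 stat ind r) => //.
    by rewrite leq_mul2r leq_pred orbT.
  by rewrite -mulnBl -{1}(prednK k0) subSnn mul1n.
exists ((\bigcup_(b < k) D b) `|` F).
  split; first by apply: measurableU => //; exact: bigcup_measurable.
  rewrite (le_trans (prob_setU _ _ _))//; first exact: bigcup_measurable.
  rewrite lerD//; apply: (le_trans (prob_bigcup _ _ _)) => //.
  apply: (@le_trans _ _ (\sum_(b < k) (8 * p) ^+ 2)); first exact: ler_sum.
  by rewrite sumr_const card_ord -[X in X <= _]mulr_natl.
move=> w /not_orP[nD nF].
pose y := grid_path K w.
have yE j : (j <= k)%N -> y (j%:R / k%:R) = V (j%:R / k%:R) w.
  move=> jk; rewrite /y /= /step_fun in_itv/= divr_ge0//= ler_pdivrMr// mul1r.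
  rewrite ler_nat jk nodeE; congr (V (_ / _) w).
  by rewrite [K%:R * _]mulrC divfK ?gt_eqF// natrK.
have -> : grid_path k w = step_path k (fun j => y (j%:R / k%:R)).
  by apply: step_path_eq => j jk; rewrite yE.
have e80 : 40 * e <= 80 * e by move: e0; lra.
have e40 : 0 <= 40 * e by move: e0; lra.
have block b : (b < k)%N -> one_switch y (80 * e) (b%:R / k%:R) (b.+1%:R / k%:R).
  move=> bk; pose i := (b * r)%N; pose l := (b.+1 * r)%N.
  have il : (i < l)%N by rewrite /i /l ltn_mul2r r0 ltnSn.
  have [[m /= ml fm]|nex] := pselect (exits S i l (40 * e) w); last first.
    apply: (@step_one_switch K l _ _ b r k) => //; first exact: le_trans e80.
    - by rewrite il leqnn.
    - move=> j /andP[ij jl]; rewrite leNgt; apply/negP => h.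
      apply: nex; exists j; first by rewrite ij ltnW.
      exact: le_lt_trans h.
    - move=> j /andP[lj jl]; have -> : j = l by apply/eqP; rewrite eqn_leq jl.
      by rewrite subrr normr0; exact: le_trans e80.
  have ex : exits S i l (40 * e) w by exists m.
  move: ex; rewrite exitsE => -[m' /= m'l fm'].
  have [im' [m'c m'P]] := fm'.
  have im'' : (i < m')%N.
    rewrite ltn_neqAle im' andbT; apply/eqP => E.
    by move: m'c; rewrite E subrr normr0 ltNge e40.
  have nm j : (m' <= j <= l)%N -> `|S j w - S m' w| <= 40 * e.
    move=> jP; rewrite leNgt; apply/negP => h; apply: nD.
    exists b => //; exists m' => //; split=> //.
    by exists j.
  apply: (@step_one_switch K m' _ _ b r k) => //; first exact: le_trans e80.
  - by rewrite im''.
  - by move=> j /m'P h; exact: le_trans e80.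
  - move=> j /andP[mj jl].
    have h1 := nm j; have h2 := nm l.
    rewrite mj jl in h1; rewrite leqnn -ltnS m'l in h2.
    have := ler_distD (S m' w) (S l w) (S j w).
    rewrite [`|S m' w - S j w|]distrC.
    by move: (h1 isT) (h2 isT); rewrite -/(S l w) -/(S j w); lra.
apply: one_switch_close => //; first exact: le_trans e80.
  by move=> b /ltnW; exact: block.
move=> s /andP[s1 s2].
have s0 : 0 <= s by apply: le_trans s1; rewrite divr_ge0.
rewrite yE ?leq_pred// nodeE /y /= /step_fun in_itv/= s0 (ltW s2)/= distrC.
rewrite leNgt; apply/negP => h; apply: nF.
exists (Num.truncn (K%:R * s)); last exact: le_lt_trans h.
apply/andP; split.
  by have := le_truncn (_ : (k.-1 * r)%N%:R <= K%:R * s); rewrite natrK; apply;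
    rewrite mulrC -ler_pdivrMr// -nodeE.
rewrite -(ler_nat R) (@le_trans _ _ (K%:R * s)) ?truncn_le ?mulr_ge0//.
by rewrite -/K ler_piMr// ltW.
Qed.

(** Rounding the values of a discretized path makes it countably valued. *)
Lemma grid_path_measurable k (f : skorohod R -> R) : continuous f ->
  measurable_fun setT (f \o grid_path k).
Proof.
move=> cf.
pose Z n w : {ffun 'I_k.+1 -> int} :=
  [ffun j : 'I_k.+1 => Num.floor (n.+1%:R * V (j%:R / k%:R) w)].
pose h n (z : {ffun 'I_k.+1 -> int}) :=
  f (step_path k (fun j => (z (inord j))%:~R / n.+1%:R)).
have mZ n z : measurable [set w | Z n w = z].
  rewrite (_ : [set w | _] = \bigcap_(j : 'I_k.+1)
      ([set w | (z j)%:~R <= n.+1%:R * V (j%:R / k%:R) w] `&`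
       [set w | n.+1%:R * V (j%:R / k%:R) w < (z j + 1)%:~R])).
    apply: fin_bigcap_measurable => [|j _]; first exact: finite_finset.
    have m : measurable_fun setT (fun w => n.+1%:R * V (j%:R / k%:R) w).
      by apply: measurable_funM => //; exact: levy_grid_measurable.
    by apply: measurableI; [exact: measurable_ge|exact: measurable_lt].
  apply/seteqP; split=> w /=.
    move=> zE j _; rewrite /= -zE ffunE; apply/andP.
    by rewrite -floor_eq.
  move=> H; apply/ffunP => j; rewrite ffunE; apply/eqP.
  by rewrite floor_eq; apply/andP; exact: H.
apply: (@measurable_fun_cvg _ _ _ _ (fun n w => h n (Z n w))) => [n|w _].
  move=> _ Y mY; rewrite setTI.
  rewrite (_ : _ @^-1` _ = \bigcup_z (if h n z \in Y then [set w | Z n w = z] else set0)).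
    apply: countable_bigcupT_measurable => [|z]; first exact: countableP.
    by case: ifP.
  apply/seteqP; split=> w /=.
    by move=> Yw; exists (Z n w) => //; rewrite mem_set.
  by move=> [z _]; case: ifPn => //; rewrite inE => Yz zE; rewrite /= zE.
apply: continuous_skorohod_cvg => // e e0.
near=> n; apply: step_close => j jk.
rewrite ffunE inordK//.
have n0 : 0 < n.+1%:R :> R by [].
have -> : V (j%:R / k%:R) w = n.+1%:R * V (j%:R / k%:R) w / n.+1%:R.
  by rewrite mulrAC divff ?mul1r// gt_eqF.
have := eqxx (Num.floor (n.+1%:R * (n.+1%:R * V (j%:R / k%:R) w / n.+1%:R))).
rewrite floor_eq => /andP[].
rewrite [n.+1%:R * (_ / _)]mulrC divfK ?gt_eqF//.
set x := n.+1%:R * _; rewrite intrD => x1 x2.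
rewrite -mulrBl normrM [X in _ * X]gtr0_norm ?invr_gt0// ler_pdivrMr//.
apply: (@le_trans _ _ 1).
  by rewrite ler_norml; apply/andP; split; lra.
rewrite mulrC -ler_pdivrMr// mul1r.
rewrite (@le_trans _ _ n%:R) ?ler_nat//.
by near: n; exact: nbhs_infty_ger.
Unshelve. all: by end_near. Qed.

Lemma levy_path_measurable (f : skorohod R -> R) : continuous f ->
  measurable_fun setT (f \o levy_path V).
Proof.
move=> cf; apply: (@measurable_fun_cvg _ _ _ _ (fun k => f \o grid_path k)).
  by move=> k; exact: grid_path_measurable.
move=> w _ /=; apply: continuous_skorohod_cvg => // e; exact: grid_path_cvg.
Qed.

End levy_grid.

(** * Characteristic functions *)

Section trigonometric_bounds.
Context {R : realType}.
Implicit Types x y : R.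

Lemma lipschitz1_of_derive (f f' : R -> R) : (forall x, is_derive x 1 f (f' x)) ->
  (forall x, `|f' x| <= 1) -> forall x y, `|f x - f y| <= `|x - y|.
Proof.
move=> df f1 x y; wlog yx : x y / y <= x.
  move=> H; have [/H//|/ltW/H] := leP y x.
  by rewrite distrC [`|y - x|]distrC.
have cf : {within `[y, x], continuous f}.
  by apply: derivable_within_continuous => z _; case: (df z).
have [c _ ->] := MVT_segment yx (fun z _ => df z) cf.
by rewrite normrM ler_piMl.
Qed.

Lemma cos_lipschitz x y : `|cos x - cos y| <= `|x - y|.
Proof.
apply: (@lipschitz1_of_derive _ (fun x => - sin x)) => z.
by rewrite normrN sin_max.
Qed.

Lemma sin_lipschitz x y : `|sin x - sin y| <= `|x - y|.
Proof. by apply: (@lipschitz1_of_derive _ cos) => z; exact: cos_max. Qed.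

End trigonometric_bounds.

Section characteristic_function.
Context d (T : measurableType d) (R : realType) (P : probability T R).
Variable X : T -> R.
Hypothesis mX : measurable_fun setT X.

Definition cfc (x : R) := mean P (fun w => cos (x * X w)).
Definition cfs (x : R) := mean P (fun w => sin (x * X w)).

Let mxX (x : R) : measurable_fun setT (fun w => x * X w).
Proof. exact: measurable_funM. Qed.

Lemma bounded_rv_cos x : bounded_rv (fun w => cos (x * X w)).
Proof.
split; last by exists 1 => w; exact: cos_max.
exact: (measurableT_comp (continuous_measurable_fun (@continuous_cos R)) (mxX x)).
Qed.

Lemma bounded_rv_sin x : bounded_rv (fun w => sin (x * X w)).
Proof.
split; last by exists 1 => w; exact: sin_max.
exact: (measurableT_comp (continuous_measurable_fun (@continuous_sin R)) (mxX x)).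
Qed.

Let m_gt (M : R) : measurable [set w | M < `|X w|].
Proof. by apply: measurable_gt; exact: measurableT_comp. Qed.

Let osc (M x y : R) w : ~ [set w | M < `|X w|] w -> `|x * X w - y * X w| <= M * `|x - y|.
Proof.
move=> /negP; rewrite -leNgt => XM; rewrite -mulrBl normrM mulrC.
exact: ler_wpM2r.
Qed.

Lemma cfc_close (M x y : R) : 0 <= M ->
  `|cfc x - cfc y| <= M * `|x - y| + 2 * prob P [set w | M < `|X w|].
Proof.
move=> M0; rewrite -[2]mulr1; apply: mean_close => //.
- exact: bounded_rv_cos.
- exact: bounded_rv_cos.
- by rewrite mulr_ge0.
- by move=> w; exact: cos_max.
- by move=> w; exact: cos_max.
- by move=> w wM; apply: le_trans (cos_lipschitz _ _) (osc x y wM).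
Qed.

Lemma cfs_close (M x y : R) : 0 <= M ->
  `|cfs x - cfs y| <= M * `|x - y| + 2 * prob P [set w | M < `|X w|].
Proof.
move=> M0; rewrite -[2]mulr1; apply: mean_close => //.
- exact: bounded_rv_sin.
- exact: bounded_rv_sin.
- by rewrite mulr_ge0.
- by move=> w; exact: sin_max.
- by move=> w; exact: sin_max.
- by move=> w wM; apply: le_trans (sin_lipschitz _ _) (osc x y wM).
Qed.

Let continuous_of_close (f : R -> R) :
  (forall M x y, 0 <= M ->
    `|f x - f y| <= M * `|x - y| + 2 * prob P [set w | M < `|X w|]) ->
  continuous f.
Proof.
move=> fP x; apply/cvgrPdist_le => e e0.
have [|M M0 PM] := tail_small P mX (_ : 0 < e / 4); first by rewrite divr_gt0.
near=> y; have := fP M x y (ltW M0).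
have : `|x - y| <= e / 4 / M.
  near: y; apply: cvgr_dist_le; first exact: cvg_id.
  by rewrite !divr_gt0.
rewrite ler_pdivlMr// mulrC; move: PM; lra.
Unshelve. all: by end_near. Qed.

Lemma cfc_continuous : continuous cfc.
Proof. exact: continuous_of_close cfc_close. Qed.

Lemma cfs_continuous : continuous cfs.
Proof. exact: continuous_of_close cfs_close. Qed.

Lemma cfc0 : cfc 0 = 1.
Proof.
by rewrite /cfc; under eq_fun do rewrite mul0r cos0; exact: mean_cst.
Qed.

Lemma cfs0 : cfs 0 = 0.
Proof.
by rewrite /cfs; under eq_fun do rewrite mul0r sin0; exact: mean_cst.
Qed.

Lemma cfcN x : cfc (- x) = cfc x.
Proof. by congr mean; apply/funext => w; rewrite mulNr cosN. Qed.

Lemma cfsN x : cfs (- x) = - cfs x.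
Proof.
rewrite -[RHS]mulN1r /cfs -meanZ; last exact: bounded_rv_sin.
by congr mean; apply/funext => w; rewrite mulNr sinN mulN1r.
Qed.

End characteristic_function.

(** Let f = c + i s and f' = c' + i s' be square roots of two uniformly close
    functions, with the same value at 0. The real part D of f' times the
    conjugate of f cannot vanish: |f' - f| |f' + f| is small, but at a zero of D
    both factors are at least the square root of k. Hence D > 0, which bounds
    |f' + f| from below and forces f' - f to be small. *)
Lemma sqrt_close (R : realType) (c s c' s' : R -> R) (x0 k e : R) :
  continuous c -> continuous s -> continuous c' -> continuous s' ->
  c 0 = 1 -> s 0 = 0 -> c' 0 = 1 -> s' 0 = 0 ->
  0 < k -> 2 * e ^+ 2 < k ^+ 2 ->
  (forall x, 0 <= x <= x0 -> k <= c x ^+ 2 + s x ^+ 2 /\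
    `|(c' x ^+ 2 - s' x ^+ 2) - (c x ^+ 2 - s x ^+ 2)| <= e /\
    `|2 * c' x * s' x - 2 * c x * s x| <= e) ->
  forall x, 0 <= x <= x0 ->
    (c' x - c x) ^+ 2 + (s' x - s x) ^+ 2 <= 2 * e ^+ 2 / k.
Proof.
move=> cc cs cc' cs' c0 s0 c'0 s'0 k0 ek H x /andP[x_ge0 xx0].
pose D y := c' y * c y + s' y * s y.
have prodE y : ((c' y - c y) ^+ 2 + (s' y - s y) ^+ 2) *
    ((c' y + c y) ^+ 2 + (s' y + s y) ^+ 2) =
    ((c' y ^+ 2 - s' y ^+ 2) - (c y ^+ 2 - s y ^+ 2)) ^+ 2 +
    (2 * c' y * s' y - 2 * c y * s y) ^+ 2 by ring.
have prod_le y : 0 <= y <= x0 -> ((c' y - c y) ^+ 2 + (s' y - s y) ^+ 2) *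
    ((c' y + c y) ^+ 2 + (s' y + s y) ^+ 2) <= 2 * e ^+ 2.
  move=> /H[_ [h1 h2]]; rewrite prodE (_ : 2 * e ^+ 2 = e ^+ 2 + e ^+ 2); last by ring.
  have e0 : 0 <= e by rewrite (le_trans _ h1).
  by rewrite lerD// -[X in X <= _]real_normK ?num_real ?lerXn2r.
have Dn0 y : 0 <= y <= x0 -> D y != 0.
  move=> y0; apply/eqP => Dy; have := prod_le _ y0; have [h _] := H _ y0.
  rewrite (_ : (c' y - c y) ^+ 2 + _ =
    c' y ^+ 2 + s' y ^+ 2 + (c y ^+ 2 + s y ^+ 2) - 2 * D y); last by rewrite /D; ring.
  rewrite (_ : (c' y + c y) ^+ 2 + _ =
    c' y ^+ 2 + s' y ^+ 2 + (c y ^+ 2 + s y ^+ 2) + 2 * D y); last by rewrite /D; ring.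
  rewrite Dy mulr0 subr0 addr0 => le.
  have := sqr_ge0 (c' y); have := sqr_ge0 (s' y).
  by move: le h ek k0; nra.
have cD : continuous D.
  move=> y; apply: cvgD; apply: cvgM; [exact: cc'|exact: cc|exact: cs'|exact: cs].
have Dpos : 0 < D x.
  rewrite ltNge; apply/negP => Dx.
  have D0 : D 0 = 1 by rewrite /D c0 c'0 s0 s'0; ring.
  have [||y + Dy] := @IVT _ D 0 x 0 x_ge0.
  - exact: continuous_subspaceT.
  - by rewrite D0 ge_min Dx orbT le_max ler01.
  rewrite in_itv/= => /andP[y0 yx]; have := Dn0 y.
  by rewrite Dy eqxx y0 (le_trans yx xx0) => /(_ isT).
have x01 : 0 <= x <= x0 by rewrite x_ge0.
have := prod_le _ x01; have [h _] := H _ x01.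
rewrite ler_pdivlMr//; apply: le_trans; apply: ler_wpM2l.
  by rewrite addr_ge0// sqr_ge0.
rewrite (_ : (c' x + c x) ^+ 2 + _ =
    c' x ^+ 2 + s' x ^+ 2 + (c x ^+ 2 + s x ^+ 2) + 2 * D x); last by rewrite /D; ring.
have := sqr_ge0 (c' x); have := sqr_ge0 (s' x).
by move: h Dpos; lra.
Qed.

Section convergence.
Context (R : realType) (d : nat -> measure_display)
  (T : forall n, measurableType (d n)) (P : forall n, probability (T n) R)
  (d0 : measure_display) (T0 : measurableType d0) (P0 : probability T0 R).

Definition cf_cvg (X : forall n, T n -> R) (X0 : T0 -> R) :=
  forall x0 e : R, 0 < e -> \forall n \near \oo, forall x, 0 <= x <= x0 ->
    `|cfc (P n) (X n) x - cfc P0 X0 x| <= e /\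
    `|cfs (P n) (X n) x - cfs P0 X0 x| <= e.

Definition tight (X : forall n, T n -> R) := forall e : R, 0 < e ->
  exists M : R, 0 < M /\ \forall n \near \oo, prob (P n) [set w | M < `|X n w|] < e.

Section weak.
Variables (X : forall n, T n -> R) (X0 : T0 -> R).
Arguments X : clear implicits.
Hypotheses (mX : forall n, measurable_fun setT (X n)) (mX0 : measurable_fun setT X0).
Hypothesis wcvg : cvg_in_distribution P X P0 X0.

Let mean_wcvg (f : R -> R) (M : R) : continuous f -> (forall x, `|f x| <= M) ->
  mean (P n) (f \o X n) @[n --> \oo] --> mean P0 (f \o X0).
Proof.
move=> cf fM; have := wcvg cf (ex_intro _ M fM).
have mf := continuous_measurable_fun cf.
under eq_fun => n.
  rewrite expectation_mean; last first.
    by split; [exact: measurableT_comp|exists M => w; exact: fM].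
  over.
rewrite expectation_mean; last first.
  by split; [exact: measurableT_comp|exists M => w; exact: fM].
by move/fine_cvgP => [_].
Qed.

(** The tail of X n is bounded by the mean of a continuous function that
    interpolates between the indicators of the tails at M and M + 1. *)
Lemma weak_tight : tight X.
Proof.
move=> e e0; have [M M0 PM] := tail_small P0 mX0 e0.
pose f (x : R) := Num.min 1 (Num.max 0 (`|x| - M)).
have f0 x : 0 <= f x by rewrite le_min ler01 le_max lexx.
have f1 x : f x <= 1 by rewrite ge_min lexx.
have fb x : `|f x| <= 1 by rewrite ger0_norm.
have cf : continuous ((cst 1 : R -> R^o) \min
    ((cst 0 : R -> R^o) \max (fun x : R => `|x| - M : R^o))).
  move=> x; apply: continuous_min; first exact: cvg_cst.
  apply: continuous_max; first exact: cvg_cst.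
  by apply: cvgB; [exact: norm_continuous|exact: cvg_cst].
rewrite -[_ \min _]/f in cf.
have mf := continuous_measurable_fun cf.
exists (M + 1); split; first by rewrite addr_gt0.
have bf0 : bounded_rv (f \o X0).
  by split; [exact: measurableT_comp|exists 1 => w; exact: fb].
have m_gt d' (T' : measurableType d') (Y : T' -> R) (N : R) : measurable_fun setT Y ->
    measurable [set w | N < `|Y w|].
  by move=> mY; apply: measurable_gt; exact: measurableT_comp.
have le0 : mean P0 (f \o X0) < e.
  apply: le_lt_trans PM; rewrite -mean_indic; last exact: m_gt.
  apply: le_mean => //; first by apply: bounded_rv_indic; exact: m_gt.
  move=> w; rewrite indicE; case: (boolP (w \in [set w | M < `|X0 w|])) => [_|]; first exact: f1.
  rewrite notin_setE /= => /negP; rewrite -leNgt => XM.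
  by rewrite /f /= ge_min ge_max lexx/= subr_le0 XM orbT.
have := @mean_wcvg f 1 cf fb.
move/cvgr_lt/(_ _ le0); apply: filterS => n; apply: le_lt_trans.
rewrite -mean_indic; last exact: m_gt.
apply: le_mean.
- by apply: bounded_rv_indic; exact: m_gt.
- by split; [exact: measurableT_comp|exists 1 => w; exact: fb].
move=> w; rewrite indicE; case: (boolP (w \in [set w | M + 1 < `|X n w|])) => [|_]; last exact: f0.
rewrite inE /= => XM; rewrite /f le_min lexx/= le_max.
by rewrite lerBrDl (ltW XM) orbT.
Qed.

(** Tightness makes the characteristic functions equicontinuous, so that they
    converge uniformly near each point. *)
Lemma weak_cf_cvg : cf_cvg X X0.
Proof.
move=> x0 e e0; have e40 : 0 < e / 16 by rewrite divr_gt0.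
have [M1 [M10 PM1]] := weak_tight e40.
have [M2 M20 PM2] := tail_small P0 mX0 e40.
have [] := @compact_near_coveringP R `[0, x0]%classic.
move=> /(_ (@segment_compact R 0 x0)) cov _.
pose Q n x := `|cfc (P n) (X n) x - cfc P0 X0 x| <= e /\
    `|cfs (P n) (X n) x - cfs P0 X0 x| <= e.
suff : \forall n \near \oo, `[0, x0]%classic `<=` Q n.
  apply: filterS => n H x x01; apply: H.
  by rewrite /= in_itv/=.
apply: cov => x _.
have c1 : cfc (P n) (X n) x @[n --> \oo] --> cfc P0 X0 x.
  apply: (@mean_wcvg (fun y => cos (x * y)) 1) => y; last exact: cos_max.
  apply: continuous_comp; last exact: continuous_cos.
  by apply: cvgM; [exact: cvg_cst|exact: cvg_id].
have c2 : cfs (P n) (X n) x @[n --> \oo] --> cfs P0 X0 x.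
  apply: (@mean_wcvg (fun y => sin (x * y)) 1) => y; last exact: sin_max.
  apply: continuous_comp; last exact: continuous_sin.
  by apply: cvgM; [exact: cvg_cst|exact: cvg_id].
pose r := Num.min (e / 16 / M1) (e / 16 / M2).
have r0 : 0 < r by rewrite lt_min !divr_gt0.
have e20 : 0 < e / 2 by rewrite divr_gt0.
exists ([set y | `|x - y| < r], [set n | prob (P n) [set w | M1 < `|X n w|] < e / 16 /\
   `|cfc (P n) (X n) x - cfc P0 X0 x| <= e / 2 /\
   `|cfs (P n) (X n) x - cfs P0 X0 x| <= e / 2]).
  split; first by exists r.
  near=> n; split; first by near: n.
  split; rewrite distrC; near: n.
    by have /cvgrPdist_le/(_ _ e20) := c1.
  by have /cvgrPdist_le/(_ _ e20) := c2.
move=> [y n] /= [xy [h1 [h2 h3]]].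
have xy1 : M1 * `|y - x| <= e / 16.
  by rewrite mulrC -ler_pdivlMr// distrC (le_trans (ltW xy))// ge_min lexx.
have xy2 : M2 * `|y - x| <= e / 16.
  by rewrite mulrC -ler_pdivlMr// distrC (le_trans (ltW xy))// ge_min lexx orbT.
split.
  have := cfc_close (P n) (@mX n) y x (ltW M10).
  have := cfc_close P0 mX0 y x (ltW M20).
  move: h2; rewrite !ler_norml => /andP[? ?] /andP[? ?] /andP[? ?].
  by move: xy1 xy2 h1 PM2 e0 => ? ? ? ? ?; apply/andP; split; lra.
have := cfs_close (P n) (@mX n) y x (ltW M10).
have := cfs_close P0 mX0 y x (ltW M20).
move: h3; rewrite !ler_norml => /andP[? ?] /andP[? ?] /andP[? ?].
by move: xy1 xy2 h1 PM2 e0 => ? ? ? ? ?; apply/andP; split; lra.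
Unshelve. all: by end_near. Qed.

End weak.

(** The hypotheses on Y and Y0 say that their characteristic functions are square
    roots of those of X and X0, written with real and imaginary parts. *)
Lemma cf_cvg_sqrt (X Y : forall n, T n -> R) (X0 Y0 : T0 -> R) :
  (forall n, measurable_fun setT (Y n)) -> measurable_fun setT Y0 ->
  (forall n x, cfc (P n) (X n) x =
     cfc (P n) (Y n) x ^+ 2 - cfs (P n) (Y n) x ^+ 2 /\
     cfs (P n) (X n) x = 2 * cfc (P n) (Y n) x * cfs (P n) (Y n) x) ->
  (forall x, cfc P0 X0 x = cfc P0 Y0 x ^+ 2 - cfs P0 Y0 x ^+ 2 /\
     cfs P0 X0 x = 2 * cfc P0 Y0 x * cfs P0 Y0 x) ->
  (forall x, 0 < cfc P0 Y0 x ^+ 2 + cfs P0 Y0 x ^+ 2) ->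
  cf_cvg X X0 -> cf_cvg Y Y0.
Proof.
move=> mY mY0 Xn X00 pos XX x0 e e0.
have [x0n|x0p] := ltP x0 0.
  by apply: nearW => n x /andP[x1 x2]; move: (le_trans x1 x2); rewrite leNgt x0n.
have cc := @cfc_continuous _ _ _ P0 _ mY0; have cs := @cfs_continuous _ _ _ P0 _ mY0.
have [z z01 zmin] : exists2 z, z \in `[0, x0] & forall t, t \in `[0, x0] ->
    cfc P0 Y0 z ^+ 2 + cfs P0 Y0 z ^+ 2 <= cfc P0 Y0 t ^+ 2 + cfs P0 Y0 t ^+ 2.
  apply: (@EVT_min _ (fun x => cfc P0 Y0 x ^+ 2 + cfs P0 Y0 x ^+ 2)) => //.
  apply: continuous_subspaceT => x.
  by apply: cvgD; apply: cvgM; [exact: cc|exact: cc|exact: cs|exact: cs].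
set k := cfc P0 Y0 z ^+ 2 + cfs P0 Y0 z ^+ 2 in zmin.
have k0 : 0 < k by exact: pos.
pose r := Num.min (k / 2) (Num.min 1 (e ^+ 2 * k / 2)).
have e2 : 0 < e ^+ 2 by rewrite exprn_gt0.
have r0 : 0 < r by rewrite !lt_min ltr01 !divr_gt0// mulr_gt0.
have rk : r <= k / 2 by rewrite ge_min lexx.
have r1 : r <= 1 by rewrite !ge_min lexx orbT.
have re : r <= e ^+ 2 * k / 2 by rewrite !ge_min lexx !orbT.
have rrk : 2 * r ^+ 2 < k ^+ 2 by move: k0 rk r0; nra.
have rr : r ^+ 2 <= r by rewrite expr2 ler_piMr// ltW.
near=> n.
have Hn x : 0 <= x <= x0 -> `|cfc (P n) (X n) x - cfc P0 X0 x| <= r /\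
    `|cfs (P n) (X n) x - cfs P0 X0 x| <= r.
  by move: x; near: n; exact: XX.
move=> x x01.
have : (cfc (P n) (Y n) x - cfc P0 Y0 x) ^+ 2 +
       (cfs (P n) (Y n) x - cfs P0 Y0 x) ^+ 2 <= 2 * r ^+ 2 / k.
  apply: (@sqrt_close _ _ _ _ _ x0 k r) => //.
  - exact: cfc_continuous.
  - exact: cfs_continuous.
  - exact: cfc0.
  - exact: cfs0.
  - exact: cfc0.
  - exact: cfs0.
  - move=> y y01; split; first by apply: zmin; rewrite in_itv.
    by have [<- <-] := Xn n y; have [<- <-] := X00 y; exact: Hn.
have : 2 * r ^+ 2 / k <= e ^+ 2.
  by rewrite ler_pdivrMr//; move: re rr; lra.
set a := _ - _; set b := _ - _ => h1 h2.
have sq (u : R) : u ^+ 2 <= e ^+ 2 -> `|u| <= e.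
  by rewrite -(real_normK (num_real u)) ler_pXn2r// nnegrE// ltW.
have a0 := sqr_ge0 a; have b0 := sqr_ge0 b.
by split; apply: sq; lra.
Unshelve. all: by end_near. Qed.

End convergence.

(** * From characteristic functions to distribution functions *)

Section smoothstep.
Context {R : realType}.
Implicit Types (u x : R).

Definition smoothstep u : R := 3 * u ^+ 2 - 2 * u ^+ 3.

Lemma smoothstep_itv u : 0 <= u <= 1 -> 0 <= smoothstep u <= 1.
Proof.
move=> /andP[u0 u1]; rewrite /smoothstep; apply/andP; split.
  rewrite (_ : _ - _ = u ^+ 2 * (3 - 2 * u)); last by ring.
  by rewrite mulr_ge0// ?sqr_ge0//; lra.
rewrite -subr_ge0 (_ : _ - _ = (1 - u) ^+ 2 * (1 + 2 * u)); last by ring.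
by rewrite mulr_ge0// ?sqr_ge0//; lra.
Qed.

Lemma iter_smoothstep_itv N u : 0 <= u <= 1 -> 0 <= iter N smoothstep u <= 1.
Proof. by move=> u01; elim: N => //= N; exact: smoothstep_itv. Qed.

(** Below 1 / 2 - del, smoothstep multiplies by at most 1 - del. *)
Lemma iter_smoothstep_low N (del : R) u : 0 < del -> 0 <= u <= 1 / 2 - del ->
  iter N smoothstep u <= (1 - del) ^+ N.
Proof.
move=> del0 /andP[u0 u1].
suff : 0 <= iter N smoothstep u <= 1 / 2 - del /\
    iter N smoothstep u <= (1 - del) ^+ N by case.
elim: N => [|N [/andP[IH0 IH1] IH2]] /=.
  by rewrite u0 u1 expr0; split => //; lra.
set v := iter N smoothstep u in IH0 IH1 IH2 *.
have sE : smoothstep v = v * (1 - (1 - v) * (1 - 2 * v)) by rewrite /smoothstep; ring.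
have h : del <= (1 - v) * (1 - 2 * v) by nra.
have h' : (1 - v) * (1 - 2 * v) <= 1 by nra.
split.
  rewrite sE mulr_ge0//=; last by lra.
  by apply: le_trans IH1; rewrite ler_piMr//; lra.
rewrite exprSr sE; apply: ler_pM => //; lra.
Qed.

Lemma smoothstepC u : smoothstep (1 - u) = 1 - smoothstep u.
Proof. by rewrite /smoothstep; ring. Qed.

Lemma iter_smoothstep_high N (del : R) u : 0 < del -> 1 / 2 + del <= u <= 1 ->
  1 - (1 - del) ^+ N <= iter N smoothstep u.
Proof.
move=> del0 /andP[u0 u1].
have sN : iter N smoothstep (1 - u) = 1 - iter N smoothstep u.
  by elim: N => //= N ->; exact: smoothstepC.
have := @iter_smoothstep_low N del (1 - u) del0.
rewrite sN => H; have /H : 0 <= 1 - u <= 1 / 2 - del by apply/andP; split; lra.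
by lra.
Qed.

Inductive trig_poly : (R -> R) -> Prop :=
| TrigPoly (s : seq (R * R * R)) :
  trig_poly (fun x => \sum_(i <- s) (i.1.1 * cos (i.2 * x) + i.1.2 * sin (i.2 * x))).

Lemma trig_polyP f (s : seq (R * R * R)) :
  (forall x, f x = \sum_(i <- s) (i.1.1 * cos (i.2 * x) + i.1.2 * sin (i.2 * x))) ->
  trig_poly f.
Proof. by move=> fE; have -> : f = _ := funext fE; constructor. Qed.

Lemma trig_polyD f g : trig_poly f -> trig_poly g -> trig_poly (fun x => f x + g x).
Proof. by move=> [s] [s']; apply: (@trig_polyP _ (s ++ s')) => x; rewrite big_cat. Qed.

Lemma trig_polyM f g : trig_poly f -> trig_poly g -> trig_poly (fun x => f x * g x).
Proof.
move=> [s] [s'].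
(* product-to-sum formulas *)
pose h (i j : R * R * R) : seq (R * R * R) :=
  [:: ((i.1.1 * j.1.1 + i.1.2 * j.1.2) / 2, (i.1.2 * j.1.1 - i.1.1 * j.1.2) / 2, i.2 - j.2);
      ((i.1.1 * j.1.1 - i.1.2 * j.1.2) / 2, (i.1.2 * j.1.1 + i.1.1 * j.1.2) / 2, i.2 + j.2)].
apply: (@trig_polyP _ (flatten [seq h i j | i <- s, j <- s'])) => x.
rewrite big_flatten/= big_allpairs_dep mulr_suml; apply: eq_bigr => i _.
rewrite mulr_sumr; apply: eq_bigr => j _; rewrite /h !big_cons big_nil /=.
rewrite addr0 (_ : (i.2 - j.2) * x = i.2 * x - j.2 * x); last by ring.
rewrite (_ : (i.2 + j.2) * x = i.2 * x + j.2 * x); last by ring.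
rewrite cosB sinB cosD sinD.
by field.
Qed.

Lemma trig_poly_cst (c : R) : trig_poly (fun=> c).
Proof.
apply: (@trig_polyP _ [:: (c, 0, 0)]) => x.
by rewrite big_cons big_nil /= !mul0r cos0 mulr1 !addr0.
Qed.

Lemma trig_poly_smoothstep N f : trig_poly f ->
  trig_poly (fun x => iter N smoothstep (f x)).
Proof.
move=> tf; elim: N => //= N; set g := fun x => iter N smoothstep (f x).
move=> tg; rewrite /smoothstep.
rewrite (_ : (fun x => _) = fun x => g x * g x * (3 + - 2 * g x)).
  apply: trig_polyM; first exact: trig_polyM.
  by apply: trig_polyD; [|apply: trig_polyM => //]; exact: trig_poly_cst.
by apply/funext => x; rewrite /g; ring.
Qed.

(** A trigonometric polynomial that approximates the indicator of ]-oo, a] on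
    a large interval: smoothstep iterates push the values of a sine of small
    frequency to 0 or 1 according to its sign. *)
Lemma trig_poly_step (a r e M : R) : 0 < r -> 0 < e -> `|a| + r <= M ->
  exists g : R -> R, trig_poly g /\ forall x, 0 <= g x <= 1 /\
    (`|x| <= M -> (x <= a - r -> 1 - e <= g x) /\ (a + r <= x -> g x <= e)).
Proof.
move=> r0 e0 aM.
have M0 : 0 < M by apply: lt_le_trans aM; rewrite ltr_wpDl.
(* with this frequency, |t (a - x)| <= 1 < pi / 2 as long as |x| <= M *)
pose t := (2 * M)^-1.
have t0 : 0 < t by rewrite invr_gt0 mulr_gt0.
pose del := Num.min (sin (t * r) / 2) (1 / 2).
have pi1 : 1 <= pi / 2 :> R by have := pi_ge2 R; lra.
have trM : t * r <= 1 / 2.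
  rewrite /t mulrC ler_pdivrMr ?mulr_gt0//.
  by have := normr_ge0 a; lra.
have tr0 : 0 < t * r by rewrite mulr_gt0.
have sr0 : 0 < sin (t * r) by apply: sin_gt0_pihalf; rewrite tr0 /=; lra.
have del0 : 0 < del by rewrite lt_min !divr_gt0.
have del1 : 2 * del <= sin (t * r).
  have : del <= sin (t * r) / 2 by rewrite ge_min lexx.
  by lra.
have del2 : del <= 1 / 2 by rewrite ge_min lexx orbT.
have [N Ne] : exists N, (1 - del) ^+ N <= e.
  have : (1 - del) ^+ n @[n --> \oo] --> (0 : R).
    by apply: cvg_expr; rewrite ger0_norm; lra.
  move=> /cvgrPdist_le/(_ _ e0)[N _ NP]; exists N.
  have := NP N (leqnn _); rewrite sub0r normrN; apply: le_trans.
  exact: ler_norm.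
pose f x := (1 + sin (t * (a - x))) / 2.
exists (fun x => iter N smoothstep (f x)); split.
  apply: trig_poly_smoothstep.
  apply: (@trig_polyP _ [:: (1 / 2, 0, 0); (sin (t * a) / 2, - cos (t * a) / 2, t)]) => x.
  rewrite !big_cons big_nil /f /= mulrBr sinB mul0r cos0.
  by field.
move=> x.
have f01 : 0 <= f x <= 1.
  have := sin_max (t * (a - x)); rewrite /f ler_norml => /andP[? ?].
  by apply/andP; split; lra.
split; first exact: iter_smoothstep_itv.
move=> xM.
have bnd : -1 <= t * (a - x) <= 1.
  rewrite -ler_norml normrM gtr0_norm// /t mulrC ler_pdivrMr ?mulr_gt0// mul1r.
  by have := ler_normB a x; move: aM xM r0; lra.
have inpi (y : R) : -1 <= y <= 1 -> y \in `[- (pi / 2), pi / 2].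
  move=> /andP[y1 y2]; rewrite in_itv/=; apply/andP; split.
    by rewrite lerNl; apply: le_trans pi1; lra.
  exact: le_trans y2 pi1.
have smono : {in `[- (pi / 2), pi / 2] &, {mono (@sin R) : x y / x <= y}}.
  by move=> y z y01 z01; rewrite !leNgt ltr_sin.
split=> xa.
  have sle : sin (t * r) <= sin (t * (a - x)).
    rewrite smono ?ler_pM2l//; [lra|by apply: inpi; apply/andP; split; lra|exact: inpi].
  have hi : 1 / 2 + del <= f x <= 1.
    by move: f01; rewrite /f => /andP[? ?]; apply/andP; split; lra.
  by have := iter_smoothstep_high N del0 hi; lra.
have sle : sin (t * (a - x)) <= sin (- (t * r)).
  rewrite smono; [|exact: inpi|by apply: inpi; apply/andP; split; lra].
  by rewrite -mulrN ler_pM2l//; lra.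
have lo : 0 <= f x <= 1 / 2 - del.
  by move: f01 sle; rewrite sinN /f => /andP[? ?] ?; apply/andP; split; lra.
exact: le_trans (iter_smoothstep_low N del0 lo) Ne.
Qed.

End smoothstep.

Section cdf_convergence.
Context (R : realType) (d : nat -> measure_display)
  (T : forall n, measurableType (d n)) (P : forall n, probability (T n) R)
  (d0 : measure_display) (T0 : measurableType d0) (P0 : probability T0 R).
Variables (X : forall n, T n -> R) (X0 : T0 -> R).
Arguments X : clear implicits.
Hypotheses (mX : forall n, measurable_fun setT (X n)) (mX0 : measurable_fun setT X0).
Hypotheses (cX : cf_cvg P P0 X X0) (tX : tight P X).

Let cf_cvg_pt (x : R) : cfc (P n) (X n) x @[n --> \oo] --> cfc P0 X0 x /\
  cfs (P n) (X n) x @[n --> \oo] --> cfs P0 X0 x.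
Proof.
have pos y : 0 <= y -> cfc (P n) (X n) y @[n --> \oo] --> cfc P0 X0 y /\
    cfs (P n) (X n) y @[n --> \oo] --> cfs P0 X0 y.
  move=> y0; split; apply/cvgrPdist_le => e e0; apply: filterS (cX y e0) => n.
    by move=> /(_ y); rewrite y0 lexx distrC => /(_ isT)[].
  by move=> /(_ y); rewrite y0 lexx [`|cfs P0 _ _ - _|]distrC => /(_ isT)[].
have [x0|x0] := leP 0 x; first exact: pos.
have [|h1 h2] := pos (- x); first by rewrite oppr_ge0 ltW.
rewrite -(opprK x) cfcN cfsN//; split.
  by under eq_fun do rewrite cfcN.
by under eq_fun => n do rewrite (cfsN (P n) (@mX n)); exact: cvgN.
Qed.

Lemma trig_poly_bounded d' (T' : measurableType d') (Y : T' -> R) (g : R -> R) :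
  measurable_fun setT Y -> trig_poly g -> bounded_rv (g \o Y).
Proof.
move=> mY [s]; apply: bounded_rv_sum => i; apply: bounded_rvD.
  by apply: bounded_rvZ; exact: bounded_rv_cos.
by apply: bounded_rvZ; exact: bounded_rv_sin.
Qed.

Lemma trig_poly_mean d' (T' : measurableType d') (P' : probability T' R) (Y : T' -> R)
    (s : seq (R * R * R)) : measurable_fun setT Y ->
  mean P' ((fun x => \sum_(i <- s) (i.1.1 * cos (i.2 * x) + i.1.2 * sin (i.2 * x))) \o Y) =
  \sum_(i <- s) (i.1.1 * cfc P' Y i.2 + i.1.2 * cfs P' Y i.2).
Proof.
move=> mY.
have bc (i : R * R * R) := bounded_rvZ (i.1.1 : R) (bounded_rv_cos mY i.2).
have bs (i : R * R * R) := bounded_rvZ (i.1.2 : R) (bounded_rv_sin mY i.2).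
rewrite [LHS](mean_sum P' s (fun i => bounded_rvD (bc i) (bs i))).
apply: eq_bigr => i _; rewrite (meanD P' (bc i) (bs i)).
by rewrite !meanZ//; [exact: bounded_rv_sin|exact: bounded_rv_cos].
Qed.

Lemma trig_poly_cvg g : trig_poly g ->
  mean (P n) (g \o X n) @[n --> \oo] --> mean P0 (g \o X0).
Proof.
move=> [s]; rewrite trig_poly_mean//.
under eq_fun => n do rewrite (trig_poly_mean (P n) s (@mX n)).
elim: s => [|i s IH].
  by rewrite big_nil; under eq_fun do rewrite big_nil; exact: cvg_cst.
rewrite big_cons.
rewrite (_ : (fun n => _) = fun n =>
  i.1.1 * cfc (P n) (X n) i.2 + i.1.2 * cfs (P n) (X n) i.2 +
  \sum_(i <- s) (i.1.1 * cfc (P n) (X n) i.2 + i.1.2 * cfs (P n) (X n) i.2)); last first.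
  by apply/funext => n; rewrite big_cons.
have [c1 c2] := cf_cvg_pt i.2.
by apply: cvgD => //; apply: cvgD; apply: cvgMr.
Qed.

Let m_gt d' (T' : measurableType d') (Y : T' -> R) (M : R) :
  measurable_fun setT Y -> measurable [set w | M < `|Y w|].
Proof. by move=> mY; apply: measurable_gt; exact: measurableT_comp. Qed.

Let mean_ge d' (T' : measurableType d') (P' : probability T' R) (Y : T' -> R)
    (g : R -> R) (b e M : R) : measurable_fun setT Y -> trig_poly g -> 0 <= e ->
  (forall x, 0 <= g x) -> (forall x : R, `|x| <= M -> x <= b -> 1 - e <= g x) ->
  prob P' [set w | Y w <= b] <=
  mean P' (g \o Y) + e + prob P' [set w | M < `|Y w|].
Proof.
move=> mY tg e0 g0 gP.
have bg := trig_poly_bounded mY tg.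
have mA := measurable_le b mY; have mB := m_gt M mY.
rewrite -!mean_indic// -(mean_cst P' e).
have bA := bounded_rv_indic R mA; have bB := bounded_rv_indic R mB.
have be := bounded_rv_cst T' e.
have bge := bounded_rvD bg be.
rewrite -(meanD P' bg be) -(meanD P' bge bB).
apply: le_mean => //; first exact: bounded_rvD.
move=> w /=; rewrite !indicE !in_setb /=.
have [xM|xM] := leP `|Y w| M.
  rewrite /= ?mulr0n addr0; have [xb|_] := leP (Y w) b; first by rewrite mulr1n; have := gP _ xM xb; lra.
  by rewrite addr_ge0.
by case: (Y w <= b); have := g0 (Y w); move: e0; rewrite ?mulr1n ?mulr0n; lra.
Qed.

Let mean_le d' (T' : measurableType d') (P' : probability T' R) (Y : T' -> R)
    (g : R -> R) (b e M : R) : measurable_fun setT Y -> trig_poly g -> 0 <= e ->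
  (forall x, g x <= 1) -> (forall x : R, `|x| <= M -> b <= x -> g x <= e) ->
  mean P' (g \o Y) <=
  prob P' [set w | Y w <= b] + e + prob P' [set w | M < `|Y w|].
Proof.
move=> mY tg e0 g1 gP.
have bg := trig_poly_bounded mY tg.
have mA := measurable_le b mY; have mB := m_gt M mY.
rewrite -!mean_indic// -(mean_cst P' e).
have bA := bounded_rv_indic R mA; have bB := bounded_rv_indic R mB.
have be := bounded_rv_cst T' e.
have bAe := bounded_rvD bA be.
rewrite -(meanD P' bA be) -(meanD P' bAe bB).
apply: le_mean => //; first exact: bounded_rvD.
move=> w /=; rewrite !indicE !in_setb /=.
have [xM|xM] := leP `|Y w| M.
  rewrite /= ?mulr0n addr0; have [xb|xb] := leP (Y w) b; first by rewrite mulr1n; have := g1 (Y w); lra.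
  by rewrite add0r; apply: gP => //; exact: ltW.
by case: (Y w <= b); have := g1 (Y w); move: e0; rewrite ?mulr1n ?mulr0n; lra.
Qed.

(** The indicator of ]-oo, a] lies between the trigonometric steps centered at
    a - r / 2 and a + r / 2, up to e / 5 on a large interval. *)
Lemma cdf_close (a r e : R) : 0 < r -> 0 < e -> \forall n \near \oo,
  prob (P n) [set w | X n w <= a] <= prob P0 [set w | X0 w <= a + r] + e /\
  prob P0 [set w | X0 w <= a - r] - e <= prob (P n) [set w | X n w <= a].
Proof.
move=> r0 e0; have e50 : 0 < e / 5 by rewrite divr_gt0.
have r20 : 0 < r / 2 by rewrite divr_gt0.
have [M1 [M10 PM1]] := tX e50.
have [M2 M20 PM2] := tail_small P0 mX0 e50.
pose M := Num.max (Num.max M1 M2) (`|a| + r).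
have M1M : M1 <= M by rewrite !le_max lexx.
have M2M : M2 <= M by rewrite !le_max lexx orbT.
have aM : `|a| + r <= M by rewrite !le_max lexx !orbT.
have hM1 : `|a + r / 2| + r / 2 <= M.
  by have := ler_normD a (r / 2); rewrite (gtr0_norm r20); lra.
have hM2 : `|a - r / 2| + r / 2 <= M.
  by have := ler_normB a (r / 2); rewrite (gtr0_norm r20); lra.
have [g [tg gP]] := trig_poly_step r20 e50 hM1.
have [h [th hP]] := trig_poly_step r20 e50 hM2.
have tail0 : prob P0 [set w | M < `|X0 w|] < e / 5.
  apply: le_lt_trans PM2; apply: le_prob; [exact: m_gt|exact: m_gt|].
  by move=> w /=; exact: le_lt_trans.
have eE1 : a + r / 2 - r / 2 = a by rewrite addrK.
have eE2 : a + r / 2 + r / 2 = a + r by rewrite -addrA -splitr.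
have eE3 : a - r / 2 - r / 2 = a - r by rewrite -addrA -opprD -splitr.
have eE4 : a - r / 2 + r / 2 = a by rewrite subrK.
have m1 : mean P0 (g \o X0) <=
    prob P0 [set w | X0 w <= a + r] + e / 5 + prob P0 [set w | M < `|X0 w|].
  apply: mean_le => // [|x|x xM xa]; first exact: ltW.
    by have [/andP[]] := gP x.
  by have [_ /(_ xM)[_]] := gP x; rewrite eE2; apply.
have m2 : prob P0 [set w | X0 w <= a - r] <=
    mean P0 (h \o X0) + e / 5 + prob P0 [set w | M < `|X0 w|].
  apply: mean_ge => // [|x|x xM xa]; first exact: ltW.
    by have [/andP[]] := hP x.
  by have [_ /(_ xM)[+ _]] := hP x; rewrite eE3; apply.
near=> n.
have tailn : prob (P n) [set w | M < `|X n w|] < e / 5.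
  apply: (@le_lt_trans _ _ (prob (P n) [set w | M1 < `|X n w|])); last by near: n.
  apply: le_prob; [exact/m_gt/mX|exact/m_gt/mX|].
  by move=> w /=; exact: le_lt_trans.
have cg : `|mean P0 (g \o X0) - mean (P n) (g \o X n)| <= e / 5.
  by near: n; have /cvgrPdist_le := trig_poly_cvg tg; apply.
have ch : `|mean P0 (h \o X0) - mean (P n) (h \o X n)| <= e / 5.
  by near: n; have /cvgrPdist_le := trig_poly_cvg th; apply.
have m3 : prob (P n) [set w | X n w <= a] <=
    mean (P n) (g \o X n) + e / 5 + prob (P n) [set w | M < `|X n w|].
  apply: mean_ge => // [|x|x xM xa]; first exact: ltW.
    by have [/andP[]] := gP x.
  by have [_ /(_ xM)[+ _]] := gP x; rewrite eE1; apply.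
have m4 : mean (P n) (h \o X n) <=
    prob (P n) [set w | X n w <= a] + e / 5 + prob (P n) [set w | M < `|X n w|].
  apply: mean_le => // [|x|x xM xa]; first exact: ltW.
    by have [/andP[]] := hP x.
  by have [_ /(_ xM)[_]] := hP x; rewrite eE4; apply.
move: cg ch; rewrite !ler_norml => /andP[? ?] /andP[? ?].
by split; lra.
Unshelve. all: by end_near. Qed.

(** Without an atom at a, the limiting distribution function is continuous at a
    and the shift r of [cdf_close] can be made harmless. *)
Lemma cdf_cvg (a : R) : prob P0 [set w | X0 w = a] = 0 ->
  prob (P n) [set w | X n w <= a] @[n --> \oo] --> prob P0 [set w | X0 w <= a].
Proof.
move=> a0; apply/cvgrPdist_le => e e0; have e20 : 0 < e / 2 by rewrite divr_gt0.
pose r n : R := n.+1%:R^-1.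
have r0 n : 0 < r n by rewrite invr_gt0.
have mle c : measurable [set w | X0 w <= c] by exact: measurable_le.
have up : prob P0 [set w | X0 w <= a + r n] @[n --> \oo] --> prob P0 [set w | X0 w <= a].
  rewrite (_ : [set w | X0 w <= a] = \bigcap_n [set w | X0 w <= a + r n]).
    apply: fine_cvg; rewrite -prob_fin; last exact: bigcap_measurableType.
    apply: nonincreasing_cvg_mu => //.
    - by rewrite (le_lt_trans (probability_le1 _ _)) ?ltry.
    - exact: bigcap_measurableType.
    - move=> m n mn; apply/subsetPset => w /= h; apply: le_trans h _.
      by rewrite lerD2l lef_pV2 ?posrE// ler_nat.
  apply/seteqP; split=> w /=; first by move=> h n _ /=; rewrite (le_trans h)// lerDl ltW.
  move=> h; apply/ler_addgt0Pl => y y0.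
  have [n ny] : exists n, r n <= y.
    exists (Num.truncn y^-1); rewrite invf_ple ?posrE//.
    by rewrite ltW// truncnS_gt.
  by apply: (le_trans (h n I)); rewrite addrC lerD2r.
have dn : prob P0 [set w | X0 w <= a - r n] @[n --> \oo] --> prob P0 [set w | X0 w <= a].
  have -> : prob P0 [set w | X0 w <= a] = prob P0 (\bigcup_n [set w | X0 w <= a - r n]).
    have mb : measurable (\bigcup_n [set w | X0 w <= a - r n]) by exact: bigcup_measurable.
    rewrite (prob_setD P0 (mle a) mb) setIidr; last first.
      by move=> w [n _] /= h; apply: (le_trans h); rewrite gerBl ltW.
    rewrite -[RHS]add0r; congr (_ + _).
    have ma : measurable [set w | X0 w = a].
      by rewrite -[X in measurable X]setTI; apply: (mX0 _ (measurable_set1 a)).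
    apply/eqP; rewrite eq_le prob_ge0 andbT -a0; apply: le_prob => //.
      exact: measurableD.
    move=> w /= [xa nx]; apply/eqP; rewrite eq_le xa/= leNgt; apply/negP => lt.
    apply: nx; have [n ny] : exists n, r n <= a - X0 w.
      exists (Num.truncn (a - X0 w)^-1); rewrite invf_ple ?posrE ?subr_gt0//.
      by rewrite ltW// truncnS_gt.
    by exists n => //=; move: ny; lra.
  apply: prob_nondecreasing_cvg => // m n mn; apply/subsetPset => w /= h.
  apply: (le_trans h); rewrite lerD2l lerN2 lef_pV2 ?posrE// ler_nat//.
have /cvgrPdist_le/(_ _ e20)[N1 _ NP1] := up.
have /cvgrPdist_le/(_ _ e20)[N2 _ NP2] := dn.
have h1 := NP1 N1 (leqnn _); have h2 := NP2 N2 (leqnn _).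
near=> n.
have [c1 _] : prob (P n) [set w | X n w <= a] <= prob P0 [set w | X0 w <= a + r N1] + e / 2 /\
  prob P0 [set w | X0 w <= a - r N1] - e / 2 <= prob (P n) [set w | X n w <= a].
  by near: n; exact: cdf_close.
have [_ c2] : prob (P n) [set w | X n w <= a] <= prob P0 [set w | X0 w <= a + r N2] + e / 2 /\
  prob P0 [set w | X0 w <= a - r N2] - e / 2 <= prob (P n) [set w | X n w <= a].
  by near: n; exact: cdf_close.
move: h1 h2; rewrite /= !ler_norml => /andP[? ?] /andP[? ?].
by apply/andP; split; lra.
Unshelve. all: by end_near. Qed.

(** Halving the threshold leaves room for the shifts of [cdf_close]. *)
Lemma abs_tail_close (a e : R) : 0 < a -> 0 < e -> \forall n \near \oo,
  prob (P n) [set w | a < `|X n w|] <= prob P0 [set w | a / 2 < `|X0 w|] + e.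
Proof.
move=> a0 e0; have e20 : 0 < e / 2 by rewrite divr_gt0.
have a40 : 0 < a / 4 by rewrite divr_gt0.
near=> n.
have [_ c1] : prob (P n) [set w | X n w <= a] <= prob P0 [set w | X0 w <= a + a / 4] + e / 2 /\
  prob P0 [set w | X0 w <= a - a / 4] - e / 2 <= prob (P n) [set w | X n w <= a].
  by near: n; exact: cdf_close.
have [c2 _] : prob (P n) [set w | X n w <= - a] <= prob P0 [set w | X0 w <= - a + a / 4] + e / 2 /\
  prob P0 [set w | X0 w <= - a - a / 4] - e / 2 <= prob (P n) [set w | X n w <= - a].
  by near: n; exact: cdf_close.
have mXn := @mX n.
have U1 := prob_setU (P n) (measurableC (measurable_le a mXn)) (measurable_le (- a) mXn).
rewrite prob_setC in U1; last exact: measurable_le.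
have S1 : prob (P n) [set w | a < `|X n w|] <=
    prob (P n) (~` [set w | X n w <= a] `|` [set w | X n w <= - a]).
  apply: le_prob.
  - exact: m_gt.
  - by apply: measurableU; [apply: measurableC|]; exact: measurable_le.
  - move=> w /=; rewrite lter_normr => /orP[h|h]; [left|right].
      by apply/negP; rewrite -ltNge.
    by move: h; lra.
have mA := measurable_le (a - a / 4) mX0; have mB := measurable_le (- a + a / 4) mX0.
have dis : (~` [set w | X0 w <= a - a / 4]) `&` [set w | X0 w <= - a + a / 4] = set0.
  apply/seteqP; split=> // w /= [/negP]; rewrite -ltNge.
  by move: a0; lra.
have := prob_setD P0 (measurableU _ _ (measurableC mA) mB) mB.
rewrite setIC setKU setDUl setDv setU0 => E.
have S2 : prob P0 (~` [set w | X0 w <= a - a / 4]) + prob P0 [set w | X0 w <= - a + a / 4]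
    <= prob P0 [set w | a / 2 < `|X0 w|].
  have E2 : prob P0 (~` [set w | X0 w <= a - a / 4] `|` [set w | X0 w <= - a + a / 4]) =
    prob P0 (~` [set w | X0 w <= a - a / 4]) + prob P0 [set w | X0 w <= - a + a / 4].
    rewrite E; congr (_ + _); congr prob.
    by apply/seteqP; split=> w /= => [[]//|h]; split=> // h'; have : set0 w by rewrite -dis.
  rewrite -E2; apply: le_prob.
  - by apply: measurableU => //; exact: measurableC.
  - exact: m_gt.
  - move=> w /= [/negP|]; rewrite lter_normr; rewrite -?ltNge => h; apply/orP.
      by left; move: h a0; lra.
    by right; move: h a0; lra.
rewrite prob_setC// in S2.
by lra.
Unshelve. all: by end_near. Qed.

End cdf_convergence.

(** * Halving the time of a Levy process *)

Section levy_cf.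
Context d (T : measurableType d) (R : realType) (P : probability T R).
Variables (V : levy_process P) (G : levy_triplet R).
Hypothesis VG : has_triplet V G.

(** The Levy exponent is linear in time. *)
Lemma levy_cf_exp : exists a b : R -> R, forall t x : R, 0 <= t ->
  cfc P (V t) x = expR (t * a x) * cos (t * b x) /\
  cfs P (V t) x = expR (t * a x) * sin (t * b x).
Proof.
exists (fun x => complex.Re (levy_exponent G 1 x)),
       (fun x => complex.Im (levy_exponent G 1 x)) => t x t0.
have := VG x t0.
have -> : levy_exponent G t x = (t * complex.Re (levy_exponent G 1 x) +i*
    (t * complex.Im (levy_exponent G 1 x)))%C.
  rewrite /levy_exponent.
  move: (cintegral (levy_measure_left _) _ _) (cintegral (levy_measure_right _) _ _).
  move=> [u1 u2] [v1 v2] /=; rewrite /= !mul0r !subr0 !addr0 !mul1r ?oppr0 ?add0r.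
  by congr (_ +i* _)%C; field.
rewrite /cintegral /cexp /= => -[].
have E y : 0 * y - 1 * 0 = 0 :> R by rewrite mul0r mul1r subr0.
have E' y : 0 * 0 + 1 * y = y :> R by rewrite mul0r add0r mul1r.
rewrite /cfc /cfs /mean /Rintegral => h1 h2.
by split; [rewrite -h1|rewrite -h2]; congr fine; apply: eq_integral => w _;
  rewrite E E' expR0 mul1r.
Qed.

End levy_cf.

Section levy_half.
Context (R : realType) (d : nat -> measure_display)
  (T : forall n, measurableType (d n)) (P : forall n, probability (T n) R)
  (d0 : measure_display) (T0 : measurableType d0) (P0 : probability T0 R)
  (G : nat -> levy_triplet R) (G0 : levy_triplet R).
Variables (V : forall n, levy_process (P n)) (V0 : levy_process P0).
Hypotheses (HV : forall n, has_triplet (V n) (G n)) (HV0 : has_triplet V0 G0).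

Let half_cf d' (T' : measurableType d') (P' : probability T' R)
    (W : levy_process P') (H : levy_triplet R) : has_triplet W H ->
  forall t x : R, 0 <= t ->
  [/\ cfc P' (W t) x = cfc P' (W (t / 2)) x ^+ 2 - cfs P' (W (t / 2)) x ^+ 2,
      cfs P' (W t) x = 2 * cfc P' (W (t / 2)) x * cfs P' (W (t / 2)) x &
      0 < cfc P' (W (t / 2)) x ^+ 2 + cfs P' (W (t / 2)) x ^+ 2].
Proof.
move=> HW t x t0; have [a [b ab]] := levy_cf_exp HW.
have t20 : 0 <= t / 2 by rewrite divr_ge0.
have [-> ->] := ab _ x t0; have [-> ->] := ab _ x t20.
have tE y : t * y = t / 2 * y + t / 2 * y by rewrite -mulrDl -splitr.
rewrite (tE (a x)) (tE (b x)) expRD cosD sinD; split.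
- by ring.
- by ring.
- by rewrite !exprMn -mulrDr cos2Dsin2 mulr1 exprn_gt0// expR_gt0.
Qed.

Lemma cf_cvg_half (t : R) : 0 <= t ->
  cf_cvg P P0 (fun n => V n t) (V0 t) ->
  cf_cvg P P0 (fun n => V n (t / 2)) (V0 (t / 2)).
Proof.
move=> t0; have t20 : 0 <= t / 2 by rewrite divr_ge0.
apply: cf_cvg_sqrt.
- by move=> n; exact: lp_measurable.
- exact: lp_measurable.
- by move=> n x; have [] := half_cf (@HV n) x t0.
- by move=> x; have [] := half_cf HV0 x t0.
- by move=> x; have [] := half_cf HV0 x t0.
Qed.

(** If both increments over [0, t / 2] and [t / 2, t] exceed M, which are
    independent events with the same probability, then W t exceeds 2 M. *)
Let half_tail d' (T' : measurableType d') (P' : probability T' R)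
    (W : levy_process P') (t M : R) : 0 <= t ->
  prob P' [set w | M < `|W (t / 2) w|] ^+ 2 <=
  4 * prob P' [set w | 2 * M < `|W t w|].
Proof.
move=> t0; have t20 : 0 <= t / 2 by rewrite divr_ge0.
have mW (s : R) : 0 <= s -> measurable_fun setT (W s) by exact: lp_measurable.
pose B (a : bool) : set R := if a then [set x | M < x] else [set x | x < - M].
have mB a : measurable (B a).
  by case: a; [apply: measurable_gt|apply: measurable_lt].
have mWB (s : R) a : 0 <= s -> measurable [set w | B a (W s w)].
  move=> s0; rewrite -[X in measurable X]setTI; exact: (mW s s0).
have sq a : prob P' [set w | B a (W (t / 2) w)] ^+ 2 <=
    prob P' [set w | 2 * M < `|W t w|].
  have := @lp_independent _ _ _ _ W 2 (fun i => i%:R * (t / 2)) (fun=> B a).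
  rewrite mul0r => /(_ (lexx _)) H.
  have {}H : P' (\bigcap_(i < 2) (increment W (i%:R * (t / 2)) (i.+1%:R * (t / 2)) @^-1` B a)) =
     (\prod_(i < 2) P' (increment W (i%:R * (t / 2)) (i.+1%:R * (t / 2)) @^-1` B a))%E.
    by apply: H => // i j ij; rewrite ler_wpM2r// ler_nat.
  have inc i : P' (increment W (i%:R * (t / 2)) (i.+1%:R * (t / 2)) @^-1` B a) =
      P' [set w | B a (W (t / 2) w)].
    have -> : i.+1%:R * (t / 2) = i%:R * (t / 2) + t / 2 by rewrite -[X in X * _]natr1 mulrDl mul1r.
    rewrite lp_stationary ?mulr_ge0//.
    congr (P' _); apply/seteqP.
    by split=> w; rewrite /increment /= lp_start subr0.
  have -> : prob P' [set w | B a (W (t / 2) w)] ^+ 2 = prob P'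
     (\bigcap_(i < 2) (increment W (i%:R * (t / 2)) (i.+1%:R * (t / 2)) @^-1` B a)).
    rewrite /prob H big_ord_recl big_ord1 !inc.
    by rewrite fineM ?fin_num_measure ?expr2//; exact: mWB.
  apply: le_prob.
  - apply: bigcap_measurableType => i _; rewrite -[X in measurable X]setTI.
    by apply: measurable_funB => //; apply: mW; rewrite mulr_ge0.
  - by apply: measurable_gt; apply: measurableT_comp => //; exact: mW.
  - move=> w /= h; have h0 := h 0%N isT; have h1 := h 1%N isT.
    move: h0 h1; rewrite /increment /= mul0r mul1r lp_start subr0.
    rewrite (_ : 2 * (t / 2) = t); last by field.
    rewrite lter_normr; case: a {H inc h} => /= h0 h1; apply/orP.
      by left; move: h0 h1; lra.
    by right; move: h0 h1; lra.
have le : prob P' [set w | M < `|W (t / 2) w|] <=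
    prob P' [set w | B true (W (t / 2) w)] + prob P' [set w | B false (W (t / 2) w)].
  apply: le_trans (prob_setU _ (mWB _ _ t20) (mWB _ _ t20)).
  apply: le_prob.
  - by apply: measurable_gt; apply: measurableT_comp => //; exact: mW.
  - by apply: measurableU; exact: mWB.
  - move=> w /=; rewrite lter_normr => /orP[h|h]; [by left|right => /=].
    by rewrite ltrNr.
have := sq true; have := sq false; have := prob_ge0 P' [set w | M < `|W (t / 2) w|].
move: le; set x := prob _ _; set y := prob _ _; set z := prob _ _.
have := sqr_ge0 (y - z); have : 0 <= y by exact: prob_ge0.
have : 0 <= z by exact: prob_ge0.
by nra.
Qed.

Lemma tight_half (t : R) : 0 <= t ->
  tight P (fun n => V n t) -> tight P (fun n => V n (t / 2)).
Proof.
move=> t0 tV e e0; have e20 : 0 < e ^+ 2 / 4 by rewrite divr_gt0// exprn_gt0.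
have [M [M0 PM]] := tV _ e20.
exists (M / 2); split; first by rewrite divr_gt0.
apply: filterS PM => n h; have := half_tail (V n) (M / 2) t0.
rewrite (_ : 2 * (M / 2) = M); last by field.
move=> h'; rewrite ltNge; apply/negP => h''.
have : e ^+ 2 <= prob (P n) [set w | M / 2 < `|V n (t / 2) w|] ^+ 2.
  by rewrite lerXn2r// nnegrE ?prob_ge0// ltW.
by move: h h'; lra.
Qed.

Lemma dyadic_cf_cvg_tight m :
  cf_cvg P P0 (fun n => V n 1) (V0 1) -> tight P (fun n => V n 1) ->
  cf_cvg P P0 (fun n => V n (1 / (2 ^ m)%N%:R)) (V0 (1 / (2 ^ m)%N%:R)) /\
  tight P (fun n => V n (1 / (2 ^ m)%N%:R)).
Proof.
move=> c1 t1; elim: m => [|m [IH1 IH2]]; first by rewrite expn0 divr1.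
have -> : 1 / (2 ^ m.+1)%N%:R = 1 / (2 ^ m)%N%:R / 2 :> R.
  by rewrite expnSr natrM invfM mulrA.
by split; [exact: cf_cvg_half|exact: tight_half].
Qed.

End levy_half.

(** * Convergence of discretized paths *)

Section atoms.
Context d (T : measurableType d) (R : realType) (P : probability T R).

(** Atoms are countably many. *)
Lemma atom_free (Y : T -> R) (u v : R) : measurable_fun setT Y -> u < v ->
  exists2 a, u < a < v & prob P [set w | Y w = a] = 0.
Proof.
move=> mY uv.
pose Z : {RV P >-> R} := HB.pack Y (isMeasurableFun.Build _ _ _ _ Y mY).
have cZ := pmf_gt0_countable Z.
apply: contrapT => H.
have sub : `]u, v[%classic `<=` [set r | 0 < pmf Z r].
  move=> a; rewrite /= in_itv/= => auv; rewrite lt_neqAle fine_ge0// andbT.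
  by apply/eqP => pa; apply: H; exists a.
have := countable_lebesgue_measure0 (sub_countable (subset_card_le sub) cZ).
rewrite lebesgue_measure_itv/= lte_fin uv -EFinB => -[].
by move/eqP; rewrite subr_eq0 gt_eqF.
Qed.

End atoms.

Section cells.
Context (R : realType) (a : nat -> R).
Hypothesis inc_a : forall j, a j < a j.+1.

Lemma cells_nondecreasing i j : (i <= j)%N -> a i <= a j.
Proof.
elim: j => [|j IH]; first by rewrite leqn0 => /eqP ->.
by rewrite leq_eqVlt => /predU1P[-> //|/IH h]; exact: le_trans h (ltW _).
Qed.

Lemma cells_disjoint i j x : a i < x <= a i.+1 -> a j < x <= a j.+1 -> i = j.
Proof.
wlog ij : i j / (i < j)%N.
  move=> H hi hj; have [lt|lt|//] := ltngtP i j; first exact: H.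
  by apply/esym; exact: H.
move=> /andP[_ xi] /andP[jx _].
by have := lt_le_trans jx xi; rewrite ltNge cells_nondecreasing.
Qed.

Lemma cells_cover N x : a 0%N < x -> x <= a N ->
  exists2 j, (j < N)%N & a j < x <= a j.+1.
Proof.
move=> x0 xN; have ex : exists n, x <= a n by exists N.
case: (ex_minnP ex) => -[|j] xj jmin; first by move: x0; rewrite ltNge xj.
exists j; first by apply: leq_trans (jmin _ xN).
by rewrite xj andbT ltNge; apply/negP => /jmin; rewrite ltnn.
Qed.

End cells.

Section grid_approximation.
Context d (T : measurableType d) (R : realType) (P : probability T R).
Variable V : levy_process P.
Variables (k N : nat) (a : nat -> R) (g : skorohod R -> R) (L B del M : R).
Hypothesis inc_a : forall j, a j < a j.+1.
Hypothesis mesh_a : forall j, a j.+1 - a j <= del.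
Hypotheses (aM : a 0%N < - M) (Ma : M <= a N).
Hypothesis L0 : 0 <= L.
Hypothesis gL : forall x y e, skorohod_close x y e -> `|g x - g y| <= L * e.
Hypothesis gB : forall x, `|g x| <= B.
Hypothesis mg : measurable_fun setT (g \o grid_path V k.+1).

Let del0 : 0 <= del.
Proof. by apply: le_trans _ (mesh_a 0); rewrite subr_ge0 ltW. Qed.

Let X i w := V (i.+1%:R / k.+1%:R) w - V (i%:R / k.+1%:R) w.

Let mX i : measurable_fun setT (X i).
Proof. by apply: measurable_funB; exact: levy_grid_measurable. Qed.

Let lawX i (C : set R) : measurable C ->
  prob P [set w | C (X i w)] = prob P [set w | C (V (1 / k.+1%:R) w)].
Proof. by move=> mC; rewrite /X -add1n addnC levy_grid_stationary. Qed.

(** The value of g on a discretized path whose increments are rounded to the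
    lower ends a (c i) of their cells. *)
Definition cell_value (c : {ffun 'I_k.+1 -> 'I_N}) : R :=
  g (step_path k.+1 (fun j => \sum_(i < j) a (c (inord i)))).

Definition cell_prob (j : nat) : R :=
  prob P [set w | V (1 / k.+1%:R) w <= a j.+1] - prob P [set w | V (1 / k.+1%:R) w <= a j].

Let cell (j : nat) : set R := [set x | a j < x <= a j.+1].

Let mcell j : measurable (cell j).
Proof.
rewrite (_ : cell j = `]a j, a j.+1]%classic); first exact: measurable_itv.
by apply/seteqP; split=> x /=; rewrite in_itv.
Qed.

Let cell_probE j : prob P [set w | cell j (V (1 / k.+1%:R) w)] = cell_prob j.
Proof.
have mV : measurable_fun setT (V (1 / k.+1%:R)) by exact: lp_measurable.
rewrite /cell_prob (prob_setD P (measurable_le (a j.+1) mV) (measurable_le (a j) mV)).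
rewrite setIidr; last by move=> w /= h; apply: le_trans h (ltW _).
rewrite addrK; congr prob; apply/seteqP; split=> w /=.
  by move=> /andP[h1 h2]; split=> //; apply/negP; rewrite -ltNge.
by move=> [h1 /negP]; rewrite -ltNge => h2; apply/andP.
Qed.

Let A (c : {ffun 'I_k.+1 -> 'I_N}) : set T :=
  \bigcap_(i < k.+1) X i @^-1` cell (c (inord i)).

Let mA c : measurable (A c).
Proof.
apply: bigcap_measurableType => i _.
by rewrite -[X in measurable X]setTI; exact: mX.
Qed.

Let PA c : prob P (A c) = \prod_(i < k.+1) cell_prob (c i).
Proof.
rewrite /A (@levy_grid_independent _ _ _ _ V k.+1 k.+1 (fun i => cell (c (inord i))))//.
by apply: eq_bigr => i _; rewrite inord_val -cell_probE -(lawX i (mcell _)).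
Qed.

Let out := \bigcup_(i < k.+1) [set w | M < `|X i w|].

Let mout : measurable out.
Proof.
apply: bigcup_measurable => i _; apply: measurable_gt.
by apply: measurableT_comp => //; exact: mX.
Qed.

Let pout : prob P out <= k.+1%:R * prob P [set w | M < `|V (1 / k.+1%:R) w|].
Proof.
apply: (le_trans (prob_bigcup _ _ _)) => [i|].
  by apply: measurable_gt; apply: measurableT_comp => //; exact: mX.
rewrite (eq_bigr (fun=> prob P [set w | M < `|V (1 / k.+1%:R) w|])).
  by rewrite sumr_const card_ord -[X in X <= _]mulr_natl.
move=> i _; apply: (lawX i (C := [set x | M < `|x|])).
by apply: measurable_gt; exact: normr_measurable.
Qed.

Let simple w := \sum_(c : {ffun 'I_k.+1 -> 'I_N}) cell_value c * \1_(A c) w.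

Let simpleE w c : A c w -> simple w = cell_value c.
Proof.
move=> Acw; rewrite /simple (bigD1 c)//= big1 ?addr0.
  by rewrite indicE mem_set// mulr1.
move=> c' cc'; rewrite indicE memNset ?mulr0// => Ac'w.
move/eqP: cc'; apply; apply/ffunP => i; apply/val_inj.
have h := Acw i (ltn_ord i); have h' := Ac'w i (ltn_ord i).
rewrite /= inord_val in h; rewrite /= inord_val in h'.
exact: cells_disjoint h' h.
Qed.

Let simple_bounded w : `|simple w| <= B.
Proof.
have [[c Acw]|nA] := pselect (exists c, A c w); first by rewrite (simpleE Acw); exact: gB.
rewrite /simple big1 ?normr0.
  exact: le_trans (normr_ge0 _) (gB (step_path 0 (fun=> 0))).
move=> c _; rewrite indicE memNset ?mulr0// => Acw.
by apply: nA; exists c.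
Qed.

Let simple_close w : ~ out w -> `|g (grid_path V k.+1 w) - simple w| <= L * (k.+1%:R * del).
Proof.
move=> nout.
have bnd i : (i < k.+1)%N -> `|X i w| <= M.
  by move=> ik; rewrite leNgt; apply/negP => h; apply: nout; exists i.
have /choice[c cP] : forall i : 'I_k.+1, exists j : 'I_N, cell j (X i w).
  move=> i; have := bnd _ (ltn_ord i); rewrite ler_norml => /andP[h1 h2].
  have [j jN jP] := cells_cover (lt_le_trans aM h1) (le_trans h2 Ma).
  by exists (Ordinal jN).
have Acw : A (finfun c) w.
  by move=> i /= ik; rewrite ffunE; have := cP (inord i); rewrite inordK.
rewrite (simpleE Acw) /cell_value; apply: gL; apply: step_close => j jk.
have -> : V (j%:R / k.+1%:R) w = \sum_(i < j) X i w.
  rewrite -(big_mkord xpredT (fun i => X i w)).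
  by rewrite (telescope_sumr (fun i => V (i%:R / k.+1%:R) w))// levy_grid0 subr0.
rewrite -sumrB; apply: (le_trans (ler_norm_sum _ _ _)).
apply: (@le_trans _ _ (\sum_(i < j) del)).
  apply: ler_sum => i _; have ik : (i < k.+1)%N by exact: leq_trans jk.
  rewrite ffunE; have := cP (inord i); rewrite inordK// => /andP[h1 h2].
  rewrite ger0_norm ?subr_ge0 ?(ltW h1)//.
  by apply: le_trans _ (mesh_a (c (inord i))); rewrite lerD2r.
by rewrite sumr_const card_ord -[X in X <= _]mulr_natl ler_wpM2r// ler_nat.
Qed.

(** As long as no increment exceeds M, rounding the increments to their cells
    moves the path by at most k.+1 * del; and by independence the mean of g on
    the rounded path is a polynomial in the probabilities of the cells. *)
Lemma grid_mean_approx :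
  `|mean P (g \o grid_path V k.+1) -
    \sum_(c : {ffun 'I_k.+1 -> 'I_N}) cell_value c * \prod_(i < k.+1) cell_prob (c i)|
  <= L * (k.+1%:R * del) +
     2 * B * (k.+1%:R * prob P [set w | M < `|V (1 / k.+1%:R) w|]).
Proof.
have B0 : 0 <= B by exact: le_trans (normr_ge0 _) (gB (step_path 0 (fun=> 0))).
have bi c := bounded_rvZ (cell_value c) (bounded_rv_indic R (mA c)).
have -> : \sum_(c : {ffun 'I_k.+1 -> 'I_N}) cell_value c * \prod_(i < k.+1) cell_prob (c i) =
    mean P simple.
  rewrite /simple (mean_sum P _ bi); apply: eq_bigr => c _.
  by rewrite meanZ ?mean_indic ?PA//; exact: bounded_rv_indic.
apply: (@le_trans _ _ (L * (k.+1%:R * del) + 2 * B * prob P out)).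
  apply: mean_close => //.
  - by split=> //; exists B => w; exact: gB.
  - exact: (bounded_rv_sum _ bi).
  - by rewrite !mulr_ge0.
  - by move=> w; exact: gB.
by rewrite lerD2l ler_wpM2l// mulr_ge0.
Qed.

End grid_approximation.

Section grid_convergence.
Context (R : realType) (d : nat -> measure_display)
  (T : forall n, measurableType (d n)) (P : forall n, probability (T n) R)
  (d0 : measure_display) (T0 : measurableType d0) (P0 : probability T0 R).
Variables (V : forall n, levy_process (P n)) (V0 : levy_process P0).
Variables (k : nat) (g : skorohod R -> R) (L B : R).
Hypothesis L0 : 0 <= L.
Hypothesis gL : forall x y e, skorohod_close x y e -> `|g x - g y| <= L * e.
Hypothesis gB : forall x, `|g x| <= B.
Hypothesis cg : continuous g.
Hypothesis cV : cf_cvg P P0 (fun n => V n (1 / k.+1%:R)) (V0 (1 / k.+1%:R)).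
Hypothesis tV : tight P (fun n => V n (1 / k.+1%:R)).

(** The ends of the cells are chosen outside the atoms of the limit, so that the
    probabilities of the cells converge. *)
Lemma grid_path_mean_cvg :
  mean (P n) (g \o grid_path (V n) k.+1) @[n --> \oo] -->
  mean P0 (g \o grid_path V0 k.+1).
Proof.
apply/cvgrPdist_le => e e0.
have B0 : 0 <= B by exact: le_trans (normr_ge0 _) (gB (step_path 0 (fun=> 0))).
pose K : R := k.+1%:R; have K0 : 0 < K by [].
pose del := e / 5 / ((L + 1) * K).
have L1 : 0 < L + 1 by rewrite ltr_wpDl.
have del0 : 0 < del by rewrite !divr_gt0// mulr_gt0.
have Ldel : L * (K * del) <= e / 5.
  have -> : L * (K * del) = e / 5 * (L / (L + 1)).
    by rewrite /del; field; rewrite !gt_eqF.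
  rewrite ler_piMr//; first by rewrite divr_ge0// ltW.
  by rewrite ler_pdivrMr// mul1r lerDl.
pose s := e / 5 / ((2 * B + 1) * K).
have B1 : 0 < 2 * B + 1 by rewrite ltr_wpDl// mulr_ge0.
have s0 : 0 < s by rewrite !divr_gt0// mulr_gt0.
have Bs q : q <= s -> 2 * B * (K * q) <= e / 5.
  move=> qs; apply: (@le_trans _ _ (2 * B * (K * s))).
    by rewrite ler_wpM2l ?mulr_ge0// ler_pM2l.
  have -> : 2 * B * (K * s) = e / 5 * (2 * B / (2 * B + 1)).
    by rewrite /s; field; rewrite !gt_eqF.
  rewrite ler_piMr//; first by rewrite divr_ge0// ltW.
  by rewrite ler_pdivrMr// mul1r lerDl.
have mV n : measurable_fun setT (V n (1 / k.+1%:R)) by exact: lp_measurable.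
have mV0 : measurable_fun setT (V0 (1 / k.+1%:R)) by exact: lp_measurable.
have [M1 [M10 PM1]] := tV s0.
have [M2 M20 PM2] := tail_small P0 mV0 s0.
pose M := Num.max M1 M2.
have m_gt d' (T' : measurableType d') (Y : T' -> R) (c : R) : measurable_fun setT Y ->
    measurable [set w | c < `|Y w|].
  by move=> mY; apply: measurable_gt; exact: measurableT_comp.
pose u (j : nat) := - M - del + j%:R * (del / 2).
have uS j : u j.+1 = u j + del / 2 by rewrite /u -natr1; ring.
have /choice[a aP] : forall j, exists a : R, u j < a < u j.+1 /\
    prob P0 [set w | V0 (1 / k.+1%:R) w = a] = 0.
  move=> j; have [|a a1 a2] := @atom_free _ _ _ P0 _ (u j) (u j.+1) mV0.
    by rewrite uS ltrDl divr_gt0.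
  by exists a.
have inc_a j : a j < a j.+1.
  by have [/andP[_ h] _] := aP j; have [/andP[h' _] _] := aP j.+1; exact: lt_trans h'.
have mesh_a j : a j.+1 - a j <= del.
  have [/andP[h _] _] := aP j; have [/andP[_ h'] _] := aP j.+1.
  by move: h h'; rewrite !uS; lra.
have aM : a 0%N < - M.
  have [/andP[_ h] _] := aP 0%N; apply: (lt_le_trans h).
  by rewrite uS /u mul0r; move: del0; lra.
pose N := (Num.truncn ((2 * M + del) / (del / 2))).+1.
have Ma : M <= a N.
  have [/andP[h _] _] := aP N; apply: le_trans (ltW h).
  have : (2 * M + del) / (del / 2) < N%:R by exact: truncnS_gt.
  have del20 : 0 < del / 2 by exact: divr_gt0.
  by rewrite ltr_pdivrMr// /u; lra.
have appr d' (T' : measurableType d') (P' : probability T' R) (W : levy_process P') :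
    prob P' [set w | M < `|W (1 / k.+1%:R) w|] <= s ->
    `|mean P' (g \o grid_path W k.+1) - \sum_(c : {ffun 'I_k.+1 -> 'I_N})
       cell_value a g c * \prod_(i < k.+1) cell_prob W k a (c i)| <= 2 * (e / 5).
  move=> Ws; apply: (le_trans (grid_mean_approx inc_a mesh_a aM Ma L0 gL gB
    (grid_path_measurable W k.+1 cg))).
  by have := Bs _ Ws; move: Ldel; rewrite -/K; lra.
have F_cvg j : prob (P n) [set w | V n (1 / k.+1%:R) w <= a j] @[n --> \oo] -->
    prob P0 [set w | V0 (1 / k.+1%:R) w <= a j].
  by apply: (cdf_cvg mV mV0 cV tV); have [] := aP j.
have S_cvg : \sum_(c : {ffun 'I_k.+1 -> 'I_N})
       cell_value a g c * \prod_(i < k.+1) cell_prob (V n) k a (c i) @[n --> \oo] -->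
    \sum_(c : {ffun 'I_k.+1 -> 'I_N})
       cell_value a g c * \prod_(i < k.+1) cell_prob V0 k a (c i).
  apply: cvg_big => [|c _]; first exact: add_continuous.
  apply: cvgMr; apply: cvg_big => [|i _]; first exact: mul_continuous.
  by apply: cvgB; exact: F_cvg.
have h0 : prob P0 [set w | M < `|V0 (1 / k.+1%:R) w|] <= s.
  apply: le_trans (ltW PM2); apply: le_prob; [exact: m_gt|exact: m_gt|].
  by move=> w /=; apply: le_lt_trans; rewrite le_max lexx orbT.
near=> n.
have hn : prob (P n) [set w | M < `|V n (1 / k.+1%:R) w|] <= s.
  apply: (@le_trans _ _ (prob (P n) [set w | M1 < `|V n (1 / k.+1%:R) w|])).
    apply: le_prob; [exact: m_gt|exact: m_gt|].
    by move=> w /=; apply: le_lt_trans; rewrite le_max lexx.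
  by apply: ltW; near: n.
have e50 : 0 < e / 5 by rewrite divr_gt0.
have := appr _ _ _ V0 h0; have := appr _ _ _ (V n) hn.
have : `|\sum_(c : {ffun 'I_k.+1 -> 'I_N}) cell_value a g c *
      \prod_(i < k.+1) cell_prob V0 k a (c i) -
    \sum_(c : {ffun 'I_k.+1 -> 'I_N}) cell_value a g c *
      \prod_(i < k.+1) cell_prob (V n) k a (c i)| <= e / 5.
  by near: n; have /cvgrPdist_le := S_cvg; apply; rewrite divr_gt0.
rewrite !ler_norml => /andP[? ?] /andP[? ?] /andP[? ?].
by apply/andP; split; lra.
Unshelve. all: by end_near. Qed.

End grid_convergence.

(** * Convergence of Lipschitz functionals *)

Section grid_error.
Context d (T : measurableType d) (R : realType) (P : probability T R).
Variable V : levy_process P.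
Variables (g : skorohod R -> R) (L B : R).
Hypothesis L0 : 0 <= L.
Hypothesis gL : forall x y e, skorohod_close x y e -> `|g x - g y| <= L * e.
Hypothesis gB : forall x, `|g x| <= B.
Hypothesis cg : continuous g.

Lemma grid_multiple_mean_cvg k : (0 < k)%N ->
  mean P (g \o grid_path V (k * r)%N) @[r --> \oo] --> mean P (g \o levy_path V).
Proof.
move=> k0; apply: (@mean_cvg _ _ _ P _ _ B).
- by move=> n; exact: grid_path_measurable.
- by move=> n w; exact: gB.
move=> w /=; apply: continuous_skorohod_cvg => // e e0.
have [N _ NP] := grid_path_cvg V w e0.
by exists N => // r /= Nr; apply: NP; exact: leq_trans Nr (leq_pmull _ k0).
Qed.

Lemma grid_mean_close k (e p : R) : (0 < k)%N -> 0 < e ->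
  prob P [set w | e < `|V (1 / k%:R) w|] <= p -> 12 * p < 1 ->
  `|mean P (g \o grid_path V k) - mean P (g \o levy_path V)| <=
  L * Num.max k%:R^-1 (80 * e) + 2 * B * (k%:R * (8 * p) ^+ 2 + 8 * p).
Proof.
move=> k0 e0 Hp p12.
have B0 : 0 <= B by exact: le_trans (normr_ge0 _) (gB (step_path 0 (fun=> 0))).
have bg j : bounded_rv (g \o grid_path V j).
  by split; [exact: grid_path_measurable|exists B => w; exact: gB].
apply: (cvgr_to_le (f := fun r => `|mean P (g \o grid_path V k) -
    mean P (g \o grid_path V (k * r)%N)|) (F := \oo)).
  by apply: cvg_norm; apply: cvgB; [exact: cvg_cst|exact: grid_multiple_mean_cvg].
near=> r.
have r0 : (0 < r)%N by near: r; exact: nbhs_infty_gt.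
have [A [mA PA] Aclose] := grid_refine_close k0 r0 e0 Hp p12.
apply: (@le_trans _ _ (L * Num.max k%:R^-1 (80 * e) + 2 * B * prob P A)).
  apply: mean_close => //.
  - by rewrite mulr_ge0// le_max invr_ge0 ler0n.
  - by move=> w; exact: gB.
  - by move=> w; exact: gB.
  - by move=> w nA; apply: gL; exact: Aclose.
by rewrite lerD2l ler_wpM2l// mulr_ge0.
Unshelve. all: by end_near. Qed.

End grid_error.

Section lipschitz.
Context (R : realType) (d : nat -> measure_display)
  (T : forall n, measurableType (d n)) (P : forall n, probability (T n) R)
  (d0 : measure_display) (T0 : measurableType d0) (P0 : probability T0 R).
Variables (V : forall n, levy_process (P n)) (V0 : levy_process P0).
Hypothesis dyadic : forall m,
  cf_cvg P P0 (fun n => V n (1 / (2 ^ m)%N%:R)) (V0 (1 / (2 ^ m)%N%:R)) /\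
  tight P (fun n => V n (1 / (2 ^ m)%N%:R)).
Variables (g : skorohod R -> R) (L B : R).
Hypothesis L0 : 0 <= L.
Hypothesis gL : forall x y e, skorohod_close x y e -> `|g x - g y| <= L * e.
Hypothesis gB : forall x, `|g x| <= B.
Hypothesis cg : continuous g.

Lemma lipschitz_mean_cvg :
  mean (P n) (g \o levy_path (V n)) @[n --> \oo] --> mean P0 (g \o levy_path V0).
Proof.
apply/cvgrPdist_le => e e0.
have B0 : 0 <= B by exact: le_trans (normr_ge0 _) (gB (step_path 0 (fun=> 0))).
have e60 : 0 < e / 6 by rewrite divr_gt0.
have L10 : 0 < L + 1 by rewrite ltr_wpDl.
have B10 : 0 < 80 * B + 1 by rewrite ltr_wpDl// mulr_ge0.
pose e1 := e / 6 / (L + 1); have e10 : 0 < e1 by rewrite divr_gt0.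
have Le1 : L * e1 <= e / 6.
  rewrite /e1 mulrA ler_pdivrMr// mulrC ler_wpM2l ?lerDl// ltW//.
(* th bounds sqrt N * p0 and sqrt N * s below, for the grid of mesh 1 / (2 N);
   the comparison of paths then fails with probability at most 40 * th *)
pose th := Num.min (1 / 25) (e / 6 / (80 * B + 1)).
have th0 : 0 < th by rewrite lt_min !divr_gt0.
have th1 : th <= 1 / 25 by rewrite ge_min lexx.
have Bth : 2 * B * (40 * th) <= e / 6.
  have : th <= e / 6 / (80 * B + 1) by rewrite ge_min lexx orbT.
  by rewrite ler_pdivlMr//; move: th0; lra.
pose eps := e1 / 80; have eps0 : 0 < eps by rewrite divr_gt0.
have [N1 _ N1P] : \forall N \near \oo,
    N%:R * prob P0 [set w | eps / 2 < `|V0 (1 / N.*2%:R) w|] ^+ 2 <= th ^+ 2.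
  have eps20 : 0 < eps / 2 by rewrite divr_gt0.
  have := levy_pair_cvg0 V0 eps20; move/cvgr_le; apply.
  by rewrite exprn_gt0.
have [N2 _ N2P] : \forall r \near \oo,
    `|mean P0 (g \o levy_path V0) - mean P0 (g \o grid_path V0 (1 * r)%N)| <= e / 6.
  by have /cvgrPdist_le := @grid_multiple_mean_cvg _ _ _ P0 V0 g B gB cg 1 (ltn0Sn 0); apply.
pose N3 := (Num.truncn e1^-1).+1.
pose m := (N1 + N2 + N3)%N; pose N := (2 ^ m)%N.
have mN : (m <= N)%N by apply: ltnW; exact: ltn_expl.
have N0 : (0 < N)%N by rewrite expn_gt0.
have NR : 1 <= N%:R :> R by rewrite ler1n.
have kE : N.*2 = (2 ^ m.+1)%N by rewrite expnS mul2n.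
have c1 := N1P N (leq_trans (leq_trans (leq_addr _ _) (leq_addr _ _)) mN).
have c2 : `|mean P0 (g \o levy_path V0) - mean P0 (g \o grid_path V0 N.*2)| <= e / 6.
  have := N2P N.*2; rewrite mul1n; apply => /=.
  rewrite -addnn (leq_trans _ (leq_addr _ _))// (leq_trans _ mN)//.
  by rewrite /m addnAC leq_addl.
have c3 : N.*2%:R^-1 <= e1.
  rewrite invf_ple ?posrE ?ltr0n ?double_gt0//.
  apply: (@le_trans _ _ N3%:R); first by rewrite ltW// truncnS_gt.
  rewrite ler_nat -addnn (leq_trans _ (leq_addr _ _))// (leq_trans _ mN)//.
  by rewrite leq_addl.
set p0 := prob P0 _ in c1.
have p00 : 0 <= p0 by exact: prob_ge0.
pose s := th / N%:R.
have s0 : 0 < s by rewrite divr_gt0// ltr0n.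
have Ns : N%:R * s = th by rewrite mulrC divfK// pnatr_eq0 -lt0n.
have sth : s <= th by rewrite ler_pdivrMr ?ltr0n// ler_peMr// ltW.
have p0th : p0 <= th.
  rewrite -(@ler_pXn2r _ 2) ?nnegrE ?(ltW th0)//.
  by apply: le_trans c1; rewrite ler_peMl// sqr_ge0.
pose p := p0 + s.
have p12 : 12 * p < 1 by rewrite /p; lra.
have bad : N.*2%:R * (8 * p) ^+ 2 + 8 * p <= 40 * th.
  have h1 : N%:R * s ^+ 2 <= th ^+ 2.
    by rewrite expr2 mulrA Ns expr2 ler_wpM2l// ltW.
  have h2 : N%:R * p ^+ 2 <= 2 * (N%:R * p0 ^+ 2) + 2 * (N%:R * s ^+ 2).
    have -> : 2 * (N%:R * p0 ^+ 2) + 2 * (N%:R * s ^+ 2) =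
      N%:R * (2 * p0 ^+ 2 + 2 * s ^+ 2) by ring.
    rewrite ler_wpM2l ?ler0n// /p -subr_ge0.
    by rewrite (_ : _ - _ = (p0 - s) ^+ 2) ?sqr_ge0//; ring.
  have h3 : th ^+ 2 <= th * (1 / 25) by rewrite expr2 ler_wpM2l// ltW.
  have -> : N.*2%:R * (8 * p) ^+ 2 = 128 * (N%:R * p ^+ 2).
    by rewrite -muln2 natrM; ring.
  by move: h1 h2 h3 c1; rewrite /p; lra.
have [cV tV] := dyadic m.+1; rewrite -kE in cV tV.
have [k kS] : exists k, N.*2 = k.+1.
  by exists N.*2.-1; rewrite prednK// double_gt0.
have mV n t : 0 <= t -> measurable_fun setT (V n t) by exact: lp_measurable.
near=> n.
have d1 : `|mean P0 (g \o grid_path V0 N.*2) -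
            mean (P n) (g \o grid_path (V n) N.*2)| <= e / 6.
  near: n; rewrite kS; rewrite kS in cV tV.
  by have /cvgrPdist_le := grid_path_mean_cvg L0 gL gB cg cV tV; apply.
have d2 : prob (P n) [set w | eps < `|V n (1 / N.*2%:R) w|] <= p.
  near: n.
  apply: (@abs_tail_close _ _ _ P _ _ P0 (fun n => V n (1 / N.*2%:R))) => //.
    by move=> n; exact: lp_measurable.
  exact: lp_measurable.
have N20 : (0 < N.*2)%N by rewrite double_gt0.
have d3 := grid_mean_close L0 gL gB cg N20 eps0 d2 p12.
have d4 : L * Num.max N.*2%:R^-1 (80 * eps) <= e / 6.
  apply: le_trans Le1; rewrite ler_wpM2l// ge_max c3 /eps.
  by rewrite [80 * _]mulrC divfK//= lexx.
have d5 : 2 * B * (N.*2%:R * (8 * p) ^+ 2 + 8 * p) <= e / 6.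
  by apply: le_trans Bth; rewrite ler_wpM2l// mulr_ge0.
have {d4 d5}d3 := le_trans d3 (lerD d4 d5).
move: c2 d1 d3; rewrite !ler_norml => /andP[? ?] /andP[? ?] /andP[? ?].
by apply/andP; split; lra.
Unshelve. all: by end_near. Qed.

End lipschitz.

(** * From Lipschitz to continuous functionals *)

Section lipschitz_regularization.
Context {R : realType}.
Variables (f : skorohod R -> R) (B : R).
Hypothesis cf : continuous f.
Hypothesis fB : forall x, `|f x| <= B.
Implicit Types x y : skorohod R.

(** The largest m-Lipschitz function below f. *)
Definition lipschitz_minorant (m : nat) x : R :=
  inf [set f y + m%:R * skorohod_dist x y | y in setT].

Let B0 : 0 <= B.
Proof. exact: le_trans (normr_ge0 _) (fB (step_path 0 (fun=> 0))). Qed.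

Let low m x : lbound [set f y + m%:R * skorohod_dist x y | y in setT] (- B).
Proof.
move=> _ [y _ <-]; have := fB y; rewrite ler_norml => /andP[h _].
by rewrite ler_wpDr// mulr_ge0// skorohod_dist_ge0.
Qed.

Let hasinf m x : has_inf [set f y + m%:R * skorohod_dist x y | y in setT].
Proof. by split; [exists (f x + m%:R * skorohod_dist x x), x|exists (- B); exact: low]. Qed.

Lemma lipschitz_minorant_le m x y :
  lipschitz_minorant m x <= f y + m%:R * skorohod_dist x y.
Proof. by apply: ge_inf; [have [] := hasinf m x|exists y]. Qed.

Lemma lipschitz_minorant_below m x : lipschitz_minorant m x <= f x.
Proof.
by apply: (le_trans (lipschitz_minorant_le m x x)); rewrite skorohod_distxx mulr0 addr0.
Qed.

Lemma lipschitz_minorant_bounded m x : `|lipschitz_minorant m x| <= B.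
Proof.
rewrite ler_norml; apply/andP; split.
  by apply: lb_le_inf; [have [] := hasinf m x|exact: low].
apply: (le_trans (lipschitz_minorant_below m x)).
exact: le_trans (ler_norm _) (fB x).
Qed.

Lemma lipschitz_minorant_lipschitz m x y :
  `|lipschitz_minorant m x - lipschitz_minorant m y| <= m%:R * skorohod_dist x y.
Proof.
have half u v : lipschitz_minorant m u - m%:R * skorohod_dist u v <=
    lipschitz_minorant m v.
  apply: lb_le_inf; first by have [] := hasinf m v.
  move=> _ [z _ <-]; have := lipschitz_minorant_le m u z.
  have : m%:R * skorohod_dist u z <= m%:R * (skorohod_dist u v + skorohod_dist v z).
    by rewrite ler_wpM2l// skorohod_dist_triangle.
  by lra.
have h1 := half x y; have := half y x; rewrite skorohod_dist_sym => h2.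
by rewrite ler_norml; apply/andP; split; lra.
Qed.

Lemma lipschitz_minorant_continuous m : continuous (lipschitz_minorant m).
Proof.
move=> x A /nbhs_ballP[e /= e0 eA]; apply/nbhs_ballP.
have m0 : 0 < m.+1%:R :> R by [].
exists (e / m.+1%:R); first by rewrite /= divr_gt0.
move=> y; rewrite ballEmdist/= => xy; apply: eA.
rewrite -ball_normE/=; apply: (le_lt_trans (lipschitz_minorant_lipschitz m x y)).
move: xy; rewrite ltr_pdivlMr// mulrC; apply: le_lt_trans.
by rewrite ler_wpM2r ?skorohod_dist_ge0// ler_nat.
Qed.

(** If m r >= 2 B, the points at distance at least r from x do not matter in
    the infimum. *)
Lemma lipschitz_minorant_cvg x : lipschitz_minorant m x @[m --> \oo] --> f x.
Proof.
apply/cvgrPdist_le => e e0.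
have /nbhs_ballP[r /= r0 rP] := cf (nbhsx_ballx (f x) e e0).
near=> m.
have mr : 2 * B <= m%:R * r.
  rewrite -ler_pdivrMr//; near: m; exact: nbhs_infty_ger.
rewrite ger0_norm ?subr_ge0 ?lipschitz_minorant_below// lerBlDr -lerBlDl.
apply: lb_le_inf; first by have [] := hasinf m x.
move=> _ [y _ <-]; have [xy|xy] := ltP (skorohod_dist x y) r.
  have := rP y; rewrite ballEmdist/= => /(_ xy).
  rewrite -ball_normE/= => /ltW; rewrite ler_norml => /andP[_ h].
  have : 0 <= m%:R * skorohod_dist x y by rewrite mulr_ge0// skorohod_dist_ge0.
  by lra.
have : m%:R * r <= m%:R * skorohod_dist x y by rewrite ler_wpM2l.
have := fB x; have := fB y; rewrite !ler_norml => /andP[? ?] /andP[? ?].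
by move: mr e0; lra.
Unshelve. all: by end_near. Qed.

End lipschitz_regularization.

Section continuous_functionals.
Context (R : realType) (d : nat -> measure_display)
  (T : forall n, measurableType (d n)) (P : forall n, probability (T n) R)
  (d0 : measure_display) (T0 : measurableType d0) (P0 : probability T0 R).
Variables (V : forall n, levy_process (P n)) (V0 : levy_process P0).
Hypothesis dyadic : forall m,
  cf_cvg P P0 (fun n => V n (1 / (2 ^ m)%N%:R)) (V0 (1 / (2 ^ m)%N%:R)) /\
  tight P (fun n => V n (1 / (2 ^ m)%N%:R)).

Let bounded_path d' (T' : measurableType d') (P' : probability T' R)
    (W : levy_process P') (f : skorohod R -> R) (B : R) :
  continuous f -> (forall x, `|f x| <= B) -> bounded_rv (f \o levy_path W).
Proof.
move=> cf fB; split; first exact: levy_path_measurable.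
by exists B => w; exact: fB.
Qed.

(** f is above its Lipschitz minorants, whose means converge. *)
Let liminf_mean (f : skorohod R -> R) (B e : R) : continuous f ->
  (forall x, `|f x| <= B) -> 0 < e -> \forall n \near \oo,
  mean P0 (f \o levy_path V0) - e <= mean (P n) (f \o levy_path (V n)).
Proof.
move=> cf fB e0; have e20 : 0 < e / 2 by rewrite divr_gt0.
have cl := lipschitz_minorant_continuous fB.
have bl := lipschitz_minorant_bounded fB.
have [m _ mP] : \forall m \near \oo, `|mean P0 (f \o levy_path V0) -
    mean P0 (lipschitz_minorant f m \o levy_path V0)| <= e / 2.
  have : mean P0 (lipschitz_minorant f m \o levy_path V0) @[m --> \oo] -->
      mean P0 (f \o levy_path V0).
    apply: (@mean_cvg _ _ _ P0 _ _ B).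
    - by move=> n; apply: levy_path_measurable; exact: cl.
    - by move=> n w; exact: bl.
    - by move=> w; exact: (lipschitz_minorant_cvg cf fB).
  by move=> /cvgrPdist_le; apply.
have hm := mP m (leqnn m).
have lip x y c : skorohod_close x y c ->
    `|lipschitz_minorant f m x - lipschitz_minorant f m y| <= m%:R * c.
  move=> xy; apply: (le_trans (lipschitz_minorant_lipschitz fB m x y)).
  by rewrite ler_wpM2l// skorohod_dist_le.
have := lipschitz_mean_cvg dyadic (ler0n R m) lip (bl m) (cl m).
move=> /cvgrPdist_le/(_ _ e20); apply: filterS => n hn.
have le : mean (P n) (lipschitz_minorant f m \o levy_path (V n)) <=
    mean (P n) (f \o levy_path (V n)).
  apply: le_mean.
  - exact: bounded_path (cl m) (bl m).
  - exact: bounded_path cf fB.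
  - by move=> w; exact: lipschitz_minorant_below.
by move: hm hn le; rewrite !ler_norml => /andP[? ?] /andP[? ?] ?; lra.
Qed.

(** The lower bound [liminf_mean] is applied to f and to - f. *)
Lemma levy_path_cvg_in_distribution :
  cvg_in_distribution P (fun n => levy_path (V n)) P0 (levy_path V0).
Proof.
move=> f cf [B fB].
rewrite (expectation_mean _ (bounded_path V0 cf fB)).
under eq_fun => n do rewrite (expectation_mean _ (bounded_path (V n) cf fB)).
apply: cvg_EFin; first exact: nearW.
apply/cvgrPdist_le => e e0.
have cNf : continuous (fun x => - f x) by move=> x; apply: continuous_comp; [exact: cf|exact: oppr_continuous].
have fNB x : `|- f x| <= B by rewrite normrN.
have mN d' (T' : measurableType d') (P' : probability T' R) (W : levy_process P') :
    mean P' ((fun x => - f x) \o levy_path W) = - mean P' (f \o levy_path W).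
  rewrite -[RHS]mulN1r -meanZ; last exact: bounded_path cf fB.
  by congr mean; apply/funext => w; rewrite /= mulN1r.
near=> n.
have h1 : mean P0 (f \o levy_path V0) - e <= mean (P n) (f \o levy_path (V n)).
  by near: n; exact: (liminf_mean cf fB).
have h2 : mean P0 ((fun x => - f x) \o levy_path V0) - e <=
    mean (P n) ((fun x => - f x) \o levy_path (V n)).
  by near: n; exact: (liminf_mean cNf fNB).
rewrite !mN in h2.
by rewrite /= ler_norml; apply/andP; split; lra.
Unshelve. all: by end_near. Qed.

End continuous_functionals.

(** Time changes fix 1, so that paths that are close in D[0, 1] have close
    values at 1. *)
Lemma skorohod_eval1_continuous (R : realType) :
  continuous (fun x : skorohod R => x 1).
Proof.
move=> x A /nbhs_ballP[e /= e0 eA]; apply/nbhs_ballP; exists e => //= y.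
rewrite ballEmdist/= => /skorohod_dist_adherent[e' e'e [l lc lP]].
apply: eA; rewrite -ball_normE/=; apply: le_lt_trans e'e.
have [mo _ im] := lc; have [_ l1] := time_change_endpoints mo im.
by have := lP 1; rewrite in_itv/= ler01 lexx l1 => /(_ isT)[].
Qed.

Theorem theorem1 (R : realType)
    (d : nat -> measure_display) (T : forall n, measurableType (d n))
    (P : forall n, probability (T n) R)
    (d0 : measure_display) (T0 : measurableType d0) (P0 : probability T0 R)
    (G : nat -> levy_triplet R) (G0 : levy_triplet R)
    (V : forall n, levy_process (P n)) (V0 : levy_process P0)
    (HV : forall n, has_triplet (V n) (G n)) (HV0 : has_triplet V0 G0) :
  cvg_in_distribution P (fun n => levy_path (V n)) P0 (levy_path V0) <->
  cvg_in_distribution P (fun n => V n 1) P0 (V0 1).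
Proof.
split=> [cvgD f cf [B fB]|cvg1].
  have at1 d' (T' : measurableType d') (P' : probability T' R) (W : levy_process P') :
      f \o W 1 = (f \o (fun x : skorohod R => x 1)) \o levy_path W.
    by apply/funext => w; rewrite /= /restrict01 patchT// inE/= in_itv/= ler01 lexx.
  rewrite at1; under eq_fun do rewrite at1.
  apply: cvgD; last by exists B => x; exact: fB.
  move=> x; apply: continuous_comp; last exact: cf.
  exact: skorohod_eval1_continuous.
have mV n : measurable_fun setT (V n 1) by exact: lp_measurable.
have mV0 : measurable_fun setT (V0 1) by exact: lp_measurable.
apply: levy_path_cvg_in_distribution => m.
apply: (dyadic_cf_cvg_tight HV HV0).
- exact: weak_cf_cvg mV mV0 cvg1.
- exact: weak_tight mV mV0 cvg1.
Qed.
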